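(* If $-1/3\leq\beta\leq0$, then $$\Lambda_{n+1}^{(0,\beta)}>\Lambda_n^{(0,\beta)}\qquad\text{for every integer } n\geq0.$$ The same conclusion holds for the sequence $(\Lambda_n^{(\gamma,0)})_{n\geq0}$ when $-1/3\leq\gamma\leq0$, that is, $\Lambda_{n+1}^{(\gamma,0)}>\Lambda_n^{(\gamma,0)}$ for every $n\geq0$.
   Context: $P_n^{(\alpha,\beta)}$ is the Jacobi polynomial of degree $n$ normalised by $P_n^{(\alpha,\beta)}(1)=(\alpha+1)_n/n!$. For $\alpha,\beta>-1$ let $w_{\alpha,\beta}(t)=(1-t)^\alpha(1+t)^\beta$, let $h_j^{(\alpha,\beta)}=\int_{-1}^1P_j^{(\alpha,\beta)}(t)^2w_{\alpha,\beta}(t)\,dt$, and put $$K_n^{(\alpha,\beta)}(x,t)=\sum_{j=0}^n\frac{P_j^{(\alpha,\beta)}(x)P_j^{(\alpha,\beta)}(t)}{h_j^{(\alpha,\beta)}},$$ $$\lambda_n^{(\alpha,\beta)}(x)=\int_{-1}^1\bigl|K_n^{(\alpha,\beta)}(x,t)\bigr|w_{\alpha,\beta}(t)\,dt,\qquad \Lambda_n^{(\alpha,\beta)}=\sup_{-1\leq x\leq1}\lambda_n^{(\alpha,\beta)}(x).$$ *)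

(* Defs.v *)
From HB Require Import structures.
From mathcomp Require Import all_boot all_order all_algebra.
From mathcomp Require Import all_classical all_reals all_analysis.

Set Implicit Arguments.
Unset Strict Implicit.
Unset Printing Implicit Defensive.

Import Order.TTheory GRing.Theory Num.Theory.
Import numFieldNormedType.Exports.

Local Open Scope classical_set_scope.
Local Open Scope ring_scope.

Definition pochhammer (R : realType) (a : R) (k : nat) : R :=
  \prod_(i < k) (a + i%:R).

(* (a+1)_n/n! 2F1(-n, n+a+b+1; a+1; (1-X)/2), multiplied through by the
   (a+1)_k of the denominators, so that no division by a parameter occurs. *)
Definition jacobi (R : realType) (a b : R) (n : nat) : {poly R} :=
  (n`!%:R)^-1 *:
    \sum_(k < n.+1)
      ('C(n, k)%:R * pochhammer (n%:R + a + b + 1) k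
        * pochhammer (a + k%:R + 1) (n - k)) *: (2^-1 *: ('X - 1)) ^+ k.

Lemma jacobi_at1 (R : realType) (a b : R) (n : nat) :
  (jacobi a b n).[1] = pochhammer (a + 1) n / n`!%:R.
Proof.
rewrite /jacobi hornerZ horner_sum big_ord_recl big1 => [|i _].
  by rewrite bin0 /pochhammer big_ord0 !mul1r subn0 addr0 hornerZ expr0 hornerC
             mulr1 !addr0 mulrC.
by rewrite hornerZ horner_exp hornerZ hornerD hornerX hornerN hornerC subrr
           mulr0 exprS mul0r mulr0.
Qed.

(* For a negative exponent, powR sends the base 0 to 0, so the weight takes the
   value 0 instead of +oo at an endpoint of [-1, 1]: a null set. *)
Definition jacobi_weight (R : realType) (a b t : R) : R :=
  (1 - t) `^ a * (1 + t) `^ b.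

Definition jacobi_norm2 (R : realType) (a b : R) (j : nat) : R :=
  \int[@lebesgue_measure R]_(t in `[-1, 1])
    ((jacobi a b j).[t] ^+ 2 * jacobi_weight a b t).

Definition jacobi_kernel (R : realType) (a b : R) (n : nat) (x t : R) : R :=
  \sum_(j < n.+1)
    (jacobi a b j).[x] * (jacobi a b j).[t] / jacobi_norm2 a b j.

(* Extended-real valued, so that neither the integral nor the supremum below
   needs a default value; both are finite when a, b > -1. *)
Definition lebesgue_function (R : realType) (a b : R) (n : nat) (x : R)
    : \bar R :=
  (\int[@lebesgue_measure R]_(t in `[(-1)%R, 1%R])
    (`|jacobi_kernel a b n x t| * jacobi_weight a b t)%:E)%E.

Definition lebesgue_constant (R : realType) (a b : R) (n : nat) : \bar R :=
  ereal_sup [set lebesgue_function a b n x | x in `[-1, 1]].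

(* Main.v *)
From HB Require Import structures.
Require Import Defs.
From mathcomp Require Import all_boot all_order all_algebra.
From mathcomp Require Import all_classical all_reals all_analysis.
From mathcomp Require Import measurable_realfun.
From mathcomp Require Import ring lra zify.
Set Implicit Arguments.
Unset Strict Implicit.
Unset Printing Implicit Defensive.
Import Order.TTheory GRing.Theory Num.Theory.
Import numFieldNormedType.Exports.
Local Open Scope classical_set_scope.
Local Open Scope ring_scope.

(** Take alpha = 0 and put X = (1 + t) / 2, b = beta + 1. A generalized
    translation T_Y, defined on the monomials X^m, commutes with the Jacobi
    operator, maps P_j to P_j(Y) P_j / P_j(1), preserves the weighted integral
    and, for -1/2 <= beta <= 0, preserves positivity. Hence K_n(x, .) is the
    translate of K_n(1, .), the L^1 norm does not increase, and the supremum
    Lambda_n is attained at x = 1.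

    There K_n(1, .) times the weight is the derivative of F = X^b J with J the
    Jacobi polynomial of parameters (0, b) normalised by J(1) = 1, so Lambda_n is
    the total variation of F. With t = cos theta and
    y = - tau dF/dtheta, tau = ((n + 1)(n + b))^(-1/2), the equation of J becomes
    the damped oscillator F' = - y / tau, y' = F / tau - y / g with
    g = sin theta / (b + (1 - b) cos theta). Write F = R cos psi, y = R sin psi:
    the critical points of F are those with psi = k pi, and the variation is the
    sum of the R_k + R_(k+1). In the variable u = psi,
    d(ln R^2)/du = - 2 sin^2 u / (g / tau - sin u cos u); for b >= 2/3 the
    function g is strictly concave, which makes g / tau at a given phase u larger
    for n + 1 than for n. So every amplitude R_k with k >= 1 increases strictly
    with n (while R_0 = 1), and the number of critical points does not decrease.
    If F has none for n, its variation is 1, which is exceeded for n + 1 because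
    J_(n+1) takes a negative value. The case beta = 0 follows by the reflection
    t -> - t. *)

(** The obstacle is the endpoint theta = 0: there [g] vanishes, the damping 1 / g is unbounded, and
    the phases and the quantities g / tau of the two motions all start equal. A comparison cannot
    start from a strict inequality; near 0 it needs a second argument that excludes the wrong order,
    and [initial_barrier] packages this. The phase is the right independent variable because at
    equal phase the terms sin^2 u and sin u cos u of the two motions coincide, so that only the
    values of g / tau compete.

    The bound -1/3 comes from the concavity of [g], which near theta = 0 amounts to 3 b - 2 >= 0.
    The positivity of the translation is Koornwinder's product formula, an average over two
    independent Beta variables, treated here through moments because only polynomials are
    translated.

    The variation is computed exactly for n and bounded below for n + 1 by means of as many critical
    points as occur for n, so that those of n + 1 are never counted. *)

(** * Propagation of signs along a differentiable function *)

Lemma is_derive_pos_left (R : realType) (d : R -> R) (s l e : R) :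
  is_derive s 1 d l -> 0 < l -> 0 < e -> exists2 u, s - e < u < s & d u < d s.
Proof.
move=> [/cvg_ex[l' dl']] dE l0 e0.
have El : l' = l by rewrite -dE; apply/esym/cvg_lim.
rewrite {}El in dl'.
have /dl' : nbhs l [set x : R | 0 < x] by apply: lt_nbhsr.
rewrite near_simpl => -[r /= r0 hr].
pose h := - (Num.min r e / 2).
have m0 : 0 < Num.min r e by rewrite lt_min r0 e0.
have h0 : h < 0 by rewrite /h oppr_lt0 divr_gt0.
have nh : `|h| = Num.min r e / 2 by rewrite ltr0_norm // /h opprK.
have hlt : Num.min r e / 2 < Num.min r e by lra.
have := hr h; rewrite /= sub0r normrN nh => /(_ _ _) H.
have {}H : 0 < h^-1 *: (d (h *: 1 + s) - d s).
  by apply: H; [rewrite (lt_le_trans hlt) // ge_min lexx | rewrite lt_eqF].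
exists (h + s).
  have : Num.min r e <= e by rewrite ge_min lexx orbT.
  by move: h0; rewrite /h => h0 me; apply/andP; split; lra.
move: H; rewrite /GRing.scale /= mulr1 nmulr_rgt0 ?invr_lt0 //.
by rewrite subr_lt0.
Qed.

Lemma derive_pos_incr (R : realType) (d df : R -> R) (a b : R) : a < b ->
  {within `[a, b], continuous d} ->
  (forall t, a < t < b -> is_derive t 1 d (df t) /\ 0 < df t) -> d a < d b.
Proof.
move=> ab cd hd; rewrite -subr_gt0.
have [] := @MVT R d df a b ab _ cd.
  by move=> x; rewrite in_itv => /hd[].
by move=> c; rewrite in_itv => /hd[_ ?] ->; rewrite mulr_gt0 // subr_gt0.
Qed.

Lemma derive_ge0_ndecr (R : realType) (d df : R -> R) (a b : R) : a <= b ->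
  {within `[a, b], continuous d} ->
  (forall t, a < t < b -> is_derive t 1 d (df t) /\ 0 <= df t) -> d a <= d b.
Proof.
rewrite le_eqVlt => /predU1P[<- //|ab] cd hd; rewrite -subr_ge0.
have [] := @MVT R d df a b ab _ cd.
  by move=> x; rewrite in_itv => /hd[].
by move=> c; rewrite in_itv => /hd[_ ?] ->; rewrite mulr_ge0 // subr_ge0 ltW.
Qed.

(** At the first point where [d] is not positive it vanishes with positive derivative, so it would
    be negative just before that point. *)
Lemma upcrossing_stays_pos (R : realType) (d df : R -> R) (a b : R) :
  a < b -> (forall t, a <= t <= b -> is_derive t 1 d (df t)) ->
  (forall t, a < t <= b -> d t = 0 -> 0 < df t) -> 0 < d a -> 0 < d b.
Proof.
move=> ab hd hz da; rewrite ltNge; apply/negP => db.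
pose S := [set u | a <= u <= b /\ d u <= 0].
have Sb : S b by rewrite /S /= lexx (ltW ab).
have lS : lbound S a by move=> u [/andP[]].
have hS : has_inf S by split; [exists b | exists a].
have aS : a <= inf S by apply: lb_le_inf => //; exists b.
have Sb' : inf S <= b by apply: ge_inf => //; exists a.
have cs : {for inf S, continuous d}.
  have := hd (inf S); rewrite aS Sb' => /(_ isT) -[h _].
  exact/differentiable_continuous/derivable1_diffP.
have ds : d (inf S) <= 0.
  rewrite leNgt; apply/negP => ds.
  have [r /= r0 hr] := cs _ (lt_nbhsr ds).
  have [u Su ult] := inf_adherent r0 hS.
  have iu : inf S <= u by apply: ge_inf => //; exists a.
  have /hr /= : ball_ Num.norm (inf S) r u.
    by rewrite /= ltr_norml; apply/andP; split; lra.
  by case: Su => _ ?; rewrite ltNge => /negP.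
have las : a < inf S.
  rewrite lt_neqAle aS andbT; apply/eqP => E.
  by move: ds; rewrite -E leNgt da.
have pos u : a <= u < inf S -> 0 < d u.
  move=> /andP[au us]; rewrite ltNge; apply/negP => du.
  have : S u by split => //; rewrite au /=; lra.
  by move=> /(ge_inf (ex_intro _ a lS)); rewrite leNgt us.
have ds0 : d (inf S) = 0.
  apply/eqP; rewrite eq_le ds /= leNgt; apply/negP => dn.
  have [r /= r0 hr] := cs _ (lt_nbhsl dn).
  pose u := Num.max a (inf S - r / 2).
  have u1 : a <= u by rewrite le_max lexx.
  have u2 : u < inf S by rewrite gt_max las /=; lra.
  have u3 : inf S - r / 2 <= u by rewrite le_max lexx orbT.
  have /hr /= : ball_ Num.norm (inf S) r u.
    by rewrite /= ltr_norml; apply/andP; split; lra.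
  by rewrite ltNge ltW // pos // u1 u2.
have hi : a <= inf S <= b by rewrite aS Sb'.
have hi' : a < inf S <= b by rewrite las Sb'.
have e0 : 0 < inf S - a by lra.
have [u] := is_derive_pos_left (hd _ hi) (hz _ hi' ds0) e0.
move=> /andP[u1 u2]; rewrite ds0 ltNge ltW // pos //.
by apply/andP; split => //; lra.
Qed.

(** Made for equations singular at 0, where [d] may vanish and has no known derivative. If
    [d t <= 0], then [d <= 0] on the whole of (0, t] by [upcrossing_stays_pos]; the last hypothesis
    then makes [d] increase from [d 0 >= 0], a contradiction. *)
Lemma initial_barrier (R : realType) (d df : R -> R) (b e : R) :
  0 < e -> {within `[0, b], continuous d} -> 0 <= d 0 ->
  (forall t, 0 < t < b -> is_derive t 1 d (df t)) ->
  (forall t, 0 < t < b -> d t = 0 -> 0 < df t) ->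
  (forall t, 0 < t < b -> t < e -> d t <= 0 -> 0 < df t) ->
  forall t, 0 < t < b -> 0 < d t.
Proof.
move=> e0 cd d0 hd hz hs t /andP[t0 tb]; rewrite ltNge; apply/negP => dt.
have neg s : 0 < s <= t -> d s <= 0.
  move=> /andP[s0]; rewrite le_eqVlt => /predU1P[-> //|st].
  rewrite leNgt; apply/negP => ds.
  move: dt; rewrite leNgt => /negP; apply.
  apply: (@upcrossing_stays_pos _ d df s t) => //.
    by move=> u /andP[? ?]; apply: hd; apply/andP; split; lra.
  by move=> u /andP[? ?]; apply: hz; apply/andP; split; lra.
pose s := Num.min t (e / 2).
have s0 : 0 < s by rewrite lt_min t0; lra.
have st : s <= t by rewrite ge_min lexx.
have se : s <= e / 2 by rewrite ge_min lexx orbT.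
have : d 0 < d s.
  apply: (@derive_pos_incr _ d df) => //.
    apply: continuous_subspaceW cd; apply: subset_itvl; rewrite bnd_simp; lra.
  move=> u /andP[u0 us]; split; first by apply: hd; apply/andP; split; lra.
  apply: hs; try lra.
  by apply: neg; rewrite u0; lra.
by rewrite ltNge => /negP; apply; rewrite (le_trans _ d0) // neg // s0.
Qed.

(** * Rules for derivatives and continuity on the line *)

Lemma is_derive1_mul (R : realType) (f g : R -> R) (x df dg : R) :
  is_derive x 1 f df -> is_derive x 1 g dg ->
  is_derive x 1 (fun t => f t * g t) (df * g x + f x * dg).
Proof.
move=> hf hg; apply: is_derive_eq (is_deriveM hf hg) _.
by rewrite /GRing.scale /=; ring.
Qed.

Lemma is_derive1_add (R : realType) (f g : R -> R) (x df dg : R) :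
  is_derive x 1 f df -> is_derive x 1 g dg ->
  is_derive x 1 (fun t => f t + g t) (df + dg).
Proof. by move=> hf hg; exact: is_deriveD. Qed.

Lemma is_derive1_sub (R : realType) (f g : R -> R) (x df dg : R) :
  is_derive x 1 f df -> is_derive x 1 g dg ->
  is_derive x 1 (fun t => f t - g t) (df - dg).
Proof. by move=> hf hg; exact: is_deriveB. Qed.

Lemma is_derive1_inv (R : realType) (f : R -> R) (x df : R) :
  is_derive x 1 f df -> f x != 0 ->
  is_derive x 1 (fun t => (f t)^-1) (- df / f x ^+ 2).
Proof.
move=> hf fx; apply: is_derive_eq (is_deriveV fx hf) _.
by rewrite /GRing.scale /= mulrC mulrN mulNr.
Qed.

Lemma is_derive1_div (R : realType) (f g : R -> R) (x df dg : R) :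
  is_derive x 1 f df -> is_derive x 1 g dg -> g x != 0 ->
  is_derive x 1 (fun t => f t / g t) ((df * g x - f x * dg) / g x ^+ 2).
Proof.
move=> hf hg gx; apply: is_derive_eq (is_derive1_mul hf (is_derive1_inv hg gx)) _.
by field.
Qed.

Section ContinuityHelpers.
Context {R : realType}.

Lemma continuous_within_comp (A : set R) (f g : R -> R) :
  {within A, continuous f} -> (forall x, A x -> {for f x, continuous g}) ->
  {within A, continuous (g \o f)}.
Proof.
move=> cf cg; rewrite continuous_subspace_in => x /set_mem Ax.
exact: (@continuous_comp (subspace A) R R f g x (cf x) (cg x Ax)).
Qed.

Lemma for_continuous_within (A : set R) (f : R -> R) :
  (forall x, A x -> {for x, continuous f}) -> {within A, continuous f}.
Proof. by move=> cf; apply: continuous_in_subspaceT => x /set_mem Ax; exact: cf. Qed.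

Lemma is_derive_continuous (f : R -> R) (x l : R) :
  is_derive x 1 f l -> {for x, continuous f}.
Proof. by move=> [h _]; exact/differentiable_continuous/derivable1_diffP. Qed.

Lemma within_itv_near0 (f : R -> R) (L M : R) : 0 < L -> f 0 < M ->
  {within `[0, L], continuous f} ->
  exists2 e, 0 < e & forall t, 0 < t < e -> t < L -> f t < M.
Proof.
move=> L0 fM /(continuous_within_itvP _ L0)[_ cf _].
have [r /= r0 hr] := cf _ (lt_nbhsl fM).
exists r => // t /andP[t0 tr] tL; apply: (hr t) => //=.
by rewrite sub0r normrN gtr0_norm.
Qed.

End ContinuityHelpers.

(** * Time as a function of an increasing phase *)

Section PhaseInverse.
Context {R : realType}.

Lemma increasing_inverse (p dp : R -> R) (T L : R) : 0 < T ->
  {within `[0, T], continuous p} -> p 0 = 0 -> p T = L ->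
  (forall t : R, 0 < t < T -> is_derive t 1 p (dp t) /\ 0 < dp t) ->
  exists q : R -> R, [/\ q 0 = 0, q L = T, {within `[0, L], continuous q} &
    forall u : R, 0 < u < L ->
      [/\ 0 < q u < T, p (q u) = u & is_derive u 1 q (dp (q u))^-1]].
Proof.
move=> T0 cp p0 pT hp.
have incr (s t : R) : 0 <= s -> s < t -> t <= T -> p s < p t.
  move=> s0 st tT; apply: (@derive_pos_incr _ p dp) => //.
    by apply: continuous_subspaceW cp; apply: subset_itv; rewrite bnd_simp.
  by move=> u /andP[? ?]; apply: hp; apply/andP; split; lra.
have inj (s t : R) : 0 <= s <= T -> 0 <= t <= T -> p s = p t -> s = t.
  move=> /andP[s0 sT] /andP[t0 tT] st; apply/eqP; rewrite eq_le.
  by apply/andP; split; rewrite leNgt; apply/negP => ts;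
    [have := incr t s t0 ts sT | have := incr s t s0 ts tT]; rewrite st ltxx.
pose q (u : R) : R := xget 0 [set t | 0 <= t <= T /\ p t = u].
have pK : {in `[0, T], cancel p q}.
  move=> t; rewrite in_itv /= => tT; rewrite /q.
  case: xgetP => [x _ [xT /inj]|/(_ t)[]//]; first exact.
have L0 : 0 < L by rewrite -pT -[X in X < _]p0 incr.
have cq : {within `[0, L], continuous q}.
  rewrite -pT -[X in `[X, _]]p0; apply: segment_can_le_continuous => //.
  exact: ltW.
have qK (u : R) : 0 <= u <= L -> 0 <= q u <= T /\ p (q u) = u.
  move=> uL; have [|t] := @IVT _ p 0 T u (ltW T0) cp.
    rewrite p0 pT; have/andP[u0 uL'] := uL.
    by rewrite ge_min u0 /= le_max uL' orbT.
  rewrite in_itv /= => tT ptu; rewrite -ptu pK ?in_itv //.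
exists q; split => //.
- by rewrite -[X in q X]p0 pK // in_itv /= lexx ltW.
- by rewrite -pT pK // in_itv /= lexx ltW.
move=> u /andP[u0 uL].
have [|/andP[q0 qT] pq] := qK u; first by rewrite !ltW.
have qb : 0 < q u < T.
  rewrite !lt_neqAle q0 qT !andbT; apply/andP; split; apply/eqP => E.
    by move: u0; rewrite -pq -E p0 ltxx.
  by move: uL; rewrite -pT -pq E ltxx.
split => //; have [dpq dpos] := hp _ qb.
suff : is_derive (p (q u)) 1 q (dp (q u))^-1 by rewrite pq.
apply: (@is_derive_inverse _ p q).
- near=> t; apply: pK; rewrite in_itv /=; apply/andP; split; apply: ltW.
    by near: t; apply: lt_nbhsr; case/andP: qb.
  by near: t; apply: lt_nbhsl; case/andP: qb.
- near=> t; have [|dt _] := hp t; last exact: is_derive_continuous dt.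
  apply/andP; split.
    by near: t; apply: lt_nbhsr; case/andP: qb.
  by near: t; apply: lt_nbhsl; case/andP: qb.
- by rewrite gt_eqF.
Unshelve. all: by end_near.
Qed.

End PhaseInverse.

(* The function [g] above; [1 / g] is the damping coefficient. *)
Definition recip_friction (R : realType) (b t : R) : R :=
  sin t / (b + (1 - b) * cos t).

Definition recip_friction' (R : realType) (b t : R) : R :=
  (b * cos t + (1 - b)) / (b + (1 - b) * cos t) ^+ 2.

(** * Positivity and strict concavity of the reciprocal damping *)

Section RecipFriction.
Context {R : realType}.
Variable b : R.
Hypothesis hb : 2 / 3 <= b <= 1.

Lemma friction_num_gt0 t : 0 < b + (1 - b) * cos t.
Proof.
have /andP[b0 b1] := hb; have c1 := cos_geN1 t; have c2 := cos_le1 t.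
have : (1 - b) * (-1) <= (1 - b) * cos t by apply: ler_wpM2l; lra.
lra.
Qed.

Lemma recip_friction_gt0 t : 0 < t < pi -> 0 < recip_friction b t.
Proof. by move=> ht; rewrite divr_gt0 ?friction_num_gt0 // sin_gt0_pi. Qed.

Lemma is_derive_recip_friction (t : R) :
  is_derive t 1 (recip_friction b) (recip_friction' b t).
Proof.
have d0 := friction_num_gt0 t.
have dn : b + (1 - b) * cos t != 0 by rewrite gt_eqF.
rewrite /recip_friction.
have h1 : is_derive t 1 (fun x : R => b + (1 - b) * cos x) ((1 - b) * - sin t).
  by apply: is_derive_eq; rewrite /GRing.scale /= !(mulr0, mul0r, add0r, addr0); ring.
apply: is_derive_eq (is_derive1_div (is_derive_sin t) h1 dn) _.
rewrite /recip_friction'.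
have -> : cos t * (b + (1 - b) * cos t) - sin t * ((1 - b) * - sin t) =
  b * cos t + (1 - b) * (cos t ^+ 2 + sin t ^+ 2) by ring.
by rewrite cos2Dsin2 mulr1.
Qed.

(** With c = cos s > d = cos t the difference factors as c - d times b^3 - (1 - b)^2 B, where B <= b
    + 2 because c, d <= 1. The worst case b^3 - (1 - b)^2 (b + 2) equals 3 b - 2: this is the origin
    of the threshold 2/3. *)
Lemma recip_friction'_decr s t : 0 < s -> s < t -> t < pi ->
  recip_friction' b t < recip_friction' b s.
Proof.
move=> s0 st tpi; have /andP[b0 b1] := hb.
have cst : cos t < cos s.
  by rewrite ltr_cos ?in_itv //=; apply/andP; split; lra.
have ds := friction_num_gt0 s; have dt := friction_num_gt0 t.
rewrite /recip_friction' ltr_pdivrMr ?exprn_gt0 // mulrAC ltr_pdivlMr ?exprn_gt0 //.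
have := cos_geN1 t; have := cos_le1 s.
move: (cos s) (cos t) cst {ds dt} => c d cd c1 d1.
rewrite -subr_gt0.
have -> : (b * c + (1 - b)) * (b + (1 - b) * d) ^+ 2 -
   (b * d + (1 - b)) * (b + (1 - b) * c) ^+ 2 =
   (c - d) * (b ^+ 3 - (1 - b) ^+ 2 * (2 * b + b * c * d + (1 - b) * (c + d))).
  by ring.
apply: mulr_gt0; first by lra.
have h1 : c * d < 1 by nra.
have h2 : c + d < 2 by lra.
have h3 : b * c * d <= b by nra.
have h4 : (1 - b) * (c + d) <= 2 * (1 - b) by nra.
have [b1'|b1'] := eqVneq b 1.
  by rewrite b1' subrr expr0n /= mul0r subr0 expr1n.
have e0 : 0 < 1 - b by rewrite subr_gt0 lt_neqAle b1'.
have e2 : 0 < (1 - b) ^+ 2 by rewrite exprn_gt0.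
have h5 : 2 * b + b * c * d + (1 - b) * (c + d) < b + 2 by nra.
have : (1 - b) ^+ 2 * (2 * b + b * c * d + (1 - b) * (c + d)) < (1 - b) ^+ 2 * (b + 2).
  by rewrite ltr_pM2l.
have : 0 <= b ^+ 3 - (1 - b) ^+ 2 * (b + 2).
  have -> : b ^+ 3 - (1 - b) ^+ 2 * (b + 2) = 3 * b - 2 by ring.
  by lra.
lra.
Qed.

Lemma recip_friction'_gt0 t : 0 < t < pi / 2 -> 0 < recip_friction' b t.
Proof.
move=> /andP[t0 tp]; have /andP[b0 b1] := hb.
apply: divr_gt0; last by rewrite exprn_gt0 // friction_num_gt0.
have c0 : 0 < cos t.
  by apply: cos_gt0_pihalf; rewrite tp andbT; lra.
by nra.
Qed.

End RecipFriction.

(** The angular velocity (F y' - y F') / (F^2 + y^2) of the damped oscillator at phase [p] and time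
    [t]. *)
Definition phase_speed (R : realType) (b tau p t : R) : R :=
  tau^-1 - cos p * sin p / recip_friction b t.

(** * Comparison of the phases and amplitudes for two values of tau *)

Section PhaseComparison.
Context {R : realType}.
Variables (b tau1 tau2 : R) (psi1 psi2 : R -> R).
Hypothesis hb : 2 / 3 <= b <= 1.
Hypothesis tau2_gt0 : 0 < tau2.
Hypothesis tau21 : tau2 < tau1.
Hypothesis psi1_cont : forall t, 0 <= t < pi -> {for t, continuous psi1}.
Hypothesis psi2_cont : forall t, 0 <= t < pi -> {for t, continuous psi2}.
Hypothesis psi1_0 : psi1 0 = 0.
Hypothesis psi2_0 : psi2 0 = 0.
Hypothesis psi1_der : forall t, 0 < t < pi ->
  is_derive t 1 psi1 (phase_speed b tau1 (psi1 t) t).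
Hypothesis psi2_der : forall t, 0 < t < pi ->
  is_derive t 1 psi2 (phase_speed b tau2 (psi2 t) t).

Lemma double_angle_le (p q : R) : `|p| < 1 / 2 -> `|q| < 1 / 2 -> p <= q ->
  cos p * sin p <= cos q * sin q.
Proof.
rewrite !ltr_norml => /andP[p1 p2] /andP[q1 q2].
rewrite le_eqVlt => /predU1P[-> //|pq].
have pi2 := @pi_ge2 R.
have := @ltr_sin R (p *+ 2) (q *+ 2).
rewrite !in_itv /= !sin_mulr2n => /(_ _ _) H.
have : (cos p * sin p) *+ 2 < (cos q * sin q) *+ 2.
  by rewrite H ?ltrMn2r //; apply/andP; split; rewrite -?[p *+ 2]mulr_natl -?[q *+ 2]mulr_natl; lra.
by rewrite ltrMn2r /= => /ltW.
Qed.

(** Where the phases agree, the speeds differ by 1/tau2 - 1/tau1 > 0. Near 0 both phases are so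
    small that cos p sin p increases with p; the wrong order [psi2 <= psi1] would then make the
    damping term favour [psi2], however large 1/g is. *)
Lemma phase_lt t : 0 < t < pi -> psi1 t < psi2 t.
Proof.
move=> /andP[t0 tpi].
have tau1_gt0 : 0 < tau1 := lt_trans tau2_gt0 tau21.
have dtau : 0 < tau2^-1 - tau1^-1 by rewrite subr_gt0 ltf_pV2.
have near0 (psi : R -> R) : psi 0 = 0 -> (forall t, 0 <= t < pi -> {for t, continuous psi}) ->
    exists2 e, 0 < e & forall s, 0 < s < e -> `|psi s| < 1 / 2.
  move=> p0 /(_ 0); rewrite lexx pi_gt0 => /(_ isT) c.
  have h0 : psi 0 < 1 / 2 by rewrite p0; lra.
  have h1 : - (1 / 2) < psi 0 by rewrite p0; lra.
  have [r /= r0 hr] := c _ (lt_nbhsl h0).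
  have [r' /= r0' hr'] := c _ (lt_nbhsr h1).
  exists (Num.min r r'); first by rewrite lt_min r0.
  move=> s /andP[s0]; rewrite lt_min => /andP[sr sr'].
  have ns : `|0 - s| = s by rewrite sub0r normrN gtr0_norm.
  rewrite ltr_norml; apply/andP; split.
    by apply: hr'; rewrite /= ns.
  by apply: hr; rewrite /= ns.
have [e1 e10 he1] := near0 _ psi1_0 psi1_cont.
have [e2 e20 he2] := near0 _ psi2_0 psi2_cont.
pose bb := (t + pi) / 2.
have tb : t < bb by rewrite /bb; lra.
have bpi : bb < pi by rewrite /bb; lra.
rewrite -subr_gt0.
pose dd u := phase_speed b tau2 (psi2 u) u - phase_speed b tau1 (psi1 u) u.
have ddE u : dd u = (tau2^-1 - tau1^-1) -
    (cos (psi2 u) * sin (psi2 u) - cos (psi1 u) * sin (psi1 u)) / recip_friction b u.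
  by rewrite /dd /phase_speed mulrBl; ring.
have e0 : 0 < Num.min e1 e2 by rewrite lt_min e10.
apply: (@initial_barrier R (fun u => psi2 u - psi1 u) dd bb _ e0).
- apply: for_continuous_within => x /=; rewrite in_itv /= => /andP[x0 xb].
  have xpi : 0 <= x < pi by apply/andP; split; lra.
  by apply: continuousB; [exact: psi2_cont | exact: psi1_cont].
- by rewrite psi1_0 psi2_0 subrr.
- move=> u /andP[u0 ub]; have up : 0 < u < pi by apply/andP; split; lra.
  by apply: is_derive1_sub; [exact: psi2_der | exact: psi1_der].
- move=> u _ /eqP; rewrite subr_eq0 => /eqP E.
  by rewrite ddE E subrr mul0r subr0.
- move=> u /andP[u0 ub]; rewrite lt_min => /andP[ue1 ue2] d0.
  have up : 0 < u < pi by apply/andP; split; lra.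
  rewrite ddE; apply: (lt_le_trans dtau); rewrite lerDl oppr_ge0.
  rewrite pmulr_lle0 ?invr_gt0 ?recip_friction_gt0 // subr_le0.
  apply: double_angle_le; [apply: he2|apply: he1|lra]; by rewrite u0.
- by rewrite t0.
Qed.

Variables (e1 e2 : R -> R) (T1 L : R).
Hypothesis T1_itv : 0 < T1 < pi.
Hypothesis psi1_T1 : psi1 T1 = L.
Hypothesis psi1_mono : forall t, 0 < t < T1 ->
  0 < phase_speed b tau1 (psi1 t) t.
Hypothesis psi2_mono : forall T, 0 < T < pi -> psi2 T = L ->
  forall t, 0 < t < T -> 0 < phase_speed b tau2 (psi2 t) t.
Hypothesis L_gt0 : 0 < L.
Hypothesis e1_cont : forall t, 0 <= t < pi -> {for t, continuous e1}.
Hypothesis e2_cont : forall t, 0 <= t < pi -> {for t, continuous e2}.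
Hypothesis e1_0 : e1 0 = 0.
Hypothesis e2_0 : e2 0 = 0.
Hypothesis e1_der : forall t, 0 < t < pi ->
  is_derive t 1 e1 (- (2 * sin (psi1 t) ^+ 2 / recip_friction b t)).
Hypothesis e2_der : forall t, 0 < t < pi ->
  is_derive t 1 e2 (- (2 * sin (psi2 t) ^+ 2 / recip_friction b t)).

(** As a function of the phase u, Y = g / tau satisfies dY/du = g' Y / (Y - m) with m = sin u cos u.
    Where Y1 = Y2 the slopes differ only by the factor g', which is larger for the second motion
    because it reaches the phase at an earlier time. [psi2_mono] is quantified over [T] because the
    time [T2] is only found here. *)
Lemma amplitude_lt : exists T2, [/\ 0 < T2 < pi, psi2 T2 = L & e1 T1 < e2 T2].
Proof.
have /andP[T10 T1pi] := T1_itv.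
have tau1_gt0 : 0 < tau1 := lt_trans tau2_gt0 tau21.
have within_of (f : R -> R) T : T < pi ->
    (forall t, 0 <= t < pi -> {for t, continuous f}) ->
    {within `[0, T], continuous f}.
  move=> Tpi cf; apply: for_continuous_within => x /=.
  by rewrite in_itv /= => /andP[x0 xT]; apply: cf; apply/andP; split; lra.
have LT1 : L < psi2 T1 by rewrite -psi1_T1; exact: phase_lt.
have [T2 T2itv psi2_T2] : exists2 T2, 0 < T2 < T1 & psi2 T2 = L.
  have [|T] := @IVT _ psi2 0 T1 L (ltW T10) (within_of _ _ T1pi psi2_cont).
    by rewrite psi2_0 ge_min (ltW L_gt0) /= le_max (ltW LT1) orbT.
  rewrite in_itv /= => /andP[T0 TT1] pT; exists T => //.
  rewrite !lt_neqAle T0 TT1 !andbT; apply/andP; split; apply/eqP => E.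
    by move: L_gt0; rewrite -pT -E psi2_0 ltxx.
  by move: LT1; rewrite -pT E ltxx.
have /andP[T20 T2T1] := T2itv.
have T2pi : 0 < T2 < pi by apply/andP; split; lra.
pose s1 t := phase_speed b tau1 (psi1 t) t.
pose s2 t := phase_speed b tau2 (psi2 t) t.
have hs1 t : 0 < t < T1 -> is_derive t 1 psi1 (s1 t) /\ 0 < s1 t.
  move=> /andP[t0 tT]; split; last by apply: psi1_mono; rewrite t0.
  by apply: psi1_der; apply/andP; split; lra.
have hs2 t : 0 < t < T2 -> is_derive t 1 psi2 (s2 t) /\ 0 < s2 t.
  move=> /andP[t0 tT]; split; last by apply: (psi2_mono T2pi) => //; rewrite t0.
  by apply: psi2_der; apply/andP; split; lra.
have T2pi' : T2 < pi by lra.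
have [q1 [q10 q1L q1c q1d]] :=
  increasing_inverse T10 (within_of _ _ T1pi psi1_cont) psi1_0 psi1_T1 hs1.
have [q2 [q20 q2L q2c q2d]] :=
  increasing_inverse T20 (within_of _ _ T2pi' psi2_cont) psi2_0 psi2_T2 hs2.
(* Otherwise the monotonicity of [psi2] gives psi2 (q1 u) <= u = psi1 (q1 u), against [phase_lt]. *)
have q21 u : 0 < u < L -> q2 u < q1 u.
  move=> hu; have [/andP[q1u0 q1uT] pq1 _] := q1d _ hu.
  have [/andP[q2u0 q2uT] pq2 _] := q2d _ hu.
  rewrite ltNge; apply/negP => q12.
  have : psi2 (q1 u) <= psi2 (q2 u).
    apply: (@derive_ge0_ndecr R psi2 s2) => //.
      apply: for_continuous_within => x /=; rewrite in_itv /= => /andP[? ?].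
      by apply: psi2_cont; apply/andP; split; lra.
    move=> t /andP[? ?]; have [|? ?] := hs2 t; first by apply/andP; split; lra.
    by split => //; exact: ltW.
  rewrite pq2 -[X in _ <= X]pq1 leNgt => /negP; apply; apply: phase_lt.
  by apply/andP; split; lra.
(* In these terms the speed at phase u is (Y - m) / (tau Y); its positivity gives Y > m, so that the
   divisions by Y - m below are legitimate. *)
pose Y1 u := recip_friction b (q1 u) / tau1.
pose Y2 u := recip_friction b (q2 u) / tau2.
pose m (u : R) := cos u * sin u.
have itv1 u : 0 < u < L -> 0 < q1 u < pi.
  by move=> /q1d[/andP[? ?] _ _]; apply/andP; split; lra.
have itv2 u : 0 < u < L -> 0 < q2 u < pi.
  by move=> /q2d[/andP[? ?] _ _]; apply/andP; split; lra.
have Y1_gt0 u : 0 < u < L -> 0 < Y1 u.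
  by move=> /itv1 h; rewrite divr_gt0 // recip_friction_gt0.
have Y2_gt0 u : 0 < u < L -> 0 < Y2 u.
  by move=> /itv2 h; rewrite divr_gt0 // recip_friction_gt0.
have s1E u : 0 < u < L -> s1 (q1 u) = (Y1 u - m u) / (tau1 * Y1 u).
  move=> hu; have [_ pq _] := q1d _ hu; rewrite /s1 /phase_speed pq -/(m u) /Y1.
  have := recip_friction_gt0 hb (itv1 _ hu); move: (recip_friction _ _) => g g0.
  by field; rewrite !gt_eqF.
have s2E u : 0 < u < L -> s2 (q2 u) = (Y2 u - m u) / (tau2 * Y2 u).
  move=> hu; have [_ pq _] := q2d _ hu; rewrite /s2 /phase_speed pq -/(m u) /Y2.
  have := recip_friction_gt0 hb (itv2 _ hu); move: (recip_friction _ _) => g g0.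
  by field; rewrite !gt_eqF.
have Ym1 u : 0 < u < L -> 0 < Y1 u - m u.
  move=> hu; have [hq _ _] := q1d _ hu; have [_] := hs1 _ hq.
  by rewrite s1E // pmulr_lgt0 // invr_gt0 mulr_gt0 // Y1_gt0.
have Ym2 u : 0 < u < L -> 0 < Y2 u - m u.
  move=> hu; have [hq _ _] := q2d _ hu; have [_] := hs2 _ hq.
  by rewrite s2E // pmulr_lgt0 // invr_gt0 mulr_gt0 // Y2_gt0.
pose dY1 u := recip_friction' b (q1 u) * (Y1 u / (Y1 u - m u)).
pose dY2 u := recip_friction' b (q2 u) * (Y2 u / (Y2 u - m u)).
have Y1_der u : 0 < u < L -> is_derive u 1 Y1 (dY1 u).
  move=> hu; have [_ _ dq] := q1d _ hu.
  have h := is_derive1_comp (is_derive_recip_friction hb (q1 u)) dq.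
  have := is_derive1_mul h (is_derive_cst (tau1^-1) u 1).
  move=> h'; apply: is_derive_eq h' _.
  rewrite mulr0 addr0 s1E // /dY1 /cst /=.
  have := Y1_gt0 _ hu; have := Ym1 _ hu; move: (Y1 u) (m u) => y mm ym y0.
  by field; rewrite !gt_eqF.
have Y2_der u : 0 < u < L -> is_derive u 1 Y2 (dY2 u).
  move=> hu; have [_ _ dq] := q2d _ hu.
  have h := is_derive1_comp (is_derive_recip_friction hb (q2 u)) dq.
  have := is_derive1_mul h (is_derive_cst (tau2^-1) u 1).
  move=> h'; apply: is_derive_eq h' _.
  rewrite mulr0 addr0 s2E // /dY2 /cst /=.
  have := Y2_gt0 _ hu; have := Ym2 _ hu; move: (Y2 u) (m u) => y mm ym y0.
  by field; rewrite !gt_eqF.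
have pi2 := @pi_ge2 R.
have [e e0 he] : exists2 e, 0 < e & forall u, 0 < u < e -> u < L -> q1 u < pi / 2.
  by apply: within_itv_near0 => //; rewrite q10; lra.
have contY (q : R -> R) tau : {within `[0, L], continuous q} ->
    {within `[0, L], continuous (fun u => recip_friction b (q u) / tau)}.
  move=> cq.
  apply: (@continuous_within_comp R `[0, L] q (fun x => recip_friction b x / tau) cq).
  move=> x _; have h := is_derive1_mul (is_derive_recip_friction hb (q x))
    (is_derive_cst (tau^-1) (q x) 1).
  exact: is_derive_continuous h.
have Y12 u : 0 < u < L -> Y1 u < Y2 u.
  move=> hu; rewrite -subr_gt0.
  have e'0 : 0 < Num.min e 1 by rewrite lt_min e0 ltr01.
  apply: (@initial_barrier R (fun u => Y2 u - Y1 u) (fun u => dY2 u - dY1 u) L _ e'0) => //.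
  - by apply: within_continuousB; exact: contY.
  - by rewrite /Y1 /Y2 q10 q20 /recip_friction sin0 !mul0r subrr.
  - by move=> t ht; apply: is_derive1_sub; [exact: Y2_der | exact: Y1_der].
  - move=> t ht /eqP; rewrite subr_eq0 => /eqP E.
    rewrite subr_gt0 /dY1 /dY2 E ltr_pM2r; last by rewrite divr_gt0 ?Ym1 ?Y1_gt0.
    apply: recip_friction'_decr => //; [|exact: q21|].
      by have /andP[] := itv2 _ ht.
    by have /andP[] := itv1 _ ht.
  (* The tie-break near phase 0: the bound [e] makes g' positive and the bound 1 makes m >= 0. Then
     z / (z - m) does not increase with z, and Y2 <= Y1 still leaves Y2 the larger slope. *)
  - move=> t ht; rewrite lt_min => /andP[te t1] d0.
    have /andP[t0 tL] := ht.
    have q1t : 0 < q1 t < pi / 2 by rewrite he ?t0 // andbT; have /andP[] := itv1 _ ht.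
    have r1 := recip_friction'_gt0 hb q1t.
    have r21 : recip_friction' b (q1 t) < recip_friction' b (q2 t).
      apply: recip_friction'_decr => //; [|exact: q21|].
        by have /andP[] := itv2 _ ht.
      by have /andP[] := itv1 _ ht.
    have m0 : 0 <= m t.
      apply: mulr_ge0; first by apply/ltW/cos_gt0_pihalf; apply/andP; split; lra.
      by apply/ltW/sin_gt0_pihalf; apply/andP; split; lra.
    have Y1m := Ym1 _ ht; have Y2m := Ym2 _ ht.
    have y1 := Y1_gt0 _ ht; have y2 := Y2_gt0 _ ht.
    rewrite subr_gt0 /dY1 /dY2.
    apply: (@lt_le_trans _ _ (recip_friction' b (q2 t) * (Y1 t / (Y1 t - m t)))).
      by rewrite ltr_pM2r // divr_gt0.
    rewrite ler_pM2l; last by lra.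
    rewrite ler_pdivrMr // mulrAC ler_pdivlMr //.
    by nra.
pose de u := 2 * sin u ^+ 2 / (Y1 u - m u) - 2 * sin u ^+ 2 / (Y2 u - m u).
have e21_der u : 0 < u < L -> is_derive u 1 (fun u => e2 (q2 u) - e1 (q1 u)) (de u).
  move=> hu; have [_ pq1 dq1] := q1d _ hu; have [_ pq2 dq2] := q2d _ hu.
  have h2 := is_derive1_comp (e2_der (itv2 _ hu)) dq2.
  have h1 := is_derive1_comp (e1_der (itv1 _ hu)) dq1.
  apply: is_derive_eq (is_derive1_sub h2 h1) _.
  rewrite pq1 pq2 s1E // s2E // /de.
  have -> : recip_friction b (q1 u) = tau1 * Y1 u by rewrite /Y1 mulrC divfK // gt_eqF.
  have -> : recip_friction b (q2 u) = tau2 * Y2 u by rewrite /Y2 mulrC divfK // gt_eqF.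
  have := Ym1 _ hu; have := Ym2 _ hu; have := Y1_gt0 _ hu; have := Y2_gt0 _ hu.
  move: (Y1 u) (Y2 u) (m u) => y1 y2 mm ? ? ? ?.
  by field; rewrite !gt_eqF.
have e21_cont : {within `[0, L], continuous (fun u => e2 (q2 u) - e1 (q1 u))}.
  have icc (q : R -> R) T : 0 < T -> q 0 = 0 -> q L = T ->
      (forall u, 0 < u < L -> 0 < q u < T) -> forall u, 0 <= u <= L -> 0 <= q u <= T.
    move=> T0 qq0 qL hq u /andP[u0 uL].
    move: u0; rewrite le_eqVlt => /predU1P[<-|u0]; first by rewrite qq0 lexx ltW.
    move: uL; rewrite le_eqVlt => /predU1P[->|uL]; first by rewrite qL lexx ltW.
    have uu : 0 < u < L by rewrite u0.
    by have /andP[q0 qT] := hq _ uu; rewrite !ltW.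
  apply: within_continuousB.
    apply: (@continuous_within_comp R `[0, L] q2 e2 q2c) => x /=.
  rewrite in_itv => /(icc _ _ T20 q20 q2L _) h.
    have /andP[? ?] : 0 <= q2 x <= T2 by apply: h => u /q2d[].
    by apply: e2_cont; apply/andP; split; lra.
  apply: (@continuous_within_comp R `[0, L] q1 e1 q1c) => x /=.
  rewrite in_itv => /(icc _ _ T10 q10 q1L _) h.
  have /andP[? ?] : 0 <= q1 x <= T1 by apply: h => u /q1d[].
  by apply: e1_cont; apply/andP; split; lra.
have de_ge0 u : 0 < u < L -> 0 <= de u.
  move=> hu; rewrite subr_ge0 ler_wpM2l //; first by rewrite mulr_ge0 // sqr_ge0.
  by rewrite lef_pV2 ?posrE ?Ym1 ?Ym2 // lerB // ltW // Y12.
exists T2; split => //.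
(* Strictness is gained on (0, l), where sin u > 0 because l <= 1 < pi/2. Beyond [l] sin u may
   vanish, and only the weak monotonicity is used. *)
pose l := Num.min L 1.
have l0 : 0 < l by rewrite lt_min L_gt0 ltr01.
have lL : l <= L by rewrite ge_min lexx.
have l1 : l <= 1 by rewrite ge_min lexx orbT.
rewrite -subr_gt0 -q1L -q2L.
apply: (@lt_le_trans _ _ (e2 (q2 l) - e1 (q1 l))).
  rewrite -[X in X < _](subrr 0) -[X in X - _ < _]e2_0 -[X in _ - X < _]e1_0.
  rewrite -[X in e2 X - _ < _]q20 -[X in _ - e1 X < _]q10.
  apply: (@derive_pos_incr R (fun u => e2 (q2 u) - e1 (q1 u)) de) => //.
    by apply: continuous_subspaceW e21_cont; apply: subset_itvl; rewrite bnd_simp.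
  move=> u /andP[u0 ul]; have hu : 0 < u < L by apply/andP; split; lra.
  split; first exact: e21_der.
  rewrite subr_gt0 ltr_pM2l; last first.
    rewrite mulr_gt0 // exprn_gt0 // sin_gt0_pihalf //.
    by apply/andP; split; lra.
  by rewrite ltf_pV2 ?posrE ?Ym1 ?Ym2 // ltrD2r Y12.
apply: (@derive_ge0_ndecr R (fun u => e2 (q2 u) - e1 (q1 u)) de) => //.
  by apply: continuous_subspaceW e21_cont; apply: subset_itvr; rewrite bnd_simp ltW.
move=> u /andP[u0 ul]; have hu : 0 < u < L by apply/andP; split; lra.
by split; [exact: e21_der | exact: de_ge0].
Qed.

End PhaseComparison.

(** * Polar coordinates for the damped oscillator *)

Section PhaseConstruction.
Context {R : realType}.
Variables (b tau : R) (f y h : R -> R).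
Hypothesis hb : 2 / 3 <= b <= 1.
Hypothesis tau_gt0 : 0 < tau.
Hypothesis f_cont : forall t : R, - pi < t < (pi : R) -> {for t, continuous f}.
Hypothesis y_cont : forall t : R, - pi < t < (pi : R) -> {for t, continuous y}.
Hypothesis h_cont : forall t : R, - pi < t < (pi : R) -> {for t, continuous h}.
Hypothesis hE : forall t, 0 < t < pi -> h t = y t / recip_friction b t.
Hypothesis f0 : f 0 = 1.
Hypothesis y0 : y 0 = 0.
Hypothesis f_der : forall t, 0 < t < pi -> is_derive t 1 f (- (y t / tau)).
Hypothesis y_der : forall t, 0 < t < pi ->
  is_derive t 1 y (f t / tau - y t / recip_friction b t).

(** A solution p of p' = p / g, since 1 / g = cot(t/2) / 2 - (1 - 2 b) tan(t/2) / 2. It measures how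
    fast the friction can consume the energy. *)
Definition integrating_factor (t : R) : R :=
  sin (t / 2) * cos (t / 2) `^ (1 - 2 * b).

Lemma half_angle_gt0 (t : R) : 0 < t < pi -> 0 < sin (t / 2) /\ 0 < cos (t / 2).
Proof.
move=> /andP[t0 tpi]; split.
  by apply: sin_gt0_pihalf; apply/andP; split; lra.
by apply: cos_gt0_pihalf; apply/andP; split; lra.
Qed.

Lemma integrating_factor_gt0 t : 0 < t < pi -> 0 < integrating_factor t.
Proof. by move=> /half_angle_gt0[s c]; rewrite mulr_gt0 // powR_gt0. Qed.

Lemma is_derive_integrating_factor (t : R) : - pi < t < pi ->
  is_derive t 1 integrating_factor
    (1 / 2 * cos (t / 2) * cos (t / 2) `^ (1 - 2 * b) +
     sin (t / 2) * ((1 - 2 * b) * cos (t / 2) `^ (1 - 2 * b - 1) *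
       (- (1 / 2 * sin (t / 2))))).
Proof.
move=> /andP[t0 tpi].
have c0 : 0 < cos (t / 2) by apply: cos_gt0_pihalf; apply/andP; split; lra.
have d2 : is_derive t 1 (fun x : R => x / 2) (1 / 2).
  by apply: is_derive_eq; rewrite /GRing.scale /=; field.
have hs := @is_derive1_comp R sin (fun x => x / 2) t _ _ (is_derive_sin (t / 2)) d2.
have hc := @is_derive1_comp R cos (fun x => x / 2) t _ _ (is_derive_cos (t / 2)) d2.
have hp := @is_derive1_comp R (fun x => x `^ (1 - 2 * b)) (cos \o (fun x => x / 2)) t _ _
  (is_derive1_powR (1 - 2 * b) c0) hc.
apply: is_derive_eq (is_derive1_mul hs hp) _.
by rewrite /=; ring.
Qed.

Lemma integrating_factor_der t : 0 < t < pi ->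
  is_derive t 1 integrating_factor (integrating_factor t / recip_friction b t).
Proof.
move=> ht; have [s0 c0] := half_angle_gt0 ht.
have ht' : - pi < t < pi by have /andP[? ?] := ht; apply/andP; split; lra.
apply: is_derive_eq (is_derive_integrating_factor ht') _.
rewrite /integrating_factor /recip_friction.
have dn : b + (1 - b) * cos t != 0 by rewrite gt_eqF // friction_num_gt0.
have [sE cE] : sin t = 2 * (cos (t / 2) * sin (t / 2)) /\
    cos t = cos (t / 2) ^+ 2 - sin (t / 2) ^+ 2.
  have tE : t = t / 2 + t / 2 by field.
  by rewrite {1 4}tE sinD cosD; split; ring.
move: dn; rewrite sE cE.
rewrite (@powRB _ _ (1 - 2 * b) 1); last by rewrite (gt_eqF c0) implybT.
rewrite powRr1 ?ltW //.
have := cos2Dsin2 (t / 2); move: (cos (t / 2) `^ _) => q.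
move: (sin (t / 2)) (cos (t / 2)) s0 c0 => s c s0 c0 cs dn.
have s2 : s ^+ 2 = 1 - c ^+ 2 by rewrite -cs; ring.
have -> : 1 / 2 * c * q + s * ((1 - 2 * b) * (q / c) * (- (1 / 2 * s))) =
   (c ^+ 2 - (1 - 2 * b) * s ^+ 2) * q / (2 * c) by field; rewrite gt_eqF.
rewrite invf_div.
have -> : b + (1 - b) * (c ^+ 2 - s ^+ 2) = c ^+ 2 - (1 - 2 * b) * s ^+ 2.
  by rewrite s2; ring.
by field; rewrite !gt_eqF.
Qed.

Let E t := f t ^+ 2 + y t ^+ 2.

Lemma energy_der (t : R) : 0 < t < pi ->
  is_derive t 1 E (- (2 * y t ^+ 2 / recip_friction b t)).
Proof.
move=> ht; have hf := f_der ht; have hy := y_der ht.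
apply: is_derive_eq (is_derive1_add (is_derive1_mul hf hf) (is_derive1_mul hy hy)) _.
by have := recip_friction_gt0 hb ht; move: (recip_friction _ _) => g g0; field;
  rewrite !gt_eqF.
Qed.

Lemma energy_cont (t : R) : - pi < t < (pi : R) -> {for t, continuous E}.
Proof.
move=> ht; apply: continuousD; apply: continuousM; by [exact: f_cont | exact: y_cont].
Qed.

Lemma pi_itv0 : - pi < (0 : R) < pi.
Proof. by rewrite oppr_lt0 pi_gt0. Qed.

Lemma pi_itv_pos (t : R) : 0 < t < pi -> - pi < t < pi.
Proof. by have := @pi_gt0 R; move=> ? /andP[? ?]; apply/andP; split; lra. Qed.

Lemma pi_itv_nneg (t : R) : 0 <= t < pi -> - pi < t < pi.
Proof. by have := @pi_gt0 R; move=> ? /andP[? ?]; apply/andP; split; lra. Qed.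

Lemma energy0 : E 0 = 1.
Proof. by rewrite /E f0 y0 expr1n expr0n addr0. Qed.

Lemma energy_near0 : exists2 eta, 0 < eta < pi & forall t, `|t| < eta -> 0 < E t.
Proof.
have h1 : 0 < E 0 by rewrite energy0.
have [r /= r0 hr] := energy_cont pi_itv0 (lt_nbhsr h1).
exists (Num.min r 1).
  rewrite lt_min r0 ltr01 /= gt_min; apply/orP; right.
  by have := @pi_ge2 R; lra.
move=> t; rewrite lt_min => /andP[tr _]; apply: hr => /=.
by rewrite sub0r normrN.
Qed.

(** The derivative of E p^2, with p the integrating factor, is 2 f^2 p^2 / g >= 0. So E cannot decay
    faster than p^(-2), and its positivity near 0 propagates to all of [0, pi). *)
Lemma energy_gt0 t : 0 <= t < pi -> 0 < E t.
Proof.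
move=> /andP[t0 tpi]; have [eta /andP[e0 epi] he] := energy_near0.
have [te|et] := ltP t (eta / 2).
  by apply: he; rewrite ger0_norm //; lra.
pose p := integrating_factor.
have e2 : 0 < eta / 2 < pi by apply/andP; split; lra.
have E2 : 0 < E (eta / 2) by apply: he; rewrite ger0_norm //; lra.
have tt : 0 < t < pi by apply/andP; split; lra.
have : E (eta / 2) * (p (eta / 2) * p (eta / 2)) <= E t * (p t * p t).
  apply: (@derive_ge0_ndecr R (fun t => E t * (p t * p t))
    (fun t => 2 * f t ^+ 2 * p t ^+ 2 / recip_friction b t)) => //.
    apply: for_continuous_within => x /=; rewrite in_itv /= => /andP[? ?].
    have hx : 0 < x < pi by apply/andP; split; lra.
    have cp := is_derive_continuous (integrating_factor_der hx).
    apply: continuousM; first by apply: energy_cont; exact: pi_itv_pos.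
    exact: continuousM.
  move=> x /andP[? ?]; have hx : 0 < x < pi by apply/andP; split; lra.
  have g0 := recip_friction_gt0 hb hx.
  have dp := integrating_factor_der hx.
  split.
    apply: is_derive_eq (is_derive1_mul (energy_der hx) (is_derive1_mul dp dp)) _.
    rewrite /p /E; move: (integrating_factor x) g0 {dp} => q.
    by move: (recip_friction _ _) => g g0; field; rewrite gt_eqF.
  by rewrite divr_ge0 ?(ltW g0) // mulr_ge0 ?sqr_ge0 // mulr_ge0 ?sqr_ge0.
have p2 : 0 < p (eta / 2) * p (eta / 2) by rewrite mulr_gt0 // integrating_factor_gt0.
have pt : 0 < p t * p t by rewrite mulr_gt0 // integrating_factor_gt0.
move=> H; rewrite -(pmulr_lgt0 _ pt); apply: lt_le_trans H.
by rewrite mulr_gt0.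
Qed.

(** The angular velocity with y / g replaced by its extension [h], which is continuous across 0
    although g vanishes there. *)
Let w t := tau^-1 - h t * f t / E t.

(** The integration starts at a negative point, so that 0 is interior and the derivative there is
    two-sided. *)
Lemma phase_primitive : exists psi : R -> R, psi 0 = 0 /\
  forall t, 0 <= t < pi -> is_derive t 1 psi (w t).
Proof.
have [eta /andP[e0 epi] he] := energy_near0.
pose a := - (eta / 2).
have a0 : a < 0 by rewrite /a; lra.
have aeta : - eta < a by rewrite /a; lra.
have Egt t : a <= t < pi -> 0 < E t.
  move=> /andP[at' tpi]; have [t0|t0] := leP 0 t.
    by apply: energy_gt0; rewrite t0.
  by apply: he; rewrite ltr0_norm //; lra.
have w_cont t : a <= t < pi -> {for t, continuous w}.
  move=> ht; have ht' : - pi < t < (pi : R).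
    by move: ht => /andP[? ?]; apply/andP; split; lra.
  apply: continuousB; first exact: cst_continuous.
  apply: continuousM; first by apply: continuousM; [exact: h_cont | exact: f_cont].
  by apply: continuousV; [rewrite gt_eqF // Egt | exact: energy_cont].
pose P x := \int[lebesgue_measure]_(t in `[a, x]) w t.
have P_der x : a < x < pi -> is_derive x 1 P (w x).
  move=> /andP[ax xpi]; pose u := (x + pi) / 2.
  have xu : x < u by rewrite /u; lra.
  have upi : u < pi by rewrite /u; lra.
  have cw : {within `[a, u], continuous w}.
    apply: for_continuous_within => t /=; rewrite in_itv /= => /andP[? ?].
    by apply: w_cont; apply/andP; split; lra.
  have iw : lebesgue_measure.-integrable `[a, u] (EFin \o w).
    by apply: continuous_compact_integrable => //; exact: segment_compact.
  have [|dP P'] := continuous_FTC1_closed xu iw ax.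
    by apply: w_cont; apply/andP; split; lra.
  by rewrite -P' derive1E; exact/derivableP.
exists (fun t => P t - P 0); split; first by rewrite subrr.
move=> t /andP[t0 tpi].
have ht : a < t < pi by apply/andP; split; lra.
apply: is_derive_eq (is_derive1_sub (P_der _ ht) (is_derive_cst (P 0) t 1)) _.
by rewrite subr0.
Qed.

(** For the primitive psi of [w], the component N of (f, y) orthogonal to (cos psi, sin psi)
    satisfies (N^2 / E)' = 0 and N = 0 at 0, so it vanishes. The remaining component C has C^2 = E >
    0 and C = 1 at 0, hence never changes sign and equals the square root of E. *)
Lemma phase_exists : exists psi : R -> R,
  [/\ psi 0 = 0, forall t, 0 <= t < pi -> {for t, continuous psi},
      forall t, 0 < t < pi -> is_derive t 1 psi (phase_speed b tau (psi t) t) &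
      forall t, 0 <= t < pi -> f t = Num.sqrt (E t) * cos (psi t) /\
                             y t = Num.sqrt (E t) * sin (psi t)].
Proof.
have [psi [psi0 psi_der]] := phase_primitive.
have psi_cont t : 0 <= t < pi -> {for t, continuous psi}.
  by move=> /psi_der; exact: is_derive_continuous.
pose N t := f t * sin (psi t) - y t * cos (psi t).
pose C t := f t * cos (psi t) + y t * sin (psi t).
have cs_cont t : 0 <= t < pi -> {for t, continuous (fun t => cos (psi t))} /\
    {for t, continuous (fun t => sin (psi t))}.
  move=> /psi_cont c; split.
    exact: (continuous_comp c (@continuous_cos R _)).
  exact: (continuous_comp c (@continuous_sin R _)).
have fy_cont t : 0 <= t < pi -> {for t, continuous f} /\ {for t, continuous y}.
  by move=> /pi_itv_nneg ht; split; [exact: f_cont | exact: y_cont].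
have N_cont t : 0 <= t < pi -> {for t, continuous N}.
  move=> ht; have [c s] := cs_cont _ ht; have [cf cy] := fy_cont _ ht.
  by apply: continuousB; exact: continuousM.
have C_cont t : 0 <= t < pi -> {for t, continuous C}.
  move=> ht; have [c s] := cs_cont _ ht; have [cf cy] := fy_cont _ ht.
  by apply: continuousD; exact: continuousM.
have E_cont t : 0 <= t < pi -> {for t, continuous E}.
  by move=> /pi_itv_nneg; exact: energy_cont.
have N0 t : 0 <= t < pi -> N t = 0.
  move=> /andP[t0 tpi]; move: t0; rewrite le_eqVlt => /predU1P[<-|t0].
    by rewrite /N psi0 sin0 y0 mulr0 mul0r subrr.
  have := @MVT R (fun t => N t ^+ 2 / E t) (fun=> 0) 0 t t0.
  case.
  - move=> x; rewrite in_itv /= => /andP[x0 xt].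
    have hx : 0 < x < pi by apply/andP; split; lra.
    have hx' : 0 <= x < pi by apply/andP; split; lra.
    have En : E x != 0 by rewrite gt_eqF // energy_gt0.
    have gn : recip_friction b x != 0 by rewrite gt_eqF // recip_friction_gt0.
    have dc := is_derive1_comp (is_derive_cos (psi x)) (psi_der _ hx').
    have ds := is_derive1_comp (is_derive_sin (psi x)) (psi_der _ hx').
    have dN := is_derive1_sub (is_derive1_mul (f_der hx) ds)
      (is_derive1_mul (y_der hx) dc).
    have dN2 := is_derive1_mul dN dN.
    apply: is_derive_eq (is_derive1_div dN2 (energy_der hx) En) _.
    rewrite /= /w hE //.
    move: En gn (gt_eqF tau_gt0); rewrite /E.
    move: (f x) (y x) (recip_friction b x) (cos (psi x)) (sin (psi x)).
    by move=> ff yy g c s En gn tn; field; rewrite En gn tn.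
  - apply: for_continuous_within => x /=; rewrite in_itv /= => /andP[x0 xt].
    have hx' : 0 <= x < pi by apply/andP; split; lra.
    apply: continuousM; first by apply: continuousM; exact: N_cont.
    by apply: continuousV; [rewrite gt_eqF // energy_gt0 | exact: E_cont].
  move=> c _; rewrite mul0r /N psi0 sin0 y0 mulr0 mul0r subrr expr0n mul0r subr0.
  have En : E t != 0 by rewrite gt_eqF // energy_gt0 // ltW.
  by move=> /eqP; rewrite mulf_eq0 invr_eq0 (negbTE En) orbF expf_eq0 => /eqP.
have CE t : 0 <= t < pi -> f t = C t * cos (psi t) /\ y t = C t * sin (psi t).
  move=> /N0; rewrite /N /C => /eqP; rewrite subr_eq0 => /eqP n0; split.
    rewrite mulrDl -[y t * _ * _]mulrA [sin _ * cos _]mulrC mulrA -n0 -!mulrA.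
    by rewrite -mulrDr -!expr2 cos2Dsin2 mulr1.
  rewrite mulrDl -[f t * _ * _]mulrA [cos _ * sin _]mulrC mulrA n0 -!mulrA.
  by rewrite -mulrDr -!expr2 cos2Dsin2 mulr1.
have C2 t : 0 <= t < pi -> C t ^+ 2 = E t.
  move=> /CE[fE yE].
  by rewrite /E fE yE !exprMn -mulrDr cos2Dsin2 mulr1.
have C0 : C 0 = 1 by rewrite /C psi0 cos0 f0 y0 mulr1 mul0r addr0.
have C_gt0 t : 0 <= t < pi -> 0 < C t.
  move=> /andP[t0 tpi]; rewrite ltNge; apply/negP => Ct.
  have [||x] := @IVT R C 0 t 0 t0.
  - apply: for_continuous_within => x /=; rewrite in_itv /= => /andP[x0 xt].
    by apply: C_cont; apply/andP; split; lra.
  - by rewrite C0 ge_min Ct orbT le_max ler01.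
  rewrite in_itv /= => /andP[x0 xt] Cx.
  have hx : 0 <= x < pi by apply/andP; split; lra.
  by have := energy_gt0 hx; rewrite -C2 // Cx expr0n ltxx.
exists psi; split => //.
  move=> t ht; have ht' : 0 <= t < pi by have /andP[/ltW -> ->] := ht.
  have -> : phase_speed b tau (psi t) t = w t; last exact: psi_der.
  have [fE yE] := CE _ ht'; rewrite /w /phase_speed hE // -C2 // fE yE.
  have := C_gt0 _ ht'; have := recip_friction_gt0 hb ht.
  move: (C t) (recip_friction b t) => cc g g0 c0.
  by field; rewrite !gt_eqF.
move=> t ht; have -> : Num.sqrt (E t) = C t.
  by rewrite -C2 // sqrtr_sqr gtr0_norm // C_gt0.
exact: CE.
Qed.

(* The phase speed has the sign of [trap := g/tau * E - f * y], and
   [(p * trap)' = p * g' * E / tau] changes sign only once, from + to -; so it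
   suffices to know that [trap] is positive at [0] and at [T]. *)
Lemma phase_speed_gt0 (psi : R -> R) (T : R) :
  (forall t, 0 <= t < pi -> f t = Num.sqrt (E t) * cos (psi t) /\
                            y t = Num.sqrt (E t) * sin (psi t)) ->
  0 < T < pi -> sin (psi T) = 0 ->
  forall t, 0 < t < T -> 0 < phase_speed b tau (psi t) t.
Proof.
move=> fy hT sT t /andP[t0 tT]; have /andP[T0 Tpi] := hT.
have pos x : 0 < x < pi -> [/\ 0 < E x, 0 < recip_friction b x &
    0 < integrating_factor x].
  move=> hx; split; [|exact: recip_friction_gt0|exact: integrating_factor_gt0].
  by apply: energy_gt0; have /andP[/ltW -> ->] := hx.
pose K x := integrating_factor x * (recip_friction b x / tau * E x - f x * y x).
pose dK x := integrating_factor x * recip_friction' b x * E x / tau.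
have KE x : 0 < x < pi ->
    K x = integrating_factor x * recip_friction b x * E x * phase_speed b tau (psi x) x.
  move=> hx; have [E0 g0 _] := pos _ hx.
  have hx' : 0 <= x < pi by have /andP[/ltW -> ->] := hx.
  have [fE yE] := fy _ hx'; rewrite /K /phase_speed fE yE.
  have : Num.sqrt (E x) ^+ 2 = E x by rewrite sqr_sqrtr // ltW.
  move: (Num.sqrt (E x)) => C C2; rewrite -C2.
  by move: (recip_friction b x) g0 => g g0; field; rewrite !gt_eqF.
have K_cont x : 0 <= x < pi -> {for x, continuous K}.
  move=> /pi_itv_nneg hx.
  have cp := is_derive_continuous (is_derive_integrating_factor hx).
  have cg := is_derive_continuous (is_derive_recip_friction hb x).
  apply: continuousM => //; apply: continuousB.
    apply: continuousM; last exact: energy_cont.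
    by apply: continuousM => //; exact: cst_continuous.
  by apply: continuousM; [exact: f_cont | exact: y_cont].
have K_der x : 0 < x < pi -> is_derive x 1 K (dK x).
  move=> hx; have [_ g0 _] := pos _ hx.
  have dg := is_derive1_mul (is_derive_recip_friction hb x) (is_derive_cst (tau^-1) x 1).
  have d1 := is_derive1_mul dg (energy_der hx).
  have d2 := is_derive1_mul (f_der hx) (y_der hx).
  apply: is_derive_eq (is_derive1_mul (integrating_factor_der hx) (is_derive1_sub d1 d2)) _.
  rewrite /dK /cst /E /=.
  by move: (recip_friction b x) g0 => g g0; field; rewrite !gt_eqF.
suff : 0 < K t.
  have ht : 0 < t < pi by apply/andP; split; lra.
  have [E0 g0 p0] := pos _ ht.
  by rewrite KE // pmulr_rgt0 //; apply: mulr_gt0 => //; exact: mulr_gt0.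
have K0 : K 0 = 0 by rewrite /K /integrating_factor mul0r sin0 !mul0r.
have ht : 0 < t < pi by apply/andP; split; lra.
have [g'0|g'0] := leP 0 (recip_friction' b t).
  rewrite -K0; apply: (@derive_pos_incr R K dK) => //.
    apply: for_continuous_within => x /=; rewrite in_itv /= => /andP[? ?].
    by apply: K_cont; apply/andP; split; lra.
  move=> x /andP[x0 xt]; have hx : 0 < x < pi by apply/andP; split; lra.
  split; first exact: K_der.
  have [E0 _ p0] := pos _ hx; have g'x := recip_friction'_decr hb x0 xt (andP ht).2.
  by rewrite /dK divr_gt0 // mulr_gt0 // mulr_gt0 //; lra.
have KT : 0 < K T.
  rewrite KE // /phase_speed sT mulr0 mul0r subr0.
  have [E0 g0 p0] := pos _ hT; apply: mulr_gt0; last by rewrite invr_gt0.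
  by apply: mulr_gt0 => //; exact: mulr_gt0.
apply: (lt_trans KT); rewrite -ltrN2.
apply: (@derive_pos_incr R (fun x => - K x) (fun x => - dK x)) => //.
  apply: for_continuous_within => x /=; rewrite in_itv /= => /andP[? ?].
  by apply: continuousN; apply: K_cont; apply/andP; split; lra.
move=> x /andP[x0 xt]; have hx : 0 < x < pi by apply/andP; split; lra.
split; first by have := K_der _ hx => ?; exact: is_deriveN.
have xpi : x < pi by lra.
have [E0 _ p0] := pos _ hx; have g'x := recip_friction'_decr hb t0 x0 xpi.
rewrite /dK oppr_gt0 pmulr_llt0 ?invr_gt0 // pmulr_llt0 // pmulr_rlt0 //; lra.
Qed.

End PhaseConstruction.

(** * The fundamental theorem for derivatives unbounded at the endpoints *)

Section ImproperFTC.
Context {R : realType}.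
Variables (c d : R) (F f : R -> R).
Hypothesis cd : c < d.
Hypothesis cF : {within `[c, d], continuous F}.
Hypothesis dF : forall t, c < t < d -> is_derive t 1 F (f t).
Hypothesis cf : forall t, c < t < d -> {for t, continuous f}.

(** The factor 1/3 keeps the shrunken interval nondegenerate already for n = 0, where [harmonic n]
    is 1. *)
Let h (n : nat) : R := (d - c) / 3 * harmonic n.

Lemma shrink_itv n : 0 < h n /\ c + h n < d - h n.
Proof.
have h1 : 0 < @harmonic R n <= 1.
  by rewrite /harmonic /= invr_gt0 ltr0Sn invf_le1 ?ltr0Sn // ler1n.
have dc := cd; have /andP[h2 h3] := h1; rewrite /h; split.
  by rewrite mulr_gt0 // divr_gt0 // subr_gt0.
have : (d - c) / 3 * harmonic n <= (d - c) / 3 by rewrite ler_piMr //; lra.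
lra.
Qed.

Lemma shrink_cvg0 : h n @[n --> \oo] --> 0.
Proof.
by rewrite -[0](mulr0 ((d - c) / 3)); apply: cvgM; [exact: cvg_cst|exact: cvg_harmonic].
Qed.

Lemma shrink_itv_cvg : F (d - h n) - F (c + h n) @[n --> \oo] --> F d - F c.
Proof.
have [_ cFc cFd] := (continuous_within_itvP _ cd).1 cF.
have h0 := shrink_cvg0.
apply: cvgB.
  apply: ((cvg_at_leftP _ _ _).1 cFd); split.
    by move=> n; have [? _] := shrink_itv n; rewrite ltrBlDr ltrDl.
  by rewrite -[X in _ --> X]subr0; apply: cvgB => //; exact: cvg_cst.
apply: ((cvg_at_rightP _ _ _).1 cFc); split.
  by move=> n; have [? _] := shrink_itv n; rewrite ltrDl.
by rewrite -[X in _ --> X]addr0; apply: cvgD => //; exact: cvg_cst.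
Qed.

Lemma within_open_continuous (a b : R) : c < a -> b < d ->
  {within `[a, b], continuous f}.
Proof.
move=> ca bd; apply: for_continuous_within => x /=; rewrite in_itv /= => /andP[? ?].
by apply: cf; apply/andP; split; lra.
Qed.

Lemma FTC_inside (a b : R) : c < a -> a < b -> b < d ->
  (\int[lebesgue_measure]_(t in `[a, b]) (f t)%:E)%E = (F b - F a)%:E.
Proof.
move=> ca ab bd; rewrite (continuous_FTC2 (F := F) ab (within_open_continuous ca bd)) //.
- have dF' x : a <= x <= b -> is_derive x 1 F (f x).
    by move=> /andP[? ?]; apply: dF; apply/andP; split; lra.
  split.
  + by move=> x; rewrite in_itv /= => /andP[? ?]; have [] := dF' x; rewrite // !ltW.
  + apply: cvg_at_right_filter; apply: (is_derive_continuous (dF' a _)).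
    by rewrite lexx ltW.
  + apply: cvg_at_left_filter; apply: (is_derive_continuous (dF' b _)).
    by rewrite lexx ltW.
- move=> x; rewrite in_itv /= => /andP[? ?]; rewrite derive1E.
  have hx : c < x < d by apply/andP; split; lra.
  by have [_ ->] := dF hx.
Qed.

Lemma open_measurable : measurable_fun `]c, d[ f.
Proof.
apply: open_continuous_measurable_fun; first exact: interval_open.
by move=> x /set_mem /=; rewrite in_itv => /cf.
Qed.

(** The sign of [f] allows monotone convergence along the inner intervals, and the continuity of [F]
    up to the ends gives the limit. *)
Lemma ge0_improper_FTC : (forall t, c < t < d -> 0 <= f t) ->
  (\int[lebesgue_measure]_(t in `[c, d]) (f t)%:E)%E = (F d - F c)%:E.
Proof.
move=> f0; pose A n := `[c + h n, d - h n].
have Asub n : [set` A n] `<=` `]c, d[.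
  move=> x /=; rewrite !in_itv /= => /andP[? ?].
  by have [? ?] := shrink_itv n; apply/andP; split; lra.
have hmono m n : (m <= n)%N -> h n <= h m.
  move=> mn; rewrite /h ler_wpM2l ?divr_ge0 ?subr_ge0 ?(ltW cd) //.
  by rewrite /harmonic /= lef_pV2 ?posrE ?ltr0Sn // ler_nat.
have bigA : \bigcup_n [set` A n] = [set` `]c, d[].
  apply/seteqP; split; first by move=> x [n _]; exact: Asub.
  move=> x /=; rewrite in_itv /= => /andP[cx xd].
  have m0 : 0 < Num.min (x - c) (d - x) by rewrite lt_min !subr_gt0 cx.
  have /cvgrPdist_lt /(_ _ m0) [n _ /(_ n (leqnn _))] := shrink_cvg0.
  have [hn _] := shrink_itv n.
  rewrite sub0r normrN gtr0_norm // lt_min => /andP[? ?].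
  by exists n => //=; rewrite in_itv /=; apply/andP; split; lra.
have ndA : nondecreasing_seq (fun n => [set` A n]).
  move=> m n mn; rewrite subsetEset => x /=; rewrite !in_itv /= => /andP[? ?].
  by have := hmono _ _ mn => ?; apply/andP; split; lra.
have mf : measurable_fun `]c, d[ (EFin \o f) by apply/measurable_EFinP; exact: open_measurable.
rewrite integral_itv_bndoo // -bigA.
have cvgI : (\int[lebesgue_measure]_(x in [set` A i]) (f x)%:E @[i --> \oo] -->
    \int[lebesgue_measure]_(x in \bigcup_i [set` A i]) (f x)%:E)%E.
  apply: (@ge0_nondecreasing_set_cvg_integral _ (measurableTypeR R) R) => //.
  - by move=> n; apply: measurable_funS mf => //; exact: Asub.
  - by move=> n x /Asub /=; rewrite in_itv lee_fin => /f0.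
rewrite -(cvg_lim (@ereal_hausdorff R) cvgI); apply: cvg_lim => //.
under eq_fun => n.
  have [? ?] := shrink_itv n.
  rewrite FTC_inside; [over|lra|lra|lra].
apply: cvg_EFin; first by near=> n.
exact: shrink_itv_cvg.
Unshelve. all: by end_near.
Qed.

(** On each inner interval the increment of [F] is bounded by an integral of |f| over a smaller set;
    only the left side passes to the limit, so [f] may change sign. *)
Lemma le_improper_variation :
  ((`|F d - F c|)%:E <= \int[lebesgue_measure]_(t in `[c, d]) (`|f t|)%:E)%E.
Proof.
have mf : measurable_fun `]c, d[ (fun t => (`|f t|)%:E).
  by apply/measurable_EFinP; apply: measurableT_comp => //; exact: open_measurable.
rewrite integral_itv_bndoo //.
apply: (@cvge_to_le _ \oo _ R (fun n => (`|F (d - h n) - F (c + h n)|)%:E)).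
  apply: cvg_EFin; first by near=> n.
  by apply: (cvg_comp _ _ shrink_itv_cvg); exact: norm_continuous.
near=> n; have [h0 hd] := shrink_itv n.
have sub : [set` `[c + h n, d - h n]] `<=` `]c, d[.
  by move=> x /=; rewrite !in_itv /= => /andP[? ?]; apply/andP; split; lra.
rewrite -abse_EFin -FTC_inside; [|lra|lra|lra].
apply: (@le_trans _ _ (\int[lebesgue_measure]_(t in `[(c + h n)%R, (d - h n)%R]) (`|f t|)%:E)%E).
  apply: (@le_abse_integral _ _ R lebesgue_measure _ (EFin \o f)) => //.
  by apply: measurable_funS sub _ => //; apply/measurable_EFinP; exact: open_measurable.
by apply: ge0_subset_integral => //; move=> x _; rewrite lee_fin.
Unshelve. all: by end_near.
Qed.

End ImproperFTC.

(** * Passages of the phase through the multiples of pi *)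

Section Crossing.
Context {R : realType}.
Variables (psi dpsi : R -> R).
Hypothesis psi_cont : forall t, 0 <= t < pi -> {for t, continuous psi}.
Hypothesis psi_der : forall t, 0 < t < pi -> is_derive t 1 psi (dpsi t).
Hypothesis psi_up : forall t, 0 < t < pi -> sin (psi t) = 0 -> 0 < dpsi t.
Hypothesis psi_0 : psi 0 = 0.

Lemma sin_pi_mulrn (k : nat) : sin (pi *+ k) = 0 :> R.
Proof. by elim: k => [|k IH]; rewrite ?mulr0n ?sin0 // mulrSr sinDpi IH oppr0. Qed.

Lemma cos_pi_mulrn (k : nat) : cos (pi *+ k) = (-1) ^+ k :> R.
Proof.
by elim: k => [|k IH]; rewrite ?mulr0n ?cos0 // mulrSr cosDpi IH exprS mulN1r.
Qed.

Lemma le_pi_mulrn (j k : nat) : (pi *+ j <= pi *+ k :> R) = (j <= k)%N.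
Proof. by rewrite -![pi *+ _]mulr_natl ler_pM2r ?pi_gt0 // ler_nat. Qed.

Lemma pi_mulrn_inj (j k : nat) : pi *+ j = pi *+ k :> R -> j = k.
Proof. by move=> E; apply/eqP; rewrite eqn_leq -!le_pi_mulrn E lexx. Qed.

Lemma sin_sign (k : nat) (x : R) : pi *+ k < x < pi *+ k.+1 ->
  0 < (-1) ^+ k * sin x.
Proof.
elim: k x => [|k IH] x; first by rewrite mulr0n expr0 mul1r; exact: sin_gt0_pi.
move=> /andP[x0 x1]; have /IH : pi *+ k < x - pi < pi *+ k.+1.
  by move: x0 x1; rewrite [in X in _ -> X -> _]mulrSr [pi *+ k.+1]mulrSr => ? ?; apply/andP; split; lra.
by rewrite -[X in _ -> 0 < _ * sin X](subrK pi) sinDpi exprS; lra.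
Qed.

Lemma is_derive_pos_right (d : R -> R) (s l e : R) :
  is_derive s 1 d l -> 0 < l -> 0 < e -> exists2 u, s < u < s + e & d s < d u.
Proof.
move=> dd l0 e0.
have d1 : is_derive (- s) 1 (fun x : R => - x) (- 1) by exact: is_deriveN.
have dd' : is_derive (- - s) 1 d l by rewrite opprK.
have d2 : is_derive (- s) 1 (fun x => - d (- x)) l.
  have h := @is_derive1_comp R d (fun x => - x) (- s) _ _ dd' d1.
  by apply: is_derive_eq (is_deriveN h) _; rewrite mulrN1 opprK.
have [u /andP[u1 u2]] := is_derive_pos_left d2 l0 e0.
by rewrite opprK ltrN2 => h; exists (- u) => //; apply/andP; split; lra.
Qed.

(** The phase moves upwards whenever it meets a multiple of pi, so it never comes back to such a
    level: every level is crossed at most once. *)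
Lemma crossing_gt (k : nat) (T t : R) : 0 < T -> T < t -> t < pi ->
  psi T = pi *+ k -> pi *+ k < psi t.
Proof.
move=> T0 Tt tpi pT.
have hT : 0 < T < pi by apply/andP; split; lra.
have up : 0 < dpsi T by apply: psi_up => //; rewrite pT sin_pi_mulrn.
have e0 : 0 < t - T by lra.
have [u /andP[u1 u2] pu] := is_derive_pos_right (psi_der hT) up e0.
rewrite -subr_gt0.
apply: (@upcrossing_stays_pos R (fun x => psi x - pi *+ k) dpsi u t).
- by lra.
- move=> x /andP[? ?]; have hx : 0 < x < pi by apply/andP; split; lra.
  apply: is_derive_eq (is_derive1_sub (psi_der hx) (is_derive_cst (pi *+ k) x 1)) _.
  by rewrite subr0.
- move=> x /andP[? ?] /eqP; rewrite subr_eq0 => /eqP E.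
  by apply: psi_up; [apply/andP; split; lra | rewrite E sin_pi_mulrn].
- by rewrite -pT subr_gt0.
Qed.

Lemma crossing_lt (k : nat) (T t : R) : 0 < t -> t < T -> T < pi ->
  psi T = pi *+ k -> psi t < pi *+ k.
Proof.
move=> t0 tT Tpi pT; rewrite ltNge; apply/negP; rewrite le_eqVlt => /predU1P[E|E].
  by have := crossing_gt t0 tT Tpi (esym E); rewrite pT ltxx.
have : 0 < psi T - pi *+ k; last by rewrite pT subrr ltxx.
apply: (@upcrossing_stays_pos R (fun x => psi x - pi *+ k) dpsi t T) => //.
- move=> x /andP[? ?]; have hx : 0 < x < pi by apply/andP; split; lra.
  apply: is_derive_eq (is_derive1_sub (psi_der hx) (is_derive_cst (pi *+ k) x 1)) _.
  by rewrite subr0.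
- move=> x /andP[? ?] /eqP; rewrite subr_eq0 => /eqP E'.
  by apply: psi_up; [apply/andP; split; lra | rewrite E' sin_pi_mulrn].
- by rewrite subr_gt0.
Qed.

Lemma crossing_exists (k : nat) (t : R) : 0 <= t < pi -> pi *+ k.+1 <= psi t ->
  exists2 T, 0 < T <= t & psi T = pi *+ k.+1.
Proof.
move=> /andP[t0 tpi] kt.
have kp : 0 < pi *+ k.+1 :> R by rewrite pmulrn_lgt0 // pi_gt0.
have [||T] := @IVT R psi 0 t (pi *+ k.+1) t0.
- apply: for_continuous_within => x /=; rewrite in_itv /= => /andP[x0 xt].
  by apply: psi_cont; apply/andP; split; lra.
- by rewrite psi_0 ge_min (ltW kp) /= le_max kt orbT.
rewrite in_itv /= => /andP[T0 Tt] pT; exists T => //; rewrite Tt andbT.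
by rewrite lt_neqAle T0 andbT; apply/eqP => E; move: kp; rewrite -pT -E psi_0 ltxx.
Qed.

Lemma crossing_lt_trans (j k : nat) (S T : R) : 0 < S < pi -> 0 < T < pi ->
  psi S = pi *+ j -> psi T = pi *+ k -> (j < k)%N -> S < T.
Proof.
move=> /andP[S0 Spi] /andP[T0 Tpi] pS pT jk; rewrite ltNge; apply/negP.
rewrite le_eqVlt => /predU1P[E|TS].
  have /pi_mulrn_inj E' : pi *+ j = pi *+ k :> R by rewrite -pS -pT E.
  by rewrite E' ltnn in jk.
have := crossing_lt T0 TS Spi pS; rewrite pT ltNge => /negP; apply.
by rewrite le_pi_mulrn ltnW.
Qed.

(* Distinct crossings are distinct zeros of [q], so there are only finitely
   many of them. *)
Lemma crossing_number (q : {poly R}) : q != 0 ->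
  (forall t, 0 < t < pi -> sin (psi t) = 0 -> root q ((1 + cos t) / 2)) ->
  exists N : nat, (forall t, 0 <= t < pi -> psi t < pi *+ N.+1) /\
    (N = 0%N \/ exists2 T, 0 < T < pi & psi T = pi *+ N).
Proof.
move=> q0 hq.
pose P (m : nat) := `[< forall t, 0 <= t < pi -> psi t < pi *+ m.+1 >].
have exP : exists m, P m.
  exists (size q); apply/asboolP => t ht; rewrite ltNge; apply/negP => le_t.
  have ex (k : 'I_(size q)) : exists T, 0 < T < pi /\ psi T = pi *+ k.+1.
    have [|T /andP[T0 Tt] pT] := @crossing_exists k t ht.
      apply: le_trans le_t; by rewrite le_pi_mulrn ltnS ltnW.
    exists T; split => //; have /andP[_ tpi] := ht; apply/andP; split; lra.
  have [T hT] := choice ex.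
  pose rs := [seq (1 + cos (T k)) / 2 | k <- enum 'I_(size q)].
  have : (size rs < size q)%N.
    apply: max_poly_roots => //.
      apply/allP => x /mapP[k _ ->]; have [hk pk] := hT k.
      by apply: hq => //; rewrite pk sin_pi_mulrn.
    rewrite map_inj_uniq ?enum_uniq // => j k E.
    have [/andP[j0 jpi] pj] := hT j; have [/andP[k0 kpi] pk] := hT k.
    have TE : T j = T k.
      apply: cos_inj; rewrite ?in_itv /= ?(ltW j0) ?(ltW jpi) ?(ltW k0) ?(ltW kpi) //.
      by move: E; lra.
    apply: val_inj => /=; have /pi_mulrn_inj[] : pi *+ j.+1 = pi *+ k.+1 :> R.
      by rewrite -pj -pk TE.
    by [].
  by rewrite size_map size_enum_ord ltnn.
case: (ex_minnP exP) => N /asboolP PN minN; exists N; split => //.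
case: N PN minN => [|N] PN minN; [by left|right].
have /asboolPn : ~~ P N by apply/negP => /minN; rewrite ltnn.
move=> /existsNP[t /not_implyP[ht /negP]]; rewrite -leNgt => Nt.
have [T /andP[T0 Tt] pT] := crossing_exists ht Nt.
by exists T => //; have /andP[_ tpi] := ht; apply/andP; split; lra.
Qed.

End Crossing.

(** The nodes decrease, as the cosines of increasing angles do. *)
Lemma ge0_integral_partition (R : realType) (u : R -> R) (t : nat -> R) (m : nat) :
  measurable_fun setT u -> (forall x, 0 <= u x) ->
  (forall k, (k < m)%N -> t k.+1 < t k) ->
  (\int[lebesgue_measure]_(x in `[t m, t 0%N]) (u x)%:E =
   \sum_(k < m) \int[lebesgue_measure]_(x in `[t k.+1, t k]) (u x)%:E)%E.
Proof.
move=> mu u0; have mE : measurable_fun setT (EFin \o u) by apply/measurable_EFinP.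
have mA (A : set R) : measurable A -> measurable_fun A (fun x => (u x)%:E).
  by move=> ?; exact: measurable_funS mE.
elim: m => [|m IH] tlt.
  by rewrite big_ord0 set_itv1 integral_set1.
have tm : t m <= t 0%N.
  have : forall k, (k <= m)%N -> t k <= t 0%N.
    elim=> // k IHk km; apply: le_trans (IHk (ltnW km)).
    by apply/ltW/tlt; rewrite ltnS ltnW.
  exact.
rewrite big_ord_recr /= -IH; last by move=> k km; apply: tlt; rewrite ltnW.
have tlm := tlt m (ltnSn m).
rewrite (@itv_bndbnd_setU _ _ _ (BRight (t m))); last 2 first.
- by rewrite bnd_simp ltW.
- by rewrite bnd_simp.
rewrite ge0_integral_setU //=; last 3 first.
- by apply: mA; exact: measurableU.
- by move=> x _; rewrite lee_fin.
- apply/disj_setPS => x /= [].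
  rewrite !in_itv /= => /andP[_ xm] /andP[mx _].
  by have := lt_le_trans mx xm; rewrite ltxx.
rewrite addeC; congr (_ + _)%E.
by apply: integral_itv_obnd_cbnd; exact: mA.
Qed.

Lemma is_derive_horner (R : realType) (p : {poly R}) (x : R) :
  is_derive x 1 (horner p) p^`().[x].
Proof.
apply: DeriveDef; first exact: derivable_horner.
by rewrite derivE derive1E.
Qed.

Lemma powR_pred (R : realType) (x a : R) : 0 < x -> x `^ (a - 1) = x `^ a / x.
Proof.
move=> x0; rewrite powRB ?powRr1 ?(ltW x0) //.
by rewrite (gt_eqF x0) implybT.
Qed.

(** The polynomial X^(1-b) (X^b J)', whose roots are the interior critical points of X^b J. *)
Definition euler_op (R : realType) (b : R) (J : {poly R}) : {poly R} :=
  'X * J^`() + b *: J.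

Definition kernel_prim (R : realType) (b : R) (J : {poly R}) (t : R) : R :=
  ((1 + t) / 2) `^ b * J.[(1 + t) / 2].

Definition kernel_prim' (R : realType) (b : R) (J : {poly R}) (t : R) : R :=
  2^-1 * ((1 + t) / 2) `^ (b - 1) * (euler_op b J).[(1 + t) / 2].

(** * Regularity of the function X^b J and of its derivative *)

Section KernelPrimitive.
Context {R : realType}.
Variables (b : R) (J : {poly R}).

Let d2 (t : R) : is_derive t 1 (fun x : R => (1 + x) / 2) (1 / 2).
Proof. by apply: is_derive_eq; rewrite /GRing.scale /=; field. Qed.

Lemma is_derive_kernel_prim (t : R) : - 1 < t ->
  is_derive t 1 (kernel_prim b J) (kernel_prim' b J t).
Proof.
move=> t1; have X0 : 0 < (1 + t) / 2 by lra.
have hp := @is_derive1_comp R (fun x => x `^ b) (fun x => (1 + x) / 2) t _ _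
  (is_derive1_powR b X0) (d2 t).
have hJ := @is_derive1_comp R (horner J) (fun x => (1 + x) / 2) t _ _
  (is_derive_horner J _) (d2 t).
apply: is_derive_eq (is_derive1_mul hp hJ) _.
rewrite /kernel_prim' /euler_op /= hornerD hornerM hornerX hornerZ.
rewrite powR_pred //; move: X0; move: ((1 + t) / 2) => X X0.
by field; rewrite gt_eqF.
Qed.

Lemma is_derive_kernel_prim' (t : R) : - 1 < t ->
  is_derive t 1 (kernel_prim' b J)
   (2^-1 * (((b - 1) * ((1 + t) / 2) `^ (b - 1) / ((1 + t) / 2) * (1 / 2)) *
     (euler_op b J).[(1 + t) / 2] +
     ((1 + t) / 2) `^ (b - 1) * ((euler_op b J)^`().[(1 + t) / 2] * (1 / 2)))).
Proof.
move=> t1; have X0 : 0 < (1 + t) / 2 by lra.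
have hp := @is_derive1_comp R (fun x => x `^ (b - 1)) (fun x => (1 + x) / 2) t _ _
  (is_derive1_powR (b - 1) X0) (d2 t).
have hJ := @is_derive1_comp R (horner (euler_op b J)) (fun x => (1 + x) / 2) t _ _
  (is_derive_horner _ _) (d2 t).
have h2 := is_derive1_mul (is_derive_cst (2^-1 : R) t 1) hp.
apply: is_derive_eq (is_derive1_mul h2 hJ) _.
rewrite (powR_pred (b - 1) X0).
by rewrite /cst /=; ring.
Qed.

(** Differentiability can fail only at -1; there X^b tends to its value 0 because b > 0. *)
Lemma kernel_prim_within : 0 < b -> {within `[-1, 1], continuous (kernel_prim b J)}.
Proof.
move=> b0; have lt11 : (-1 : R) < 1 by lra.
apply/(continuous_within_itvP _ lt11); split.
- move=> x; rewrite in_itv /= => /andP[x1 _].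
  exact: is_derive_continuous (is_derive_kernel_prim x1).
- have -> : kernel_prim b J (-1) = 0 * J.[(1 + -1) / 2].
    by rewrite /kernel_prim subrr mul0r powR0 // gt_eqF.
  apply: cvgM.
    apply/cvg_at_rightP => u [u1 ucvg].
    apply: ((cvg_at_rightP _ _ _).1 (powR_cvg0 b0) (fun n => (1 + u n) / 2)).
    split; first by move=> n; have := u1 n; lra.
    rewrite -[X in _ --> X](mul0r (2^-1 : R)) -(subrr (1 : R)).
    apply: cvgM; last exact: cvg_cst.
    by apply: cvgD; [exact: cvg_cst | exact: ucvg].
  apply: cvg_at_right_filter.
  have h := is_derive_continuous (is_derive1_comp (is_derive_horner J _) (d2 (-1))).
  exact: h.
- apply: cvg_at_left_filter; have n1 : (-1 : R) < 1 by lra.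
  exact: is_derive_continuous (is_derive_kernel_prim n1).
Qed.

Lemma kernel_prim'_measurable : measurable_fun setT (kernel_prim' b J).
Proof.
have ml : measurable_fun setT (fun x : R => (1 + x) / 2).
  by apply: measurable_realfun.continuous_measurable_fun => x; exact: is_derive_continuous (d2 x).
apply: measurable_funM; first apply: measurable_funM => //.
  by apply: (measurableT_comp (@measurable_powR R (b - 1))).
apply: (@measurableT_comp _ _ _ _ _ _ (horner (euler_op b J))) => //.
by apply: measurable_realfun.continuous_measurable_fun; exact: continuous_horner.
Qed.

End KernelPrimitive.

(** * The Jacobi equation as a damped oscillator *)

Section Oscillation.
Context {R : realType}.
Variables (b mu : R) (J : {poly R}).
Hypothesis hb : 2 / 3 <= b <= 1.
Hypothesis mu_gt0 : 0 < mu.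
Hypothesis J1 : J.[1] = 1.
Hypothesis J_ode : forall x : R,
  (1 - x) * (euler_op b J)^`().[x] = (euler_op b J).[x] - mu * J.[x].

Let tau := (Num.sqrt mu)^-1.
Let f t := kernel_prim b J (cos t).
Let v t := kernel_prim' b J (cos t).
Let y t := tau * sin t * v t.
(** This is y / g with the common factor sin t cancelled, hence continuous on (-pi, pi). *)
Let h t := tau * (b + (1 - b) * cos t) * v t.

Lemma tau_gt0 : 0 < tau. Proof. by rewrite invr_gt0 sqrtr_gt0. Qed.

Lemma tau2 : tau ^+ 2 = mu^-1.
Proof. by rewrite exprVn sqr_sqrtr // ltW. Qed.

Lemma cos_gtN1 (t : R) : - pi < t < pi -> -1 < cos t.
Proof.
move=> /andP[t1 t2]; rewrite -cos_norm -cospi ltr_cos ?in_itv /= ?pi_ge0 ?lexx ?normr_ge0 //=.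
  by rewrite ltr_norml t1.
by rewrite ler_norml !ltW.
Qed.

Lemma v_der (t : R) : - pi < t < pi -> exists dv, is_derive t 1 v dv.
Proof.
move=> ht; eexists.
exact: is_derive1_comp (is_derive_kernel_prim' b J (cos_gtN1 ht)) (is_derive_cos t).
Qed.

Lemma f_cont t : - pi < t < pi -> {for t, continuous f}.
Proof.
move=> ht; have d := is_derive1_comp (is_derive_kernel_prim b J (cos_gtN1 ht)) (is_derive_cos t).
exact: is_derive_continuous d.
Qed.

Lemma v_cont t : - pi < t < pi -> {for t, continuous v}.
Proof. by move=> /v_der[dv]; exact: is_derive_continuous. Qed.

Lemma y_cont t : - pi < t < pi -> {for t, continuous y}.
Proof.
move=> /v_cont cv; apply: continuousM => //.
by apply: continuousM; [exact: cst_continuous | exact: continuous_sin].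
Qed.

Lemma h_cont t : - pi < t < pi -> {for t, continuous h}.
Proof.
move=> /v_cont cv; apply: continuousM => //.
apply: continuousM; first exact: cst_continuous.
apply: continuousD; first exact: cst_continuous.
by apply: continuousM; [exact: cst_continuous | exact: continuous_cos].
Qed.

Lemma f_der t : 0 < t < pi -> is_derive t 1 f (- (y t / tau)).
Proof.
move=> ht; have ht' : - pi < t < pi.
  by have := @pi_gt0 R; have /andP[? ?] := ht => ?; apply/andP; split; lra.
have d := is_derive1_comp (is_derive_kernel_prim b J (cos_gtN1 ht')) (is_derive_cos t).
apply: is_derive_eq d _; rewrite /y /v.
by field; rewrite gt_eqF // tau_gt0.
Qed.

Lemma y_der t : 0 < t < pi ->
  is_derive t 1 y (f t / tau - y t / recip_friction b t).
Proof.
move=> ht; have ht' : - pi < t < pi.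
  by have := @pi_gt0 R; have /andP[? ?] := ht => ?; apply/andP; split; lra.
have c1 := cos_gtN1 ht'.
have dv := is_derive1_comp (is_derive_kernel_prim' b J c1) (is_derive_cos t).
have ds := is_derive1_mul (is_derive_cst tau t 1) (is_derive_sin t).
apply: is_derive_eq (is_derive1_mul ds dv) _.
have s0 : 0 < sin t by exact: sin_gt0_pi.
have den0 := friction_num_gt0 hb t.
rewrite /cst /= mul0r add0r /y /v /f /recip_friction /kernel_prim /kernel_prim'.
have := J_ode ((1 + cos t) / 2).
have X0 : 0 < (1 + cos t) / 2 by lra.
have s2 : sin t ^+ 2 = 1 - cos t ^+ 2 by rewrite -(cos2Dsin2 t); ring.
rewrite (powR_pred b X0).
have tau0 := tau_gt0; have t2 := tau2.
move: (euler_op b J).[_] (euler_op b J)^`().[_] J.[_] => Q Q' j ode.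
move: (_ `^ b) => q.
(* [J_ode] trades mu J for Q and Q', and tau^2 mu = 1 brings f / tau to the same form; what remains
   is a rational identity in cos t, once sin^2 t is eliminated. *)
have muj : mu * j = Q - (1 - (1 + cos t) / 2) * Q' by rewrite ode; ring.
have qjE : q * j / tau = tau * q * (mu * j).
  have -> : tau * q * (mu * j) = tau ^+ 2 * mu * (q * j / tau) by field; rewrite gt_eqF.
  by rewrite t2 mulVf ?mul1r // gt_eqF.
rewrite qjE muj.
move: X0 s2 den0; move: (cos t) (sin t) s0 => c s s0 X0 s2 den0.
have n1 : 1 + c != 0 by rewrite gt_eqF //; lra.
have -> : tau * s * (2^-1 * ((b - 1) * (q / ((1 + c) / 2)) / ((1 + c) / 2) * (1 / 2) * Q +
   q / ((1 + c) / 2) * (Q' * (1 / 2))) * - s) =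
  - tau * s ^+ 2 * (2^-1 * ((b - 1) * (q / ((1 + c) / 2)) / ((1 + c) / 2) * (1 / 2) * Q +
   q / ((1 + c) / 2) * (Q' * (1 / 2)))) by ring.
rewrite s2.
by field; rewrite n1 !gt_eqF.
Qed.

Lemma h_def t : 0 < t < pi -> h t = y t / recip_friction b t.
Proof.
move=> ht; rewrite /h /y /recip_friction.
have s0 : 0 < sin t by exact: sin_gt0_pi.
have den0 := friction_num_gt0 hb t.
by field; rewrite !gt_eqF.
Qed.

Lemma f_0 : f 0 = 1.
Proof. by rewrite /f /kernel_prim cos0 -[1 + 1]/(2%:R) divff // powR1 J1 mulr1. Qed.

Lemma y_0 : y 0 = 0.
Proof. by rewrite /y sin0 mulr0 mul0r. Qed.

Definition energy t := f t ^+ 2 + y t ^+ 2.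

Lemma oscillation_phase : exists psi : R -> R,
  [/\ psi 0 = 0, forall t, 0 <= t < pi -> {for t, continuous psi},
      forall t, 0 < t < pi -> is_derive t 1 psi (phase_speed b tau (psi t) t) &
      forall t, 0 <= t < pi ->
        kernel_prim b J (cos t) = Num.sqrt (energy t) * cos (psi t) /\
        y t = Num.sqrt (energy t) * sin (psi t)].
Proof.
exact: (@phase_exists R b tau f y h hb tau_gt0 f_cont y_cont h_cont h_def f_0 y_0 f_der y_der).
Qed.

Lemma oscillation_speed_gt0 (psi : R -> R) (T : R) :
  (forall t, 0 <= t < pi ->
        kernel_prim b J (cos t) = Num.sqrt (energy t) * cos (psi t) /\
        y t = Num.sqrt (energy t) * sin (psi t)) ->
  0 < T < pi -> sin (psi T) = 0 ->
  forall t, 0 < t < T -> 0 < phase_speed b tau (psi t) t.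
Proof.
exact: (@phase_speed_gt0 R b tau f y hb tau_gt0 f_cont y_cont f_0 y_0 f_der y_der).
Qed.

Lemma oscillation_energy_gt0 t : 0 <= t < pi -> 0 < energy t.
Proof. exact: (@energy_gt0 R b tau f y hb tau_gt0 f_cont y_cont f_0 y_0 f_der y_der). Qed.

Lemma log_energy_0 : ln (energy 0) = 0.
Proof. by rewrite /energy f_0 y_0 expr1n expr0n addr0 ln1. Qed.

Lemma log_energy_cont t : 0 <= t < pi -> {for t, continuous (fun t => ln (energy t))}.
Proof.
move=> ht; have E0 := oscillation_energy_gt0 ht.
have cE : {for t, continuous energy} by apply: energy_cont; [exact: f_cont|exact: y_cont|exact: pi_itv_nneg].
exact: (continuous_comp cE (continuous_ln E0)).
Qed.

Lemma log_energy_der (psi : R -> R) t :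
  (forall t, 0 <= t < pi ->
        kernel_prim b J (cos t) = Num.sqrt (energy t) * cos (psi t) /\
        y t = Num.sqrt (energy t) * sin (psi t)) ->
  0 < t < pi ->
  is_derive t 1 (fun t => ln (energy t))
    (- (2 * sin (psi t) ^+ 2 / recip_friction b t)).
Proof.
move=> fy ht; have ht' : 0 <= t < pi by have /andP[/ltW -> ->] := ht.
have E0 := oscillation_energy_gt0 ht'.
have dE := energy_der hb tau_gt0 f_der y_der ht.
apply: is_derive_eq (is_derive1_comp (is_derive1_ln E0) dE) _.
have [_ yE] := fy _ ht'; rewrite yE exprMn sqr_sqrtr ?ltW //.
have := recip_friction_gt0 hb ht.
by move: (recip_friction _ _) => g g0; field; rewrite !gt_eqF.
Qed.

End Oscillation.

(** * The variation as a sum of amplitudes *)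

Section Variation.
Context {R : realType}.
Variables (b mu : R) (J : {poly R}).
Hypothesis hb : 2 / 3 <= b <= 1.
Hypothesis mu_gt0 : 0 < mu.
Hypothesis J1 : J.[1] = 1.
Hypothesis J_ode : forall x : R,
  (1 - x) * (euler_op b J)^`().[x] = (euler_op b J).[x] - mu * J.[x].

Let tau := (Num.sqrt mu)^-1.
Let E := energy b mu J.

Variable psi : R -> R.
Hypothesis psi_0 : psi 0 = 0.
Hypothesis psi_cont : forall t, 0 <= t < pi -> {for t, continuous psi}.
Hypothesis psi_der : forall t, 0 < t < pi ->
  is_derive t 1 psi (phase_speed b tau (psi t) t).
Hypothesis polar : forall t, 0 <= t < pi ->
  kernel_prim b J (cos t) = Num.sqrt (E t) * cos (psi t) /\
  tau * sin t * kernel_prim' b J (cos t) = Num.sqrt (E t) * sin (psi t).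

Lemma phase_upcrossing t : 0 < t < pi -> sin (psi t) = 0 ->
  0 < phase_speed b tau (psi t) t.
Proof.
by move=> _ s0; rewrite /phase_speed s0 mulr0 mul0r subr0 invr_gt0 tau_gt0.
Qed.

(** Gives the sign of sin psi before the first crossing. Near 0 a phase in (-1, 0] has cos psi sin
    psi <= 0, so its speed is at least 1/tau. *)
Lemma phase_gt0 t : 0 < t < pi -> 0 < psi t.
Proof.
move=> /andP[t0 tpi]; pose m := (t + pi) / 2.
have pi2 := @pi_ge2 R.
have tm : t < m by rewrite /m; lra.
have mpi : m < pi by rewrite /m; lra.
have pos x : 0 < x < m -> 0 < x < pi by move=> /andP[? ?]; apply/andP; split; lra.
have h0 : - 1 < psi 0 by rewrite psi_0; lra.
have pi_itv : 0 <= (0 : R) < pi by rewrite lexx pi_gt0.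
have [e /= e0 he] := psi_cont pi_itv (lt_nbhsr h0).
apply: (@initial_barrier R psi (fun x => phase_speed b tau (psi x) x) m e) => //.
- apply: for_continuous_within => x /=; rewrite in_itv /= => /andP[? ?].
  by apply: psi_cont; apply/andP; split; lra.
- by rewrite psi_0.
- by move=> x /pos; exact: psi_der.
- by move=> x /pos hx px; apply: phase_upcrossing; rewrite // px sin0.
- move=> x /[dup] /andP[x0 _] /pos hx xe px.
  have px1 : - 1 < psi x by apply: he; rewrite /= sub0r normrN gtr0_norm.
  apply: (@lt_le_trans _ _ tau^-1); first by rewrite invr_gt0 tau_gt0.
  rewrite /phase_speed lerBrDr gerDl pmulr_lle0 ?invr_gt0 ?recip_friction_gt0 //.
  apply: mulr_ge0_le0; first by apply: cos_ge0_pihalf; apply/andP; split; lra.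
  rewrite -oppr_ge0 -sinN; apply: sin_ge0_pi; apply/andP; split; lra.
- by rewrite t0.
Qed.

Lemma euler_op_at1 : (euler_op b J).[1] = mu.
Proof. by have := J_ode 1; rewrite subrr mul0r J1 mulr1 => /esym/subr0_eq. Qed.

(** The other factors of y do not vanish inside (0, pi). Crossings thus become roots of one nonzero
    polynomial, as [crossing_number] requires. *)
Lemma crossing_root t : 0 < t < pi -> sin (psi t) = 0 ->
  root (euler_op b J) ((1 + cos t) / 2).
Proof.
move=> ht s0; have ht' : 0 <= t < pi by have /andP[/ltW -> ->] := ht.
have [_] := polar ht'; rewrite s0 mulr0 => /eqP.
rewrite !mulf_eq0 gt_eqF ?tau_gt0 //= gt_eqF ?sin_gt0_pi //=.
rewrite invr_eq0 pnatr_eq0 /= powR_eq0 => /orP[/andP[/eqP X0 _]|//].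
have : -1 < cos t.
  by apply: cos_gtN1; have := @pi_gt0 R; have /andP[? ?] := ht => ?; apply/andP; split; lra.
lra.
Qed.

Variables (N : nat) (th : nat -> R).
Hypothesis th0 : th 0%N = 0.
Hypothesis thN : th N.+1 = pi.
Hypothesis th_cross : forall k, (0 < k <= N)%N -> 0 < th k < pi /\ psi (th k) = pi *+ k.

(** The amplitude R_k. At the end angles 0 and pi it is 1 and 0, the latter because X^b vanishes at
    X = 0, so the two extreme arcs obey the same formula as the others. *)
Let amp (k : nat) := (-1) ^+ k * kernel_prim b J (cos (th k)).

Lemma b_gt0 : 0 < b. Proof. by have /andP[? _] := hb; lra. Qed.

Lemma th_itv k : (k <= N.+1)%N -> 0 <= th k <= pi.
Proof.
case: k => [|k]; first by rewrite th0 lexx pi_ge0.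
rewrite leq_eqVlt => /predU1P[->|kN]; first by rewrite thN lexx pi_ge0.
by have [|/andP[? ?] _] := th_cross (k := k.+1) _ => //; rewrite !ltW.
Qed.

Lemma th_incr k : (k <= N)%N -> th k < th k.+1.
Proof.
case: k => [|k] kN.
  rewrite th0; case: N thN th_cross => [->|M _ thM]; first by rewrite pi_gt0.
  by have [//|/andP[]] := thM 1%N.
have [//|hk pk] := th_cross (k := k.+1) _.
move: kN; rewrite leq_eqVlt => /predU1P[E'|kN].
  by rewrite E' thN -E'; case/andP: hk.
have [//|hk' pk'] := th_cross (k := k.+2) _.
exact: (@crossing_lt_trans R psi (fun s => phase_speed b tau (psi s) s)
  psi_der phase_upcrossing k.+1 k.+2 _ _ hk hk' pk pk' (ltnSn _)).
Qed.

Lemma amp_ge0 k : (k <= N.+1)%N -> 0 <= amp k.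
Proof.
case: k => [|k] kN.
  by rewrite /amp th0 expr0 mul1r cos0 /kernel_prim -[1 + 1]/(2%:R) divff // powR1 J1 mulr1.
move: kN; rewrite leq_eqVlt => /predU1P[->|kN].
  by rewrite /amp thN cospi /kernel_prim subrr mul0r powR0 ?gt_eqF ?b_gt0 // mul0r mulr0.
have [//|hk pk] := th_cross (k := k.+1) _.
have hk' : 0 <= th k.+1 < pi by have /andP[/ltW -> ->] := hk.
have [fE _] := polar hk'.
by rewrite /amp fE pk cos_pi_mulrn mulrCA -exprMn mulrNN mulr1 expr1n mulr1 sqrtr_ge0.
Qed.

Lemma amp_sub k : kernel_prim b J (cos (th k)) - kernel_prim b J (cos (th k.+1)) =
  (-1) ^+ k * (amp k + amp k.+1).
Proof.
have ss : (-1) ^+ k * (-1) ^+ k = 1 :> R by rewrite -exprMn mulrNN mulr1 expr1n.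
rewrite /amp exprS; move: ss; move: ((-1) ^+ k) (kernel_prim _ _ _) => s x ss.
by rewrite -[LHS]mul1r -[in LHS]ss; ring.
Qed.

Let t k := cos (th k).

Lemma t_decr k : (k <= N)%N -> t k.+1 < t k.
Proof.
by move=> kN; rewrite /t ltr_cos ?th_incr // in_itv /= th_itv // ltnW.
Qed.

Lemma t_itv k : (k <= N.+1)%N -> -1 <= t k <= 1.
Proof. by move=> _; rewrite cos_geN1 cos_le1. Qed.

Lemma variation_partition :
  (\int[lebesgue_measure]_(x in `[(-1)%R, 1%R]) (`|kernel_prim' b J x|)%:E =
   \sum_(k < N.+1) \int[lebesgue_measure]_(x in `[t k.+1, t k])
      (`|kernel_prim' b J x|)%:E)%E.
Proof.
rewrite -(@ge0_integral_partition R (fun x => `|kernel_prim' b J x|) t N.+1).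
- by rewrite /t th0 thN cos0 cospi.
- by apply: measurableT_comp => //; exact: kernel_prim'_measurable.
- by [].
- by move=> k; rewrite ltnS; exact: t_decr.
Qed.

Lemma kernel_prim_arc k : (k <= N)%N ->
  {within `[t k.+1, t k], continuous (kernel_prim b J)}.
Proof.
move=> kN; have cw := @kernel_prim_within R b J b_gt0.
apply: (continuous_subspaceW _ cw).
have /andP[h1 _] := @t_itv k.+1 kN; have /andP[_ h2] := t_itv (leqW kN).
by apply: subset_itv; rewrite bnd_simp.
Qed.

Lemma arc_gtN1 k x : (k <= N)%N -> t k.+1 < x < t k -> -1 < x.
Proof.
by move=> kN /andP[h _]; have /andP[h1 _] := @t_itv k.+1 kN; exact: le_lt_trans h.
Qed.

(** The crossings listed by [th] need not be all of them: between two listed points the variation is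
    at least the increment, whatever happens in between. This form serves the larger degree. *)
Lemma le_variation :
  ((\sum_(k < N.+1) (amp k + amp k.+1))%:E <=
   \int[lebesgue_measure]_(x in `[(-1)%R, 1%R]) (`|kernel_prim' b J x|)%:E)%E.
Proof.
rewrite variation_partition -sumEFin; apply: lee_sum => k _.
have kN : (k <= N)%N by rewrite -ltnS.
have -> : amp k + amp k.+1 = `|kernel_prim b J (t k) - kernel_prim b J (t k.+1)|.
  rewrite amp_sub normrM normrX normrN1 expr1n mul1r ger0_norm //.
  by rewrite addr_ge0 // amp_ge0 // leqW.
apply: le_improper_variation; first exact: t_decr.
- exact: kernel_prim_arc.
- by move=> x /(arc_gtN1 kN); exact: is_derive_kernel_prim.
- by move=> x /(arc_gtN1 kN)/(is_derive_kernel_prim' b J); exact: is_derive_continuous.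
Qed.

(** The phase never reaches (N + 1) pi, so the list of crossings is complete and the derivative has
    the constant sign (-1)^k on the arc k. *)
Lemma variation_eq : (forall s, 0 <= s < pi -> psi s < pi *+ N.+1) ->
  (\int[lebesgue_measure]_(x in `[(-1)%R, 1%R]) (`|kernel_prim' b J x|)%:E =
   (\sum_(k < N.+1) (amp k + amp k.+1))%:E)%E.
Proof.
move=> psiN; rewrite variation_partition -sumEFin; apply: eq_bigr => k _.
have kN : (k <= N)%N by rewrite -ltnS.
pose s := (-1) ^+ k : R.
have s1 : `|s| = 1 by rewrite normrX normrN1 expr1n.
have ss : s * s = 1 by rewrite -exprMn mulrNN mulr1 expr1n.
have pos x : t k.+1 < x < t k -> 0 <= s * kernel_prim' b J x.
  move=> /andP[x1 x2]; have x11 : -1 <= x <= 1.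
    have /andP[h1 _] := @t_itv k.+1 kN; have /andP[_ h2] := t_itv (leqW kN).
    by apply/andP; split; lra.
  pose a := acos x; have xE : x = cos a by rewrite acosK // in_itv.
  have a0 : 0 <= a <= pi by rewrite acos_ge0 ?acos_lepi.
  have /andP[k0 kpi] := th_itv (leqW kN).
  have /andP[k1 kpi1] := @th_itv k.+1 kN.
  have ak : th k < a.
    by move: x2; rewrite xE /t ltr_cos // in_itv /= ?k0.
  have ak1 : a < th k.+1.
    by move: x1; rewrite xE /t ltr_cos // in_itv /= ?k1.
  have ha : 0 < a < pi by apply/andP; split; lra.
  have ha' : 0 <= a < pi by have /andP[/ltW -> ->] := ha.
  have [_ yE] := polar ha'.
  (* On the arc k the phase lies strictly between k pi and (k + 1) pi. The lower bound is
     [phase_gt0] for k = 0 and [crossing_gt] otherwise; on the last arc the upper bound is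
     [psiN]. *)
  have sg : 0 < s * sin (psi a).
    apply: sin_sign; apply/andP; split.
      move: kN ak {kpi}; rewrite /s; case: (nat_of_ord k) => [|j] jN ak.
        by rewrite mulr0n phase_gt0.
      have [//|/andP[j0 jpi] pj] := th_cross (k := j.+1) _.
      have /andP[_ api] := ha.
      exact: (@crossing_gt R psi (fun s => phase_speed b tau (psi s) s)
        psi_der phase_upcrossing j.+1 _ _ j0 ak api pj).
    move: (kN); rewrite leq_eqVlt => /predU1P[->|kN']; first exact: psiN.
    have [//|/andP[j0 jpi] pj] := th_cross (k := k.+1) _.
    have /andP[a00 _] := ha.
    exact: (@crossing_lt R psi (fun s => phase_speed b tau (psi s) s)
        psi_der phase_upcrossing k.+1 _ _ a00 ak1 jpi pj).
  have : 0 < s * (tau * sin a * kernel_prim' b J (cos a)).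
    by rewrite yE mulrCA mulr_gt0 // sqrtr_gt0 oscillation_energy_gt0.
  rewrite -xE mulrCA pmulr_rgt0; first by move=> /ltW.
  by rewrite mulr_gt0 ?tau_gt0 // sin_gt0_pi.
apply: (etrans (@ge0_improper_FTC R (t k.+1) (t k) (fun x => s * kernel_prim b J x)
  (fun x => `|kernel_prim' b J x|) _ _ _ _ _)).
- exact: t_decr.
- move=> x; apply: cvgM; first exact: cvg_cst.
  exact: kernel_prim_arc.
- move=> x hx; have x1 := arc_gtN1 kN hx.
  have d := is_derive1_mul (is_derive_cst s x 1) (is_derive_kernel_prim b J x1).
  apply: is_derive_eq d _; rewrite /cst /= mul0r add0r.
  by rewrite -[LHS]ger0_norm ?pos // normrM s1 mul1r.
- move=> x /(arc_gtN1 kN)/(is_derive_kernel_prim' b J)/is_derive_continuous c.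
  by apply: cvg_norm; exact: c.
- by [].
- congr (_%:E); rewrite -mulrBr amp_sub mulrA.
  by rewrite ss mul1r.
Qed.

End Variation.

(** * Comparison of the variations for two degrees *)

Section VariationComparison.
Context {R : realType}.
Variables (b mu1 mu2 : R) (J1 J2 : {poly R}).
Hypothesis hb : 2 / 3 <= b <= 1.
Hypothesis mu1_gt0 : 0 < mu1.
Hypothesis mu12 : mu1 < mu2.
Hypothesis J1_1 : J1.[1] = 1.
Hypothesis J2_1 : J2.[1] = 1.
Hypothesis J1_ode : forall x : R,
  (1 - x) * (euler_op b J1)^`().[x] = (euler_op b J1).[x] - mu1 * J1.[x].
Hypothesis J2_ode : forall x : R,
  (1 - x) * (euler_op b J2)^`().[x] = (euler_op b J2).[x] - mu2 * J2.[x].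

Let V (J : {poly R}) : \bar R :=
  (\int[lebesgue_measure]_(x in `[(-1)%R, 1%R]) (`|kernel_prim' b J x|)%:E)%E.

(** The increments over the two intervals cut at the point s = 2 x - 1 already sum to (1 - F(s)) -
    F(s) > 1, because F(1) = 1, F(-1) = 0 and F(s) < 0. *)
Lemma variation_gt1 (J : {poly R}) (x : R) : J.[1] = 1 -> 0 < x < 1 -> J.[x] < 0 ->
  (1%:E < V J)%E.
Proof.
move=> JE /andP[x0 x1] Jx.
have b0 : 0 < b by have /andP[? _] := hb; lra.
pose t (k : nat) : R := if k is 0%N then 1 else if k is 1%N then 2 * x - 1 else -1.
have part := @ge0_integral_partition R (fun x => `|kernel_prim' b J x|) t 2.
have {}part : V J = (\sum_(k < 2) \int[lebesgue_measure]_(x in `[t k.+1, t k])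
      (`|kernel_prim' b J x|)%:E)%E.
  apply: part => //.
    by apply: measurableT_comp => //; exact: kernel_prim'_measurable.
  by case=> [|[|//]] _ /=; lra.
rewrite part 2!big_ord_recr big_ord0 /= add0e.
have arc c d : -1 <= c -> c < d -> d <= 1 ->
  ((`|kernel_prim b J d - kernel_prim b J c|)%:E <=
    \int[lebesgue_measure]_(t in `[c, d]) (`|kernel_prim' b J t|)%:E)%E.
  move=> c1 cd d1; apply: le_improper_variation => //.
  - have cw := @kernel_prim_within R b J b0; apply: (continuous_subspaceW _ cw).
    by apply: subset_itv; rewrite bnd_simp.
  - by move=> s /andP[s1 s2]; apply: is_derive_kernel_prim; lra.
  - move=> s /andP[s1 s2].
    have s3 : -1 < s by lra.
    exact: is_derive_continuous (is_derive_kernel_prim' b J s3).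
have a1 : (-1 : R) <= 2 * x - 1 by lra.
have a2 : 2 * x - 1 < 1 by lra.
have a3 : (-1 : R) < 2 * x - 1 by lra.
have a4 : 2 * x - 1 <= 1 by lra.
have h1 := arc _ _ a1 a2 (lexx _); have h2 := arc _ _ (lexx _) a3 a4.
apply: lt_le_trans (leeD h1 h2).
rewrite -EFinD lte_fin.
have k0 : kernel_prim b J (-1) = 0.
  by rewrite /kernel_prim subrr mul0r powR0 ?gt_eqF // mul0r.
have k1 : kernel_prim b J 1 = 1.
  by rewrite /kernel_prim -[1 + 1]/(2%:R) divff // powR1 JE mulr1.
have kx : kernel_prim b J (2 * x - 1) < 0.
  rewrite /kernel_prim; have -> : (1 + (2 * x - 1)) / 2 = x by field.
  by rewrite pmulr_rlt0 // powR_gt0.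
rewrite k0 k1 subr0 gtr0_norm ?ltr0_norm //; lra.
Qed.

Theorem variation_lt (x : R) : 0 < x < 1 -> J2.[x] < 0 -> (V J1 < V J2)%E.
Proof.
move=> hx J2x.
have mu2_gt0 : 0 < mu2 := lt_trans mu1_gt0 mu12.
have [psi1 [psi1_0 psi1_cont psi1_der polar1]] := oscillation_phase hb mu1_gt0 J1_1 J1_ode.
have [psi2 [psi2_0 psi2_cont psi2_der polar2]] := oscillation_phase hb mu2_gt0 J2_1 J2_ode.
pose tau1 := (Num.sqrt mu1)^-1; pose tau2 := (Num.sqrt mu2)^-1.
have tau2_gt0 : 0 < tau2 by exact: tau_gt0.
have tau21 : tau2 < tau1.
  by rewrite ltf_pV2 ?posrE ?sqrtr_gt0 // ltr_sqrt.
have Q1n0 : euler_op b J1 != 0.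
  apply/eqP => Q0; have := euler_op_at1 J1_1 J1_ode.
  by rewrite Q0 horner0 => E; move: mu1_gt0; rewrite -E ltxx.
have [N [psi1N exT]] := crossing_number psi1_cont psi1_0 Q1n0
   (crossing_root mu1_gt0 polar1).
(* One pair holds the k-th crossing times of both motions, chosen together so that [amplitude_lt]
   compares them. The values (0, 0) at k = 0 and (pi, pi) beyond [N] supply the end angles. *)
have cross (k : nat) : exists p : R * R,
    [/\ (k = 0%N -> p = (0, 0)), ((N < k)%N -> p = (pi, pi)) &
     (0 < k <= N)%N -> [/\ 0 < p.1 < pi /\ psi1 p.1 = pi *+ k,
        0 < p.2 < pi /\ psi2 p.2 = pi *+ k &
        ln (energy b mu1 J1 p.1) < ln (energy b mu2 J2 p.2)]].
  case: k => [|k]; first by exists (0, 0).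
  have [Nk|kN] := ltnP N k.+1; first by exists (pi, pi).
  case: exT => [N0|[T /andP[T0 Tpi] pT]]; first by rewrite N0 in kN.
  have [||T1 /andP[T10 T1T] pT1] := @crossing_exists R psi1 psi1_cont psi1_0 k T.
  - by rewrite (ltW T0).
  - by rewrite pT le_pi_mulrn.
  have hT1 : 0 < T1 < pi by apply/andP; split; lra.
  have L0 : 0 < pi *+ k.+1 :> R by rewrite pmulrn_lgt0 // pi_gt0.
  have [T2 [hT2 pT2 e12]] := @amplitude_lt R b tau1 tau2 psi1 psi2 hb tau2_gt0 tau21
    psi1_cont psi2_cont psi1_0 psi2_0 psi1_der psi2_der
    (fun t => ln (energy b mu1 J1 t)) (fun t => ln (energy b mu2 J2 t)) T1 (pi *+ k.+1)
    hT1 pT1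
    (oscillation_speed_gt0 hb mu1_gt0 J1_1 J1_ode polar1 hT1 (etrans (congr1 sin pT1) (sin_pi_mulrn _)))
    (fun T hT pT => oscillation_speed_gt0 hb mu2_gt0 J2_1 J2_ode polar2 hT
      (etrans (congr1 sin pT) (sin_pi_mulrn _)))
    L0
    (log_energy_cont hb mu1_gt0 J1_1 J1_ode) (log_energy_cont hb mu2_gt0 J2_1 J2_ode)
    (log_energy_0 b mu1 J1_1) (log_energy_0 b mu2 J2_1)
    (fun t => log_energy_der hb mu1_gt0 J1_1 J1_ode polar1 (t := t))
    (fun t => log_energy_der hb mu2_gt0 J2_1 J2_ode polar2 (t := t)).
  by exists (T1, T2); split.
have [p hp] := choice cross.
pose th1 k := (p k).1; pose th2 k := (p k).2.
have th1_0 : th1 0%N = 0 by rewrite /th1 /th2; have [-> //] := hp 0%N.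
have th2_0 : th2 0%N = 0 by rewrite /th1 /th2; have [-> //] := hp 0%N.
have th1_N : th1 N.+1 = pi by rewrite /th1 /th2; have [_ -> //] := hp N.+1.
have th2_N : th2 N.+1 = pi by rewrite /th1 /th2; have [_ -> //] := hp N.+1.
have th1_c k : (0 < k <= N)%N -> 0 < th1 k < pi /\ psi1 (th1 k) = pi *+ k.
  by move=> kN; have [_ _ /(_ kN)[]] := hp k.
have th2_c k : (0 < k <= N)%N -> 0 < th2 k < pi /\ psi2 (th2 k) = pi *+ k.
  by move=> kN; have [_ _ /(_ kN)[]] := hp k.
have V1 := variation_eq hb mu1_gt0 J1_1 J1_ode psi1_0 psi1_cont psi1_der polar1
  th1_0 th1_N th1_c psi1N.
have V2 := le_variation hb mu2_gt0 J2_1 psi2_der polar2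
  th2_0 th2_N th2_c.
pose amp1 k := (-1) ^+ k * kernel_prim b J1 (cos (th1 k)).
pose amp2 k := (-1) ^+ k * kernel_prim b J2 (cos (th2 k)).
have ampE (mu : R) (J : {poly R}) (psi : R -> R) (t : R) (k : nat) :
    (forall t, 0 <= t < pi ->
        kernel_prim b J (cos t) = Num.sqrt (energy b mu J t) * cos (psi t) /\
        (Num.sqrt mu)^-1 * sin t * kernel_prim' b J (cos t) =
          Num.sqrt (energy b mu J t) * sin (psi t)) ->
    0 < t < pi -> psi t = pi *+ k ->
    (-1) ^+ k * kernel_prim b J (cos t) = Num.sqrt (energy b mu J t).
  move=> polar ht pt; have ht' : 0 <= t < pi by have /andP[/ltW -> ->] := ht.
  have [-> _] := polar _ ht'; rewrite pt cos_pi_mulrn mulrCA -exprMn.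
  by rewrite mulrNN mulr1 expr1n mulr1.
have amp_lt k : (0 < k <= N)%N -> amp1 k < amp2 k.
  move=> kN; have [_ _ /(_ kN) [[h1 p1] [h2 p2] e12]] := hp k.
  rewrite /amp1 /amp2 (ampE mu1 J1 psi1 _ _ polar1 h1 p1) (ampE mu2 J2 psi2 _ _ polar2 h2 p2).
  have E1 : 0 < energy b mu1 J1 (th1 k).
    apply: (oscillation_energy_gt0 hb mu1_gt0 J1_1 J1_ode).
    by have /andP[/ltW -> ->] := h1.
  have E2 : 0 < energy b mu2 J2 (th2 k).
    apply: (oscillation_energy_gt0 hb mu2_gt0 J2_1 J2_ode).
    by have /andP[/ltW -> ->] := h2.
  by rewrite ltr_sqrt //; move: e12; rewrite ltr_ln ?posrE.
have amp0 : amp1 0%N = amp2 0%N.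
  rewrite /amp1 /amp2 th1_0 th2_0 cos0 /kernel_prim -[1 + 1]/(2%:R) divff //.
  by rewrite J1_1 J2_1.
have b0 : 0 < b by have /andP[? _] := hb; lra.
have ampN : amp1 N.+1 = amp2 N.+1.
  by rewrite /amp1 /amp2 th1_N th2_N cospi /kernel_prim subrr mul0r powR0 ?gt_eqF // !mul0r.
have amp_le k : (k <= N.+1)%N -> amp1 k <= amp2 k.
  case: k => [|k]; first by rewrite amp0.
  rewrite leq_eqVlt => /predU1P[->|kN]; first by rewrite ampN.
  by apply/ltW/amp_lt.
(* Without crossings of the first motion its variation is 1 and the amplitudes give no strictness;
   the negative value of [J2] does. *)
have [N0|N0] := posnP N.
  apply: (@le_lt_trans _ _ 1%:E); last exact: variation_gt1 J2_1 hx J2x.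
  have th11 : th1 1%N = pi by rewrite -th1_N N0.
  rewrite /V V1 lee_fin N0 big_ord_recl big_ord0 addr0 /= th1_0 th11 cos0 cospi.
  rewrite /kernel_prim subrr mul0r powR0 ?gt_eqF // mul0r mulr0 addr0.
  by rewrite -[1 + 1]/(2%:R) divff // powR1 J1_1 expr0 !mulr1.
apply: lt_le_trans V2; rewrite /V V1 lte_fin.
(* As N > 0, the first summand contains the amplitude of index 1, where the inequality is strict;
   the other summands compare weakly. *)
rewrite big_ord_recl [X in _ < X]big_ord_recl; apply: ltr_leD.
  by rewrite -/(amp1 0%N) -/(amp2 0%N) amp0 ltrD2l amp_lt.
apply: ler_sum => k _; apply: lerD; apply: amp_le => /=.
  by rewrite ltnS ltnW.
by rewrite /bump /= add1n !ltnS.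
Qed.

End VariationComparison.

(** The Jacobi polynomial in the variable X = (1 + t) / 2, for which (t - 1) / 2 = X - 1. *)
Definition jacobiX (R : realType) (a b : R) (n : nat) : {poly R} :=
  (n`!%:R)^-1 *:
    \sum_(k < n.+1)
      ('C(n, k)%:R * pochhammer (n%:R + a + b + 1) k
        * pochhammer (a + k%:R + 1) (n - k)) *: ('X - 1) ^+ k.

(** This is X (1 - X) p'' + (b + 1 - (a + b + 2) X) p', grouped around X p' because X d/dX is
    diagonal on the monomials. *)
Definition jacobi_op (R : realType) (a b : R) (p : {poly R}) : {poly R} :=
  (1 - 'X) * ('X * p^`())^`() + b *: p^`() - (a + b + 1) *: ('X * p^`()).

(** * The Jacobi differential operator and its polynomial eigenfunctions *)

Section JacobiOperator.
Context {R : realType}.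
Implicit Types (a b : R) (p q : {poly R}).

Lemma jacobi_horner a b n t :
  (jacobi a b n).[t] = (jacobiX a b n).[(1 + t) / 2].
Proof.
rewrite /jacobi /jacobiX !hornerZ !horner_sum; congr (_ * _).
apply: eq_bigr => k _; rewrite !hornerZ !horner_exp; congr (_ * _ ^+ _).
by rewrite hornerZ !hornerE; field.
Qed.

Lemma jacobi_op_additive a b p q :
  jacobi_op a b (p + q) = jacobi_op a b p + jacobi_op a b q.
Proof.
rewrite /jacobi_op !(derivD, mulrDr, scalerDr) opprD.
by rewrite -!mul_polyC; ring.
Qed.

Lemma jacobi_op_scale a b c p : jacobi_op a b (c *: p) = c *: jacobi_op a b p.
Proof.
rewrite /jacobi_op !derivZ -!scalerAr derivZ -!scalerAr !scalerBr scalerDr.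
by rewrite -!mul_polyC; ring.
Qed.

HB.instance Definition _ a b := GRing.isLinear.Build R {poly R} {poly R} _ (jacobi_op a b)
  (fun c p q => etrans (jacobi_op_additive a b _ _)
     (congr1 (fun z => z + _) (jacobi_op_scale a b c p))).

Lemma pochhammerS a k : pochhammer a k.+1 = pochhammer a k * (a + k%:R).
Proof. by rewrite /pochhammer big_ord_recr. Qed.

Lemma pochhammer0 a : pochhammer a 0 = 1.
Proof. by rewrite /pochhammer big_ord0. Qed.

Lemma pochhammerSl a k : pochhammer a k.+1 = a * pochhammer (a + 1) k.
Proof.
rewrite /pochhammer big_ord_recl /= addr0; congr (_ * _); apply: eq_bigr => i _.
by rewrite /bump /= add1n -natr1; ring.
Qed.

Lemma jacobi_op_Xsub1 a b k :
  jacobi_op a b (('X - 1) ^+ k) =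
  - (k%:R * (k%:R + a + b + 1)) *: ('X - 1) ^+ k
  - (k%:R * (k%:R + a)) *: ('X - 1) ^+ k.-1.
Proof.
have dz : ('X - 1 : {poly R})^`() = 1 by rewrite derivB derivX derivC subr0.
have dpow j : (('X - 1 : {poly R}) ^+ j.+1)^`() = j.+1%:R%:P * ('X - 1) ^+ j.
  by rewrite deriv_exp dz mul1r -mulr_natl polyC_natr.
rewrite /jacobi_op; case: k => [|[|k]] /=.
- by rewrite expr0 derivC mulr0 deriv0 mulr0 !mul0r oppr0 !scale0r scaler0 !subr0 addr0 scaler0 subr0.
- rewrite !expr1 dz mulr1 derivX -!mul_polyC expr0.
  by rewrite !(polyCN, polyCM, polyCD); ring.
- have -> : ('X * (('X - 1) ^+ k.+2)^`() : {poly R}) =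
     k.+2%:R%:P * (('X - 1) ^+ k.+2 + ('X - 1) ^+ k.+1).
    by rewrite dpow [('X - 1) ^+ k.+2]exprS; ring.
  rewrite derivM derivC mul0r add0r derivD !dpow.
  rewrite [('X - 1) ^+ k.+2]exprS [('X - 1) ^+ k.+1]exprS -[k.+2%:R]natr1.
  move: (k.+1%:R : R) => c.
  rewrite -!mul_polyC !(polyCN, polyCM, polyCD).
  by ring.
Qed.

Lemma jacobiX_ode a b n :
  jacobi_op a b (jacobiX a b n) = - (n%:R * (n%:R + a + b + 1)) *: jacobiX a b n.
Proof.
rewrite /jacobiX linearZ /= scalerA mulrC -scalerA; congr (_ *: _).
rewrite linear_sum /= scaler_sumr.
set d := fun k => 'C(n, k)%:R * pochhammer (n%:R + a + b + 1) k *
   pochhammer (a + k%:R + 1) (n - k).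
(* The ratio of consecutive coefficients of the hypergeometric series. By it each summand splits
   into its eigenvalue part and a difference S (k + 1) - S k, and the differences telescope. *)
have dS k : (k <= n)%N -> d k.+1 * (k.+1%:R * (k.+1%:R + a)) =
    (n%:R - k%:R) * (n%:R + k%:R + a + b + 1) * d k.
  rewrite leq_eqVlt => /predU1P[->|kn]; first by rewrite /d bin_small // subrr !mul0r.
  rewrite /d pochhammerS -(subnSK kn) pochhammerSl.
  have /(congr1 (fun m => m%:R : R)) : (k.+1 * 'C(n, k.+1) = (n - k) * 'C(n, k))%N.
    by rewrite mul_bin_left.
  rewrite !natrM natrB ?(ltnW kn) // -natr1 => E.
  have -> : a + (k%:R + 1) + 1 = a + k%:R + 1 + 1 by ring.
  move: (pochhammer _ _) (pochhammer _ _) => u w.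
  transitivity ((k%:R + 1) * 'C(n, k.+1)%:R * (u * (n%:R + a + b + 1 + k%:R) * w * (k%:R + 1 + a))).
    by ring.
  by rewrite E; ring.
have coef k : (k <= n)%N ->
    jacobi_op a b (d k *: ('X - 1) ^+ k) =
    - (n%:R * (n%:R + a + b + 1)) *: (d k *: ('X - 1) ^+ k) +
    ((d k.+1 * (k.+1%:R * (k.+1%:R + a))) *: ('X - 1) ^+ k
      - (d k * (k%:R * (k%:R + a))) *: ('X - 1) ^+ k.-1).
  move=> kn; rewrite linearZ /= jacobi_op_Xsub1 scalerBr !scalerA dS //.
  rewrite addrA -scalerDl; congr (_ *: _ - _); by ring.
rewrite (eq_bigr _ (fun (k : 'I_n.+1) _ => coef k (ltn_ord k))) big_split /= -[RHS]addr0.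
congr (_ + _); pose S k := (d k * (k%:R * (k%:R + a))) *: (('X - 1 : {poly R}) ^+ k.-1).
have := telescope_sumr S (leq0n n.+1).
rewrite big_mkord => ->.
by rewrite /S /d bin_small // !mul0r mulr0 !scale0r subrr.
Qed.

Lemma coefXderiv p k : ('X * p^`())`_k = p`_k *+ k.
Proof. by rewrite coefXM; case: k => [|k] //=; rewrite coef_deriv. Qed.

Lemma coef_jacobi_op a b p k :
  (jacobi_op a b p)`_k = k.+1%:R * (k.+1%:R + b) * p`_k.+1
    - k%:R * (k%:R + a + b + 1) * p`_k.
Proof.
rewrite /jacobi_op mulrBl mul1r !(coefB, coefD, coefZ) !coefXderiv !coef_deriv coefXderiv.
rewrite -[p`_k.+1 *+ k.+1]mulr_natl -[p`_k *+ k]mulr_natl.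
rewrite -[_ *+ k.+1 in LHS]mulr_natl -[_ *+ k in LHS]mulr_natl -natr1.
suff H (r u v : R) : (r + 1) * ((r + 1) * u) - r * (r * v) + b * ((r + 1) * u) -
    (a + b + 1) * (r * v) = (r + 1) * (r + 1 + b) * u - r * (r + a + b + 1) * v by exact: H.
by ring.
Qed.

Lemma jacobi_op_Xn a b k : jacobi_op a b ('X^k) =
  (k%:R * (k%:R + b)) *: 'X^(k.-1) - (k%:R * (k%:R + a + b + 1)) *: 'X^k.
Proof.
apply/polyP => i; rewrite coef_jacobi_op !(coefB, coefZ, coefXn).
case: k => [|k]; first by rewrite /= !mul0r; case: i => [|i] /=; rewrite ?mulr0 ?mul0r subrr.
rewrite /= eqSS; case: (eqVneq i k) => [->|ik].
  by rewrite -[k == _]negbK neq_ltn ltnSn /= !mulr1 !mulr0.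
case: (eqVneq i k.+1) => [->|ik1]; rewrite ?mulr1 ?mulr0 //.
Qed.

(** In powers of X - 1 the equation is a two-term recurrence with leading factor (k + 1)(k + 1 + a),
    nonzero for a > -1, so the value at 1 determines all coefficients. Translated and reflected
    Jacobi polynomials are identified in this way. *)
Lemma jacobi_op_uniq a b lam p : -1 < a -> jacobi_op a b p = - lam *: p ->
  p.[1] = 0 -> p = 0.
Proof.
move=> a1 ode p1; pose z := p \Po ('X + 1).
have dq : ('X + 1 : {poly R})^`() = 1 by rewrite derivD derivX derivC addr0.
have dz : z^`() = p^`() \Po ('X + 1) by rewrite deriv_comp dq mulr1.
have pE : p = z \Po ('X - 1).
  by rewrite -comp_polyA comp_polyD comp_polyX comp_polyC subrK comp_polyXr.
have d2z : z^`()^`() = p^`()^`() \Po ('X + 1) by rewrite dz deriv_comp dq mulr1.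
have zode : - ('X * ('X * z^`())^`()) - ('X * z^`()^`() + (a + 1) *: z^`())
    - (a + b + 1) *: ('X * z^`()) = - lam *: z.
  have := congr1 (comp_poly ('X + 1)) ode.
  rewrite /jacobi_op !derivM !derivX !mul1r.
  rewrite !comp_polyD !(raddfN (comp_poly _)) /=.
  rewrite !(comp_polyZ, comp_polyM, comp_polyX, comp_polyD) -dz -d2z.
  rewrite !(raddfN (comp_poly _)) /= comp_polyC !comp_polyX -/z => <-.
  rewrite -!mul_polyC !(polyCN, polyCM, polyCD). by ring.
have zk k : k.+1%:R * (k.+1%:R + a) * z`_k.+1 =
    (lam - k%:R * (k%:R + a + b + 1)) * z`_k.
  have := congr1 (fun q : {poly R} => q`_k) zode.
  have -> : 'X * z^`()^`() = ('X * z^`())^`() - z^`().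
    by rewrite derivM derivX mul1r addrC addKr.
  rewrite !(coefB, coefN, coefD, coefZ) !coefXderiv !coef_deriv coefXderiv.
  rewrite -[z`_k.+1 *+ k.+1]mulr_natl -[z`_k *+ k]mulr_natl => E.
  apply/eqP; rewrite -subr_eq0 mulrBl -[lam * _]opprK -mulNr -E; apply/eqP; ring.
have z0 k : z`_k = 0.
  elim: k => [|k IH].
    by rewrite -horner_coef0 horner_comp (_ : _.[0] = 1) // !hornerE ?add0r.
  have := zk k; rewrite IH mulr0 => /eqP; rewrite !mulf_eq0 pnatr_eq0 /=.
  have : 0 < k.+1%:R + a by have : 0 <= k%:R :> R by []; rewrite -natr1; lra.
  by move=> /gt_eqF -> /eqP.
have zz : z = 0 by apply/polyP => k; rewrite z0 coef0.
by rewrite pE zz comp_poly0.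
Qed.

(** With Q = X p' + b p, the operator for a = 0 is (1 - X) Q' - Q + b p. *)
Lemma jacobi_op_euler b lam p (x : R) : jacobi_op 0 b p = - lam *: p ->
  (1 - x) * ('X * p^`() + b *: p)^`().[x] =
  ('X * p^`() + b *: p).[x] - (lam + b) * p.[x].
Proof.
move=> /(congr1 (fun q => q.[x])).
rewrite /jacobi_op derivD derivZ !derivM !derivX !mul1r !hornerE /=.
move: (p.[x]) (p^`().[x]) (p^`()^`().[x]) => j j1 j2 E.
have -> : (lam + b) * j = b * j - (- lam * j) by ring.
by rewrite -mulNr in E *; rewrite -E; ring.
Qed.

Lemma jacobiX_at1 a b n : (jacobiX a b n).[1] = pochhammer (a + 1) n / n`!%:R.
Proof. by rewrite -(jacobi_at1 a b n) jacobi_horner; congr (_.[_]); field. Qed.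

Lemma pochhammer_gt0 a k : 0 < a -> 0 < pochhammer a k.
Proof. by move=> a0; apply: prodr_gt0 => i _; rewrite ltr_wpDr. Qed.

Lemma jacobiX_at1_gt0 a b n : -1 < a -> 0 < (jacobiX a b n).[1].
Proof.
move=> a1; rewrite jacobiX_at1 divr_gt0 ?ltr0n ?fact_gt0 // pochhammer_gt0 //; lra.
Qed.

Lemma pochhammer1 k : pochhammer 1 k = k`!%:R :> R.
Proof.
elim: k => [|k IH]; first by rewrite pochhammer0.
by rewrite pochhammerS IH factS natrM -natr1; ring.
Qed.

Lemma jacobiX0_at1 b n : (jacobiX 0 b n).[1] = 1.
Proof. by rewrite jacobiX_at1 add0r pochhammer1 divff // pnatr_eq0 -lt0n fact_gt0. Qed.

Lemma size_jacobiX a b n : (size (jacobiX a b n) <= n.+1)%N.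
Proof.
apply: leq_trans (size_scale_leq _ _) _.
apply: leq_trans (size_sum _ _ _) _; apply/bigmax_leqP => k _.
apply: leq_trans (size_scale_leq _ _) _.
by rewrite -polyC1 size_exp_XsubC ltn_ord.
Qed.

Lemma jacobi_op_reflect a b p :
  jacobi_op b a (p \Po (1 - 'X)) = jacobi_op a b p \Po (1 - 'X).
Proof.
have dq : (1 - 'X : {poly R})^`() = - 1 by rewrite derivB derivX derivC sub0r.
rewrite /jacobi_op !derivM !derivX !mul1r !deriv_comp dq !mulrN1 derivN deriv_comp dq.
rewrite !comp_polyD !(raddfN (comp_poly _)) /=.
rewrite !(comp_polyZ, comp_polyM, comp_polyX, comp_polyD).
rewrite !(raddfN (comp_poly _)) /= comp_polyC !comp_polyX.
by rewrite -!mul_polyC !(polyCN, polyCM, polyCD); ring.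
Qed.

(** Both polynomials solve the same equation, hence are proportional by [jacobi_op_uniq]; c = 0
    would contradict q(0) = p(1) > 0. In the kernel c^2 cancels against the norm. *)
Lemma jacobiX_reflect a b n : -1 < a -> -1 < b -> exists2 c : R, c != 0 &
  jacobiX a b n \Po (1 - 'X) = c *: jacobiX b a n.
Proof.
move=> a1 b1; pose lam := n%:R * (n%:R + a + b + 1).
set p := jacobiX a b n; pose q := p \Po (1 - 'X).
have qode : jacobi_op b a q = - lam *: q.
  by rewrite jacobi_op_reflect jacobiX_ode comp_polyZ.
have J1 : 0 < (jacobiX b a n).[1] by exact: jacobiX_at1_gt0.
pose c := q.[1] / (jacobiX b a n).[1].
have qE : q = c *: jacobiX b a n.
  apply/eqP; rewrite -subr_eq0; apply/eqP.
  apply: (jacobi_op_uniq (b := a) (lam := lam) b1).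
    rewrite raddfB /= linearZ /= qode jacobiX_ode /lam scalerBr !scalerA.
    by congr (_ *: _ - _ *: _); ring.
  by rewrite hornerD hornerN hornerZ /c divfK ?subrr // gt_eqF.
exists c => //; apply: contraTneq J1 => c0.
have q0 : q = 0 by rewrite qE c0 scale0r.
have p1 : 0 < p.[1] by exact: jacobiX_at1_gt0.
have : p.[1] = q.[0] by rewrite /q horner_comp !hornerE subr0.
by rewrite q0 horner0 => E; rewrite E ltxx in p1.
Qed.

End JacobiOperator.

(** * Linear maps prescribed on the monomials *)

Definition linext (R : realType) (V : lmodType R) (v : nat -> V) (p : {poly R}) : V :=
  \sum_(i < size p) p`_i *: v i.

Lemma linear_Xn_ext (R : realType) (V : lmodType R) (f g : {linear {poly R} -> V}) :
  (forall i, f 'X^i = g 'X^i) -> forall p, f p = g p.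
Proof.
move=> fg p; rewrite -[p]coefK poly_def !linear_sum; apply: eq_bigr => i _.
by rewrite !linearZ /= fg.
Qed.

Section LinearExtension.
Context {R : realType} {V : lmodType R}.
Variable v : nat -> V.

Lemma linext_wide (N : nat) (p : {poly R}) : (size p <= N)%N ->
  linext v p = \sum_(i < N) p`_i *: v i.
Proof.
move=> pN; rewrite /linext (big_ord_widen N (fun i => p`_i *: v i)) // big_mkcond /=.
apply: eq_bigr => i _; case: ltnP => // ip.
by rewrite nth_default // scale0r.
Qed.

Lemma linext_linear : linear (linext v).
Proof.
move=> c p q; pose N := maxn (size (c *: p + q)) (maxn (size p) (size q)).
rewrite !(@linext_wide N) ?leq_max ?leqnn ?orbT // scaler_sumr -big_split /=.
by apply: eq_bigr => i _; rewrite coefD coefZ scalerDl scalerA.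
Qed.

HB.instance Definition _ := GRing.isLinear.Build R {poly R} V _ (linext v) linext_linear.

Lemma linext_Xn i : linext v 'X^i = v i.
Proof.
rewrite /linext size_polyXn big_ord_recr /= coefXn eqxx scale1r big1 ?add0r // => j _.
by rewrite coefXn ltn_eqF ?scale0r // ltn_ord.
Qed.

End LinearExtension.

(* The expectation under the Beta distribution of parameters [a] and [s - a],
   given by its moments. *)
Definition beta_fun (R : realType) (a s : R) : {poly R} -> R^o :=
  linext (fun i => pochhammer a i / pochhammer s i : R^o).

HB.instance Definition _ (R : realType) (a s : R) := GRing.Linear.on (beta_fun a s).

(** * Positivity of the Beta expectation, from its moments *)

Section BetaFunctional.
Context {R : realType}.
Implicit Types (a s : R) (p : {poly R}).

(* First step of the Polya urn: iterating it expresses [beta_fun a s] as an average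
   of [beta_fun a' (s + N)], and these are close to point evaluations. *)
Lemma beta_fun_urn a s p : 0 < s ->
  beta_fun a s p = a / s * beta_fun (a + 1) (s + 1) p + (s - a) / s * beta_fun a (s + 1) p.
Proof.
move=> s0; rewrite /beta_fun /linext !mulr_sumr -big_split /=; apply: eq_bigr => i _.
rewrite /GRing.scale /=.
have E1 : pochhammer (a + 1) i * a = pochhammer a i * (a + i%:R).
  by rewrite -pochhammerS pochhammerSl mulrC.
have E2 : pochhammer (s + 1) i * s = pochhammer s i * (s + i%:R).
  by rewrite -pochhammerS pochhammerSl mulrC.
have p0 : 0 < pochhammer s i by exact: pochhammer_gt0.
have p1 : 0 < pochhammer (s + 1) i by apply: pochhammer_gt0; lra.
have si : 0 < s + i%:R by rewrite ltr_wpDr.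
have -> : pochhammer s i = pochhammer (s + 1) i * s / (s + i%:R).
  by rewrite E2 mulfK // gt_eqF.
have -> : a / s * (p`_i * (pochhammer (a + 1) i / pochhammer (s + 1) i)) =
  p`_i * (pochhammer (a + 1) i * a) / (s * pochhammer (s + 1) i).
  by field; rewrite !gt_eqF.
by rewrite E1; field; rewrite !gt_eqF.
Qed.

(** The moment is the product of the factors (a + j) / (s + j), each exceeding a / s by at most j /
    s; the i errors sum to at most i^2 / s. *)
Lemma beta_moment_close a s i : 0 <= a -> a <= s -> 0 < s ->
  [/\ 0 <= pochhammer a i / pochhammer s i, pochhammer a i / pochhammer s i <= 1 &
  `|pochhammer a i / pochhammer s i - (a / s) ^+ i| <= i%:R ^+ 2 / s].
Proof.
move=> a0 as' s0; elim: i => [|i [r0 r1 IH]].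
  by rewrite !pochhammer0 expr0 divr1 subrr normr0 expr0n /= mul0r.
have si : 0 < s + i%:R by rewrite ltr_wpDr.
have i0 : 0 <= i%:R :> R by [].
pose r := pochhammer a i / pochhammer s i.
pose q := (a + i%:R) / (s + i%:R).
have rE : pochhammer a i.+1 / pochhammer s i.+1 = r * q.
  rewrite !pochhammerS /r /q; have := pochhammer_gt0 i s0.
  by move=> ?; field; rewrite !gt_eqF.
have q0 : 0 <= q by rewrite divr_ge0 ?(ltW si) // addr_ge0.
have q1 : q <= 1 by rewrite ler_pdivrMr // mul1r lerD2r.
have z0 : 0 <= a / s by rewrite divr_ge0 // ltW.
have z1 : a / s <= 1 by rewrite ler_pdivrMr // mul1r.
have qz : 0 <= q - a / s <= i%:R / s.
  have -> : q - a / s = i%:R * (s - a) / (s * (s + i%:R)).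
    by rewrite /q; field; rewrite !gt_eqF.
  rewrite divr_ge0 ?mulr_ge0 ?(ltW s0) ?(ltW si) ?subr_ge0 //=.
  rewrite ler_pdivrMr ?mulr_gt0 // mulrA divfK ?gt_eqF // ler_wpM2l //; lra.
rewrite rE -/r; split.
- exact: mulr_ge0.
- by apply: mulr_ile1.
have -> : r * q - (a / s) ^+ i.+1 = (r - (a / s) ^+ i) * q + (a / s) ^+ i * (q - a / s).
  by rewrite exprSr; ring.
apply: le_trans (ler_normD _ _) _.
rewrite [`|(_ - _) * q|]normrM [`|_ ^+ i * _|]normrM.
have h1 : `|r - (a / s) ^+ i| * `|q| <= i%:R ^+ 2 / s.
  by rewrite (ger0_norm q0); apply: le_trans IH; rewrite ler_piMr.
have h2 : `|(a / s) ^+ i| * `|q - a / s| <= i%:R / s.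
  have /andP[qz0 qz1] := qz; rewrite (ger0_norm qz0) ger0_norm ?exprn_ge0 //.
  by apply: le_trans qz1; rewrite ler_piMl // exprn_ile1.
apply: le_trans (lerD h1 h2) _.
rewrite -mulrDl ler_pM2r ?invr_gt0 // -natr1; nra.
Qed.

Lemma beta_fun_close a s p : 0 <= a -> a <= s -> 0 < s ->
  `|beta_fun a s p - p.[a / s]| <= (\sum_(i < size p) `|p`_i| * i%:R ^+ 2) / s.
Proof.
move=> a0 as' s0; rewrite horner_coef /beta_fun /linext -sumrB mulr_suml.
apply: le_trans (ler_norm_sum _ _ _) _; apply: ler_sum => i _.
rewrite /GRing.scale /= -mulrBr normrM -mulrA ler_wpM2l //.
by have [] := beta_moment_close i a0 as' s0.
Qed.

(** After N urn steps the lower bound is -C / (s + N) with a constant depending on [p] alone, and N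
    is arbitrary. The weak inequalities on [a] admit the degenerate laws, which occur at the ends of
    -1/2 <= b <= 0. *)
Lemma beta_fun_ge0 a s p : 0 <= a -> a <= s -> 0 < s ->
  (forall x, 0 <= x <= 1 -> 0 <= p.[x]) -> 0 <= beta_fun a s p.
Proof.
move=> a0 as' s0 p0; pose C := \sum_(i < size p) `|p`_i| * i%:R ^+ 2.
have C0 : 0 <= C by apply: sumr_ge0 => i _; rewrite mulr_ge0 ?sqr_ge0.
have low N : forall a s, 0 <= a -> a <= s -> 0 < s -> - (C / (s + N%:R)) <= beta_fun a s p.
  elim: N => [|N IH] {a0 as' s0}a {}s a0 as' s0.
    rewrite addr0; have := beta_fun_close p a0 as' s0; rewrite -/C ler_norml.
    have : 0 <= p.[a / s].
      apply: p0; rewrite divr_ge0 ?(ltW s0) //=.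
      by rewrite ler_pdivrMr // mul1r.
    by move=> ? /andP[? _]; lra.
  rewrite beta_fun_urn // -natr1.
  have s1 : 0 < s + 1 by lra.
  have h1 : - (C / (s + (N%:R + 1))) <= beta_fun (a + 1) (s + 1) p.
    have -> : s + (N%:R + 1) = s + 1 + N%:R by ring.
    by apply: IH; lra.
  have h2 : - (C / (s + (N%:R + 1))) <= beta_fun a (s + 1) p.
    have -> : s + (N%:R + 1) = s + 1 + N%:R by ring.
    by apply: IH; lra.
  have z0 : 0 <= a / s by rewrite divr_ge0 // ltW.
  have z1 : 0 <= (s - a) / s by rewrite divr_ge0 ?(ltW s0) // subr_ge0.
  have z : a / s + (s - a) / s = 1 by field; rewrite gt_eqF.
  have := ler_wpM2l z0 h1; have := ler_wpM2l z1 h2.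
  move: (C / _) => D k2 k1.
  have -> : - D = a / s * - D + (s - a) / s * - D by rewrite -mulrDl z mul1r.
  exact: lerD.
rewrite leNgt; apply/negP => neg.
have e0 : 0 < - beta_fun a s p by rewrite oppr_gt0.
have hN := archi_boundP (divr_ge0 C0 (ltW e0)).
have := low (Num.bound (C / - beta_fun a s p)) a s a0 as' s0.
move: (Num.bound _) hN => N hN; rewrite leNgt => /negP; apply.
rewrite ltrNr ltr_pdivrMr; last by rewrite ltr_wpDr.
rewrite ltr_pdivrMr // in hN.
apply: lt_trans hN _; rewrite mulrC ltr_pM2l //; lra.
Qed.

End BetaFunctional.

Definition transl_coef (R : realType) (b : R) (m k : nat) : R :=
  'C(m, k)%:R * pochhammer (b + 1 + (m - k)%:R) k / k`!%:R.

(** The translate of X^m, symmetric in X and Y, equal to Y^m at X = 1 and to X^m at Y = 1. Its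
    coefficients satisfy [transl_coef_l] and [transl_coef_r], the recurrences from which commutation
    with the Jacobi operator follows. *)
Definition transl_mono (R : realType) (b Y : R) (m : nat) : {poly R} :=
  \sum_(k < m.+1) (transl_coef b m k * (Y ^+ (m - k) * (1 - Y) ^+ k)) *:
     ('X^(m - k) * (1 - 'X) ^+ k).

Definition transl (R : realType) (b Y : R) : {poly R} -> {poly R} :=
  linext (transl_mono b Y).

HB.instance Definition _ (R : realType) (b Y : R) :=
  GRing.Linear.on (transl b Y).

(** * The generalized translation and the Jacobi operator *)

Section Translation.
Context {R : realType}.
Variable b : R.

Lemma fact_neq0 k : k`!%:R != 0 :> R.
Proof. by rewrite pnatr_eq0 -lt0n fact_gt0. Qed.

Lemma transl_coef_l m k : (k <= m)%N ->
  transl_coef b m.+1 k * ((m.+1 - k)%:R * ((m.+1 - k)%:R + b)) =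
  m.+1%:R * (m.+1%:R + b) * transl_coef b m k.
Proof.
move=> km; rewrite /transl_coef.
have E1 : (m.+1 - k)%:R * 'C(m.+1, k)%:R = m.+1%:R * 'C(m, k)%:R :> R.
  by rewrite -!natrM mul_bin_down.
have E2 : ((m.+1 - k)%:R + b) * pochhammer (b + 1 + (m.+1 - k)%:R) k =
    (m.+1%:R + b) * pochhammer (b + 1 + (m - k)%:R) k.
  rewrite subSn // -[(m - k).+1%:R]natr1.
  have -> : (m - k)%:R + 1 + b = b + 1 + (m - k)%:R by ring.
  have -> : b + 1 + ((m - k)%:R + 1) = b + 1 + (m - k)%:R + 1 by ring.
  rewrite -pochhammerSl pochhammerS mulrC; congr (_ * _).
  by rewrite natrB // -natr1; ring.
have -> : 'C(m.+1, k)%:R * pochhammer (b + 1 + (m.+1 - k)%:R) k / k`!%:R *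
   ((m.+1 - k)%:R * ((m.+1 - k)%:R + b)) = ((m.+1 - k)%:R * 'C(m.+1, k)%:R) *
   (((m.+1 - k)%:R + b) * pochhammer (b + 1 + (m.+1 - k)%:R) k) / k`!%:R by ring.
by rewrite E1 E2; ring.
Qed.

Lemma transl_coef_r m k :
  transl_coef b m.+1 k.+1 * (k.+1%:R * k.+1%:R) =
  m.+1%:R * (m.+1%:R + b) * transl_coef b m k.
Proof.
have [km|mk] := leqP k m; last first.
  by rewrite /transl_coef !bin_small // !mul0r mulr0.
rewrite /transl_coef subSS pochhammerS factS natrM.
have E1 : k.+1%:R * 'C(m.+1, k.+1)%:R = m.+1%:R * 'C(m, k)%:R :> R.
  by rewrite -!natrM mul_bin_diag.
have E2 : b + 1 + (m - k)%:R + k%:R = m.+1%:R + b.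
  by rewrite natrB // -natr1; ring.
rewrite E2; have k0 : k.+1%:R != 0 :> R by rewrite pnatr_eq0.
have kf := fact_neq0 k; move: E1 k0 kf.
move: (k.+1%:R : R) (k`!%:R : R) ('C(_, _)%:R : R) => c f C E1 c0 f0.
transitivity (c * C * (pochhammer (b + 1 + (m - k)%:R) k * (m.+1%:R + b)) / f).
  by field; rewrite c0 f0.
by rewrite E1; ring.
Qed.

(** On products X^p (1 - X)^k the operator preserves p + k and couples neighbours only, so it acts
    on the Bernstein basis of fixed degree by a tridiagonal matrix. *)
Lemma jacobi_op_bernstein (p k : nat) :
  jacobi_op 0 b ('X^p * (1 - 'X) ^+ k) =
  (p%:R * (p%:R + b)) *: ('X^(p.-1) * (1 - 'X) ^+ k.+1)
  + (k%:R * k%:R) *: ('X^(p.+1) * (1 - 'X) ^+ k.-1)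
  - (2 * p%:R * k%:R + (b + 1) * k%:R + p%:R) *: ('X^p * (1 - 'X) ^+ k).
Proof.
have dZ : (1 - 'X : {poly R})^`() = - 1 by rewrite derivB derivX derivC sub0r.
set Z : {poly R} := 1 - 'X in dZ *.
pose P0 : {poly R} := 'X^p; pose P1 := P0^`().
pose K0 := Z ^+ k; pose K1 := - K0^`().
have P1E : P1 = p%:R *: 'X^(p.-1) by rewrite /P1 /P0 derivXn scaler_nat.
have K1E : K1 = k%:R *: Z ^+ k.-1.
  by rewrite /K1 /K0 deriv_exp dZ mulN1r mulNrn opprK scaler_nat.
(* The relations X P' = p P and (1 - X) K1 = k K0 absorb the truncated exponents [p.-1] and [k.-1]:
   in the cases p = 0 and k = 0 both sides vanish. *)
have XP1 : 'X * P1 = p%:R *: P0.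
  by rewrite P1E /P0; case: (p) => [|j]; rewrite ?scale0r ?mulr0 // -scalerAr -exprS.
have ZK1 : Z * K1 = k%:R *: K0.
  by rewrite K1E /K0; case: (k) => [|j]; rewrite ?scale0r ?mulr0 // -scalerAr -exprS.
have XP2 : 'X * P1^`() = p%:R *: P1 - P1.
  have := congr1 (@deriv R) XP1; rewrite derivM derivX derivZ mul1r -/P1 => <-.
  by rewrite addrC addKr.
have ZK2 : Z * K1^`() = K1 - k%:R *: K1.
  have := congr1 (@deriv R) ZK1; rewrite derivM dZ derivZ mulN1r => H.
  have -> : k%:R *: K1 = - (k%:R *: K0^`()) by rewrite /K1 scalerN.
  by rewrite -H; ring.
have dK0 : K0^`() = - K1 by rewrite /K1 opprK.
have E1 : (p%:R * (p%:R + b)) *: ('X^(p.-1) * Z ^+ k.+1) = (p%:R + b) *: (Z * P1 * K0).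
  by rewrite P1E /K0 exprS -!mul_polyC polyCM; ring.
have E2 : (k%:R * k%:R) *: ('X^(p.+1) * Z ^+ k.-1) = k%:R *: ('X * P0 * K1).
  by rewrite K1E /P0 exprS -!mul_polyC polyCM; ring.
rewrite E1 E2 -/P0 -/K0.
have -> : jacobi_op 0 b (P0 * K0) = (1 + b)%:P * (Z * P1 * K0 - P0 * (Z * K1))
    + Z * K0 * ('X * P1^`()) - 2%:P * ('X * P1) * (Z * K1) - 'X * P0 * (Z * K1^`())
    - 'X * P1 * K0 + 'X * P0 * K1.
  rewrite /jacobi_op !derivM derivX !derivD !derivM -/P1 !dK0 !derivN -/Z.
  by rewrite -!mul_polyC !polyCD polyC0 /Z; ring.
rewrite XP1 ZK1 XP2 ZK2 -!mul_polyC !(polyCM, polyCD).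
by ring.
Qed.

(** The image of [jacobi_op_Xn] under the translation, from which commutation follows by
    linearity. *)
Lemma transl_monoS_op (Y : R) (m : nat) :
  jacobi_op 0 b (transl_mono b Y m.+1) =
  (m.+1%:R * (m.+1%:R + b)) *: transl_mono b Y m
  - (m.+1%:R * (m.+1%:R + b + 1)) *: transl_mono b Y m.+1.
Proof.
pose A k : {poly R} := 'X^(m.+1 - k) * (1 - 'X) ^+ k.
pose y k := Y ^+ (m.+1 - k) * (1 - Y) ^+ k.
pose c k := transl_coef b m k * (m.+1%:R * (m.+1%:R + b)).
pose d k := transl_coef b m.+1 k.
pose pk k := (m.+1 - k)%:R : R.
have dl k : (k <= m)%N -> d k * (pk k * (pk k + b)) = c k.
  by move=> km; rewrite /d /pk transl_coef_l // /c mulrC.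
have dr k : d k.+1 * (k.+1%:R * k.+1%:R) = c k.
  by rewrite /d transl_coef_r /c mulrC.
(* Degree raising by X + (1 - X) = 1, and likewise for Y: it writes the translate of X^m in the
   Bernstein basis of degree m + 1, where coefficients can be compared. *)
have AS k : (k <= m)%N -> 'X^(m - k) * (1 - 'X) ^+ k = A k + A k.+1.
  move=> km; rewrite /A subSS subSn // !exprS; ring.
have yS k : (k <= m)%N -> Y ^+ (m - k) * (1 - Y) ^+ k = y k + y k.+1.
  move=> km; rewrite /y subSS subSn // !exprS; ring.
have opA k : (k <= m.+1)%N -> jacobi_op 0 b (A k) =
    (pk k * (pk k + b)) *: A k.+1 + (k%:R * k%:R) *: A k.-1
    - (2 * pk k * k%:R + (b + 1) * k%:R + pk k) *: A k.
  move=> km; rewrite /A jacobi_op_bernstein -/(pk k); congr (_ + _ - _).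
    by rewrite -subn1 -subnDA addn1.
  case: k km => [|k] km; first by rewrite mul0r !scale0r.
  by rewrite /= subSS subSn.
have -> : (m.+1%:R * (m.+1%:R + b)) *: transl_mono b Y m =
    \sum_(k < m.+1) (c k * (y k + y k.+1)) *: (A k + A k.+1).
  rewrite /transl_mono scaler_sumr; apply: eq_bigr => k _.
  by rewrite scalerA -AS ?leq_ord // -yS ?leq_ord // /c; congr (_ *: _); ring.
have -> : transl_mono b Y m.+1 = \sum_(k < m.+2) (d k * y k) *: A k by [].
rewrite linear_sum.
have -> : \sum_(k < m.+2) jacobi_op 0 b ((d k * y k) *: A k) =
   \sum_(k < m.+2) (d k * y k * (pk k * (pk k + b))) *: A k.+1 +
   \sum_(k < m.+2) (d k * y k * (k%:R * k%:R)) *: A k.-1 -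
   \sum_(k < m.+2) (d k * y k * (2 * pk k * k%:R + (b + 1) * k%:R + pk k)) *: A k.
  rewrite -big_split -sumrB; apply: eq_bigr => k _.
  by rewrite linearZ /= opA ?leq_ord // scalerBr scalerDr !scalerA.
have p0 : pk m.+1 = 0 by rewrite /pk subnn.
rewrite [X in X + _ - _ = _]big_ord_recr /= p0 mul0r mulr0 scale0r addr0.
rewrite [X in _ + X - _ = _]big_ord_recl /= mul0r mulr0 scale0r add0r.
rewrite scaler_sumr.
have -> : \sum_(i < m.+2) (m.+1%:R * (m.+1%:R + b + 1)) *: ((d i * y i) *: A i) =
   \sum_(k < m.+2) (d k * y k * (2 * pk k * k%:R + (b + 1) * k%:R + pk k)) *: A k +
   (\sum_(k < m.+2) (d k * y k * (pk k * (pk k + b))) *: A k +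
    \sum_(k < m.+2) (d k * y k * (k%:R * k%:R)) *: A k).
  rewrite -!big_split; apply: eq_bigr => k _; rewrite /= scalerA -!(@scalerDl _ _ (A k)); congr (_ *: _).
  have -> : m.+1%:R = pk k + k%:R :> R by rewrite /pk natrB ?subrK // leq_ord.
  move: (pk k) (k%:R : R) (d k * y k) => u v w.
  by ring.
rewrite [X in _ - (_ + (X + _))]big_ord_recr /= p0 mul0r mulr0 scale0r addr0.
rewrite [X in _ - (_ + (_ + X))]big_ord_recl /= mul0r mulr0 scale0r add0r.
have -> : \sum_(k < m.+1) (c k * (y k + y k.+1)) *: (A k + A k.+1) =
   (\sum_(i < m.+1) (d i * y i * (pk i * (pk i + b))) *: A i.+1 +
    \sum_(i < m.+1)
     (d (bump 0 i) * y (bump 0 i) * ((bump 0 i)%:R * (bump 0 i)%:R)) *: A (0 + i)%N) +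
   (\sum_(i < m.+1) (d i * y i * (pk i * (pk i + b))) *: A i +
    \sum_(i < m.+1)
       (d (bump 0 i) * y (bump 0 i) * ((bump 0 i)%:R * (bump 0 i)%:R)) *:
       A (bump 0 i)).
  rewrite -!big_split; apply: eq_bigr => k _ /=.
  have -> : d k * y k * (pk k * (pk k + b)) = c k * y k.
    by rewrite mulrAC dl ?leq_ord.
  rewrite /bump /= add1n add0n.
  have -> : d k.+1 * y k.+1 * (k.+1%:R * k.+1%:R) = c k * y k.+1.
    by rewrite mulrAC dr.
  by rewrite -!mul_polyC !(polyCM, polyCD); ring.
rewrite -[RHS]addrA; congr (_ + _).
by rewrite opprD addrCA subrr addr0.
Qed.

Lemma transl_mono0 (Y : R) : transl_mono b Y 0 = 1.
Proof.
rewrite /transl_mono big_ord_recl big_ord0 /= addr0 /transl_coef bin0 pochhammer0.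
by rewrite fact0 divr1 subnn !expr0 !mulr1 scale1r.
Qed.

Lemma transl_jacobi_op (Y : R) (p : {poly R}) :
  transl b Y (jacobi_op 0 b p) = jacobi_op 0 b (transl b Y p).
Proof.
pose f : {linear {poly R} -> {poly R}} := transl b Y \o jacobi_op 0 b.
pose g : {linear {poly R} -> {poly R}} := jacobi_op 0 b \o transl b Y.
apply: (@linear_Xn_ext R _ f g) => i; rewrite /f /g /=.
rewrite jacobi_op_Xn linearB !linearZ /= /transl !linext_Xn.
case: i => [|m] /=.
  have op1 : jacobi_op 0 b (1 : {poly R}) = 0.
    by rewrite -(expr0 'X) jacobi_op_Xn !mul0r !scale0r subr0.
  by rewrite transl_mono0 op1 !(mul0r, scale0r, oppr0, addr0).
by rewrite transl_monoS_op addr0 scalerN.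
Qed.

Lemma transl_at1 (Y : R) (p : {poly R}) : (transl b Y p).[1] = p.[Y].
Proof.
rewrite /transl /linext [RHS]horner_coef horner_sum; apply: eq_bigr => m _.
rewrite hornerZ; congr (_ * _); rewrite /transl_mono horner_sum big_ord_recl big1.
  rewrite /transl_coef bin0 pochhammer0 fact0 invr1 /= subn0 !expr0 !mulr1.
  by rewrite mul1r hornerZ hornerXn expr1n mulr1 addr0.
move=> k _; rewrite hornerZ hornerM lift0 !horner_exp.
by rewrite hornerD hornerN hornerC hornerX subrr expr0n !mulr0.
Qed.

(** Both sides are eigenvectors for the same eigenvalue, by commutation, and agree at 1, so
    [jacobi_op_uniq] applies to their difference. *)
Lemma transl_jacobi (Y : R) (n : nat) :
  transl b Y (jacobiX 0 b n) = (jacobiX 0 b n).[Y] *: jacobiX 0 b n.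
Proof.
pose lam := n%:R * (n%:R + 0 + b + 1).
apply/eqP; rewrite -subr_eq0; apply/eqP.
apply: (@jacobi_op_uniq _ 0 b lam); first by rewrite ltrN10.
  have tE : jacobi_op 0 b (transl b Y (jacobiX 0 b n)) = - lam *: transl b Y (jacobiX 0 b n).
    by rewrite -transl_jacobi_op jacobiX_ode linearZ.
  rewrite raddfB /= tE jacobi_op_scale jacobiX_ode -/lam.
  by rewrite -!mul_polyC; ring.
by rewrite hornerD hornerN hornerZ transl_at1 jacobiX0_at1 mulr1 subrr.
Qed.

End Translation.

(** * Binomial identities for the product formula *)

Section BinomialSums.
Context {R : realType}.

Lemma bin_sumS (F : nat -> R) (k : nat) :
  \sum_(i < k.+2) 'C(k.+1, i)%:R * F i =
  \sum_(i < k.+1) 'C(k, i)%:R * F i + \sum_(i < k.+1) 'C(k, i)%:R * F i.+1.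
Proof.
rewrite big_ord_recl bin0 [in X in _ = X + _]big_ord_recl bin0 -addrA; congr (_ + _).
under eq_bigr do rewrite lift0 binS natrD mulrDl.
rewrite big_split /=; congr (_ + _).
by rewrite big_ord_recr /= bin_small // mul0r addr0.
Qed.

(** The Chu-Vandermonde sum 2F1(-k, -p; g; 1), by induction on k through the Pascal rule. *)
Lemma vandermonde_pochhammer (g : R) (p k : nat) : 0 < g ->
  \sum_(i < k.+1) 'C(k, i)%:R * ((p ^_ i)%:R / pochhammer g i) =
  pochhammer (g + p%:R) k / pochhammer g k.
Proof.
elim: k g p => [|k IH] g p g0.
  by rewrite big_ord_recl big_ord0 /= ffactn0 !pochhammer0 bin0 !mul1r addr0.
rewrite (bin_sumS (fun i => (p ^_ i)%:R / pochhammer g i)) IH //.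
have -> : \sum_(i < k.+1) 'C(k, i)%:R * ((p ^_ i.+1)%:R / pochhammer g i.+1) =
   p%:R / g * \sum_(i < k.+1) 'C(k, i)%:R * ((p.-1 ^_ i)%:R / pochhammer (g + 1) i).
  rewrite mulr_sumr; apply: eq_bigr => i _; rewrite ffactnS natrM pochhammerSl.
  by rewrite invfM; ring.
rewrite IH; last by lra.
have pk := pochhammer_gt0 k g0.
have gk : 0 < g + k%:R by rewrite ltr_wpDr.
have E : pochhammer (g + 1) k = pochhammer g k * (g + k%:R) / g.
  by rewrite -pochhammerS pochhammerSl mulrAC divff ?mul1r // gt_eqF.
have [->|p0] := posnP p.
  rewrite mul0r mul0r !addr0 !divff // ?gt_eqF ?pochhammer_gt0 //.
have -> : g + 1 + p.-1%:R = g + p%:R by rewrite -[in RHS](prednK p0) -natr1; ring.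
rewrite !pochhammerS E; field.
by rewrite !gt_eqF.
Qed.

Lemma sum_even_odd (G : nat -> R) (n : nat) :
  \sum_(j < n.*2) G j = \sum_(i < n) (G i.*2 + G i.*2.+1).
Proof.
elim: n => [|n IH]; first by rewrite !big_ord0.
by rewrite doubleS !big_ord_recr /= IH addrA.
Qed.

Lemma even_binomial (e s : R) (m : nat) :
  (e + s) ^+ m + (e - s) ^+ m =
  2 * \sum_(i < m.+1) 'C(m, i.*2)%:R * e ^+ (m - i.*2) * (s ^+ 2) ^+ i.
Proof.
pose G (j : nat) := 'C(m, j)%:R * e ^+ (m - j) * (s ^+ j + (- s) ^+ j).
transitivity (\sum_(j < m.+1) G j).
  rewrite !exprDn -big_split; apply: eq_bigr => j _ /=.
  by rewrite -mulrnDl -mulr_natl /G; ring.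
transitivity (\sum_(j < m.+1.*2) G j).
  rewrite (big_ord_widen m.+1.*2 G); last by rewrite -addnn leq_addr.
  rewrite big_mkcond /=; apply: eq_bigr => j _; case: ltnP => // mj.
  by rewrite /G bin_small // !mul0r.
rewrite sum_even_odd mulr_sumr; apply: eq_bigr => i _.
have even : s ^+ i.*2 = (s ^+ 2) ^+ i by rewrite -muln2 mulnC exprM.
have evenN : (- s) ^+ i.*2 = (s ^+ 2) ^+ i by rewrite -muln2 mulnC exprM sqrrN.
rewrite /G [s ^+ i.*2.+1]exprS [(- s) ^+ i.*2.+1]exprS even evenN.
by move: ((s ^+ 2) ^+ i) (e ^+ _) (e ^+ _) => u v w; ring.
Qed.

Lemma half_pochhammer (i : nat) : 4 ^+ i * pochhammer (1 / 2 : R) i * i`!%:R = (i.*2)`!%:R.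
Proof.
elim: i => [|i IH]; first by rewrite pochhammer0 expr0 !mulr1.
rewrite doubleS !factS !natrM -IH exprS pochhammerS.
have -> : i.*2.+2%:R = 2 * (i%:R + 1) :> R.
    have -> : i.*2.+2 = (2 * i.+1)%N by lia.
    by rewrite natrM -[i.+1%:R]natr1.
have -> : i.*2.+1%:R = 2 * i%:R + 1 :> R.
    have -> : i.*2.+1 = (2 * i + 1)%N by lia.
    by rewrite natrD natrM.
by rewrite -[i.+1%:R]natr1; field.
Qed.

(** Both sides count m! / ((k - i)! (m - k - i)!) when i + k <= m, and vanish otherwise. *)
Lemma bin_product_identity (m k i : nat) : (i <= k)%N -> (k <= m)%N ->
  ('C(m, i.*2) * 'C(m - i.*2, k - i) * (i.*2)`! =
   'C(m, k) * 'C(k, i) * (m - k) ^_ i * i`!)%N.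
Proof.
move=> ik km; have [ikm|mik] := leqP (i + k) m; last first.
  rewrite ffact_small ?muln0 ?mul0n; last by lia.
  have [h|h] := ltnP m i.*2; first by rewrite bin_small.
  by rewrite [X in (_ * X * _)%N]bin_small ?muln0 //; lia.
have f0 : (0 < (k - i)`! * (m - k - i)`!)%N by rewrite muln_gt0 !fact_gt0.
apply/eqP; rewrite -(eqn_pmul2r f0); apply/eqP.
have E1 : ('C(m - i.*2, k - i) * ((k - i)`! * (m - k - i)`!) = (m - i.*2)`!)%N.
  have -> : (m - k - i = m - i.*2 - (k - i))%N by lia.
  by apply: bin_fact; lia.
have E2 : ('C(m, i.*2) * ((i.*2)`! * (m - i.*2)`!) = m`!)%N by apply: bin_fact; lia.
have E3 : ('C(k, i) * (i`! * (k - i)`!) = k`!)%N by apply: bin_fact.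
have E4 : ((m - k) ^_ i * (m - k - i)`! = (m - k)`!)%N by apply: ffact_fact; lia.
have E5 : ('C(m, k) * (k`! * (m - k)`!) = m`!)%N by apply: bin_fact.
transitivity m`!.
  rewrite -E2 -E1; move: (_`!) (_`!) => a c; lia.
rewrite -E5 -E3 -E4; lia.
Qed.

Lemma sum_bin_shift (H : nat -> R) (m r i : nat) : (i + r <= m)%N ->
  \sum_(j < r.+1) 'C(r, j)%:R * H (i + j)%N =
  \sum_(k < m.+1) (if (i <= k)%N then 'C(r, k - i)%:R * H k else 0).
Proof.
move=> irm.
pose F k := if (i <= k)%N then 'C(r, k - i)%:R * H k else 0.
rewrite -[RHS](big_mkord xpredT F) (big_cat_nat (n := i)) /=; [|lia|lia].
have -> : \sum_(0 <= k < i) F k = 0.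
  rewrite big_nat_cond big1 // => k hk; have ki : (k < i)%N by lia.
  by rewrite /F leqNgt ki.
rewrite add0r -[X in \sum_(X <= _ < _) _](add0n i) big_addn (big_cat_nat (n := r.+1)) /=; [|lia|lia].
have -> : \sum_(r.+1 <= k < m.+1 - i) F (k + i)%N = 0.
  rewrite big_nat_cond big1 // => k hk; have rk : (r < k)%N by lia.
  by rewrite /F leq_addl addnK bin_small // mul0r.
rewrite addr0.
by rewrite big_mkord; apply: eq_bigr => j _; rewrite /F leq_addl addnK addnC.
Qed.

End BinomialSums.

Lemma sub_double_split (m i j : nat) : (i.*2 <= m)%N -> (j <= m - i.*2)%N ->
  (m - (i + j) = m - i.*2 - j + i)%N.
Proof. lia. Qed.

(** * Positivity of the translation: Koornwinder's product formula *)

Section TranslationPositivity.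
Context {R : realType}.
Variables (b X Y : R).
Hypothesis hb : - (1 / 2) <= b <= 0.
Hypothesis hX : 0 <= X <= 1.
Hypothesis hY : 0 <= Y <= 1.

Let P := X * Y.
Let Q := (1 - X) * (1 - Y).

Lemma prodP_ge0 : 0 <= P.
Proof. by have /andP[? _] := hX; have /andP[? _] := hY; exact: mulr_ge0. Qed.

Lemma prodQ_ge0 : 0 <= Q.
Proof. by have /andP[_ ?] := hX; have /andP[_ ?] := hY; apply: mulr_ge0; rewrite subr_ge0. Qed.

(** The nodes e + s and e - s with s^2 = [s2 r * t] are the values |sqrt P + sqrt(Q r) exp(i phi)|^2
    with cos^2 phi = t. The laws of r and t are Beta with parameters (b + 1, -b) and (1/2, b + 1/2);
    these are nonnegative exactly for -1/2 <= b <= 0. *)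
Let e (r : R) := P + Q * r.
Let s2 (r : R) := 4 * (P * (Q * r)).

Lemma transl_node_itv (r t : R) : 0 <= r <= 1 -> 0 <= t <= 1 ->
  let s := Num.sqrt (s2 r * t) in
  0 <= e r + s <= 1 /\ 0 <= e r - s <= 1.
Proof.
move=> /andP[r0 r1] /andP[t0 t1] s.
have P0 := prodP_ge0; have Q0 := prodQ_ge0.
have Qr0 : 0 <= Q * r by exact: mulr_ge0.
have e0 : 0 <= e r by exact: addr_ge0.
have s20 : 0 <= s2 r by rewrite mulr_ge0 // mulr_ge0.
have s0 : 0 <= s by exact: sqrtr_ge0.
have sE : s ^+ 2 = s2 r * t by rewrite sqr_sqrtr // mulr_ge0.
have s_le : s <= e r.
  rewrite -(ler_pXn2r (n := 2)) ?nnegrE // sE.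
  apply: (@le_trans _ _ (s2 r)); first by rewrite ler_piMr.
  rewrite /s2 /e -subr_ge0.
  have -> : (P + Q * r) ^+ 2 - 4 * (P * (Q * r)) = (P - Q * r) ^+ 2 by ring.
  exact: sqr_ge0.
(* [P + Q + 2 sqrt (P Q) <= 1] is Cauchy-Schwarz. *)
have PQ : 4 * (P * Q) <= (1 - P - Q) ^+ 2.
  rewrite /P /Q -subr_ge0.
  have -> : (1 - X * Y - (1 - X) * (1 - Y)) ^+ 2 - 4 * (X * Y * ((1 - X) * (1 - Y))) =
    (X - Y) ^+ 2 by ring.
  exact: sqr_ge0.
have PQ1 : P + Q <= 1.
  have /andP[? ?] := hX; have /andP[? ?] := hY; rewrite /P /Q; nra.
have s_le1 : s <= 1 - P - Q.
  rewrite -(ler_pXn2r (n := 2)) ?nnegrE //; last by lra.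
  rewrite sE; apply: le_trans PQ.
  apply: (@le_trans _ _ (s2 r)); first by rewrite ler_piMr.
  rewrite /s2 ler_wpM2l // ler_wpM2l // ler_piMr //.
have er1 : e r <= P + Q by rewrite /e lerD2l ler_piMr.
by split; apply/andP; split; lra.
Qed.

Let kap (i : nat) : R := pochhammer (1 / 2) i / pochhammer (b + 1) i.

(** The mean of [p] over the two nodes. The odd powers of s cancel, which leaves a polynomial in t =
    cos^2 phi, to which [beta_fun] applies. *)
Let inner (p : {poly R}) (r : R) : {poly R} :=
  \sum_(m < size p) p`_m *:
     \sum_(i < m.+1) ('C(m, i.*2)%:R * e r ^+ (m - i.*2) * s2 r ^+ i) *: 'X^i.

Lemma inner_ge0 (p : {poly R}) (r t : R) :
  (forall x, 0 <= x <= 1 -> 0 <= p.[x]) -> 0 <= r <= 1 -> 0 <= t <= 1 ->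
  0 <= (inner p r).[t].
Proof.
move=> p0 hr ht; have [h1 h2] := transl_node_itv hr ht.
have sE : Num.sqrt (s2 r * t) ^+ 2 = s2 r * t.
  rewrite sqr_sqrtr //; have /andP[? _] := hr; have /andP[? _] := ht.
  by rewrite mulr_ge0 // mulr_ge0 // mulr_ge0 ?prodP_ge0 // mulr_ge0 // prodQ_ge0.
suff -> : (inner p r).[t] =
   (p.[e r + Num.sqrt (s2 r * t)] + p.[e r - Num.sqrt (s2 r * t)]) / 2.
  by rewrite divr_ge0 // addr_ge0 // p0.
rewrite /inner horner_sum !(horner_coef p) -big_split mulr_suml; apply: eq_bigr => m _ /=.
rewrite hornerZ -mulrDr -mulrA; congr (_ * _).
rewrite even_binomial sE mulrAC divff // mul1r horner_sum; apply: eq_bigr => i _.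
by rewrite hornerZ hornerXn -[LHS]mulrA -exprMn.
Qed.

Let outer (p : {poly R}) : {poly R} :=
  \sum_(m < size p) p`_m *:
     \sum_(k < m.+1) ('C(m, k)%:R * (P ^+ (m - k) * Q ^+ k) *
       (pochhammer (b + 1 + (m - k)%:R) k / pochhammer (b + 1) k)) *: 'X^k.

(** Expanding (P + Q r)^(m - 2 i) and collecting (Q r)^k leaves a sum over i, which
    [half_pochhammer] and [bin_product_identity] turn into the Chu-Vandermonde sum. *)
Lemma beta_inner (p : {poly R}) (r : R) :
  beta_fun (1 / 2) (b + 1) (inner p r) = (outer p).[r].
Proof.
have b1 : 0 < b + 1 by have /andP[? ?] := hb; lra.
rewrite /inner /outer linear_sum horner_sum; apply: eq_bigr => m _.
rewrite linearZ hornerZ; congr (_ * _); rewrite linear_sum horner_sum.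
pose H k := P ^+ (m - k) * (Q * r) ^+ k.
pose c i := 'C(m, i.*2)%:R * (4 ^+ i * kap i).
transitivity (\sum_(i < m.+1) c i * \sum_(j < (m - i.*2).+1) 'C(m - i.*2, j)%:R * H (i + j)%N).
  apply: eq_bigr => i _; rewrite linearZ /= /beta_fun linext_Xn -/(kap i).
  have [mi|im] := ltnP m i.*2; first by rewrite /c bin_small // !mul0r scale0r.
  rewrite /H /e /s2 /c; move: P (Q * r) => A B.
  rewrite exprDn mulr_sumr mulr_suml [LHS]mulr_suml mulr_sumr; apply: eq_bigr => j _.
  have jm := ltn_ord j; rewrite ltnS in jm.
  rewrite -mulr_natl !exprMn exprD (sub_double_split im jm) exprD.
  by move: (A ^+ _) (A ^+ _) => u v; ring.
have step (i : 'I_m.+1) : c i * \sum_(j < (m - i.*2).+1) 'C(m - i.*2, j)%:R * H (i + j)%N =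
   \sum_(k < m.+1) (if (i <= k)%N then c i * ('C(m - i.*2, k - i)%:R * H k) else 0).
  have [mi|im] := ltnP m i.*2.
    rewrite /c bin_small // !mul0r big1 // => k _; case: ifP => // _.
    by rewrite !mul0r.
  rewrite (sum_bin_shift H (m := m)); last by lia.
  by rewrite mulr_sumr; apply: eq_bigr => k _; case: ifP => // _; rewrite mulr0.
rewrite (eq_bigr _ (fun i _ => step i)) exchange_big /=; apply: eq_bigr => k _.
have km := ltn_ord k; rewrite ltnS in km.
rewrite hornerZ hornerXn.
rewrite -big_mkcond /=.
transitivity (H k * \sum_(i < k.+1) 'C(m, k)%:R * ('C(k, i)%:R *
    (((m - k) ^_ i)%:R / pochhammer (b + 1) i))).
  rewrite mulr_sumr (big_ord_widen m.+1 (fun i => H k * ('C(m, k)%:R * ('C(k, i)%:R *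
    (((m - k) ^_ i)%:R / pochhammer (b + 1) i))))) //.
  apply: eq_big => [i|i ik]; first by rewrite ltnS.
  have /(congr1 (fun n => n%:R : R)) := bin_product_identity ik km.
  rewrite !natrM -half_pochhammer => E.
  have i0 := @fact_neq0 R i.
  have pn : pochhammer (b + 1) i != 0 by rewrite gt_eqF // pochhammer_gt0.
  rewrite /c /kap.
  have E' : 'C(m, i.*2)%:R * 'C(m - i.*2, k - i)%:R * (4 ^+ i * pochhammer (1 / 2) i) =
     'C(m, k)%:R * 'C(k, i)%:R * ((m - k) ^_ i)%:R :> R.
    have := congr1 (fun z : R => z / i`!%:R) E; rewrite /= (mulfK i0) => E2.
    by rewrite -[RHS]E2; field; exact: i0.
  transitivity (H k * ('C(m, i.*2)%:R * 'C(m - i.*2, k - i)%:R * (4 ^+ i * pochhammer (1 / 2) i))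
     / pochhammer (b + 1) i); first by ring.
  by rewrite E'; ring.
rewrite -mulr_sumr vandermonde_pochhammer // /H.
move: P Q => A B; rewrite exprMn.
by move: (pochhammer _ _ / _) (A ^+ _) => u v; ring.
Qed.

(** The moment (b + 1)_k / k! of r^k cancels the denominator (b + 1)_k in [outer] and leaves
    [transl_coef]. *)
Lemma transl_beta (p : {poly R}) : (transl b Y p).[X] = beta_fun (b + 1) 1 (outer p).
Proof.
rewrite /transl /linext /outer horner_sum linear_sum; apply: eq_bigr => m _.
rewrite hornerZ linearZ; congr (_ * _).
rewrite /transl_mono horner_sum linear_sum; apply: eq_bigr => k _.
rewrite hornerZ linearZ /= /beta_fun linext_Xn hornerM !horner_exp hornerD hornerN hornerX hornerC.
have b1 : 0 < b + 1 by have /andP[? ?] := hb; lra.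
have pn := pochhammer_gt0 k b1; have kf := @fact_neq0 R k.
rewrite /GRing.scale /= pochhammer1 /transl_coef /P /Q !exprMn.
by field; rewrite kf gt_eqF.
Qed.

Lemma transl_ge0 (p : {poly R}) :
  (forall x, 0 <= x <= 1 -> 0 <= p.[x]) -> 0 <= (transl b Y p).[X].
Proof.
move=> p0; have /andP[b0 b1] := hb.
rewrite transl_beta; apply: beta_fun_ge0; try lra.
move=> r hr; rewrite -beta_inner; apply: beta_fun_ge0; try lra.
by move=> t ht; exact: inner_ge0.
Qed.

End TranslationPositivity.

(* Integration by parts against the weight [X^g]; only this identity is needed for
   orthogonality and for the reproducing property at [1]. *)
Definition jacobi_moment (R : realType) (g C : R) (phi : {linear {poly R} -> R^o}) : Prop :=
  forall v : {poly R}, phi ('X * v^`() + (g + 1) *: v) = C * v.[1].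

(** * Symmetry of the operator and orthogonality *)

Section MomentFunctional.
Context {R : realType}.
Variables (g C : R) (phi : {linear {poly R} -> R^o}).
Hypothesis g_gtN1 : -1 < g.
Hypothesis phiE : jacobi_moment g C phi.

(** Lagrange's identity: the difference is X V' + (g + 1) V with V = (1 - X)(p' q - p q'), and V(1)
    = 0. *)
Lemma jacobi_op_sym (p q : {poly R}) :
  phi (jacobi_op 0 g p * q) = phi (p * jacobi_op 0 g q).
Proof.
apply/eqP; rewrite -subr_eq0 -linearB /=; apply/eqP.
pose W := p^`() * q - p * q^`().
have -> : jacobi_op 0 g p * q - p * jacobi_op 0 g q =
    'X * ((1 - 'X) * W)^`() + (g + 1) *: ((1 - 'X) * W).
  rewrite /jacobi_op /W !(derivM, derivB, derivX, derivC) -!mul_polyC !polyCD polyC0.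
  by ring.
by rewrite phiE hornerM hornerD hornerN hornerC hornerX subrr mul0r mulr0.
Qed.

Lemma jacobi_eigenvalue_inj (m n : nat) : (m < n)%N ->
  n%:R * (n%:R + 0 + g + 1) - m%:R * (m%:R + 0 + g + 1) != 0 :> R.
Proof.
move=> mn; have h : m%:R + 1 <= n%:R :> R by rewrite natr1 ler_nat.
have m0 : 0 <= m%:R :> R by [].
have g1 := g_gtN1; move: (m%:R : R) (n%:R : R) h m0 => u v h u0.
have -> : v * (v + 0 + g + 1) - u * (u + 0 + g + 1) = (v - u) * (v + u + g + 1) by ring.
by rewrite mulf_neq0 // gt_eqF //; lra.
Qed.

(** Symmetry applied to X^m makes the difference of the eigenvalues times phi (J X^m) a multiple of
    phi (J X^(m-1)), which is 0 by induction; the eigenvalues are distinct. *)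
Lemma jacobi_orth_Xn (n m : nat) : (m < n)%N -> phi (jacobiX 0 g n * 'X^m) = 0.
Proof.
have := jacobiX_ode 0 g n; move: (jacobiX 0 g n) => J odeJ.
elim: m => [|m IH] mn.
  have op1 : jacobi_op 0 g (1 : {poly R}) = 0.
    by rewrite -(expr0 'X) jacobi_op_Xn !mul0r !scale0r subr0.
  have := jacobi_op_sym J 1.
  rewrite op1 mulr0 linear0 odeJ mulr1 linearZ /= expr0 mulr1 => /eqP.
  rewrite mulf_eq0 => /orP[|/eqP //].
  have := jacobi_eigenvalue_inj mn; rewrite mul0r subr0 oppr_eq0.
  by move=> /negbTE ->.
have := jacobi_op_sym J ('X^(m.+1)).
rewrite odeJ jacobi_op_Xn /= mulrBr -!scalerAl -!scalerAr linearB !linearZ /=.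
rewrite IH ?(ltnW mn) // scaler0 add0r => E.
apply/eqP; have := jacobi_eigenvalue_inj mn; apply: contraNT => h.
move: E; rewrite /GRing.scale /=; move: (phi _) h => z h Ez.
suff : (n%:R * (n%:R + 0 + g + 1) - m.+1%:R * (m.+1%:R + 0 + g + 1)) *
    z = 0 by move/eqP; rewrite mulf_eq0 (negPf h) orbF.
rewrite mulrBl; apply/eqP; rewrite subr_eq0 -eqr_opp -[X in X == _]mulNr -mulrN; apply/eqP.
by apply: (etrans Ez); rewrite mulrN.
Qed.

Lemma jacobi_orth (n : nat) (q : {poly R}) : (size q <= n)%N ->
  phi (jacobiX 0 g n * q) = 0.
Proof.
move=> qn; rewrite -[q]coefK poly_def mulr_sumr linear_sum big1 // => i _.
rewrite -scalerAr linearZ /= jacobi_orth_Xn ?scaler0 //.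
exact: leq_trans (ltn_ord i) qn.
Qed.

Lemma coef_jacobiX_lead (n : nat) : (jacobiX 0 g n)`_n != 0.
Proof.
rewrite /jacobiX coefZ mulf_neq0 ?invr_eq0 ?fact_neq0 // coef_sum big_ord_recr /=.
rewrite big1 ?add0r => [|k _]; last first.
  rewrite coefZ nth_default ?mulr0 // -polyC1 size_exp_XsubC.
  exact: ltn_ord.
rewrite coefZ -polyC1.
have := monic_exp n (monicXsubC (1 : R)); rewrite monicE lead_coefE size_exp_XsubC /=.
move=> /eqP ->; rewrite mulr1 binn subnn pochhammer0 mul1r mulr1 gt_eqF //.
case: n => [|n]; first by rewrite pochhammer0.
by apply: pochhammer_gt0; rewrite -natr1; have : 0 <= n%:R :> R by []; have := g_gtN1; lra.
Qed.

Lemma jacobiX_span (n : nat) (q : {poly R}) : (size q <= n)%N ->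
  exists c : nat -> R, q = \sum_(j < n) c j *: jacobiX 0 g j.
Proof.
elim: n q => [|n IH] q qn.
  by exists (fun=> 0); rewrite big_ord0; apply/eqP; rewrite -size_poly_leq0.
pose a := q`_n / (jacobiX 0 g n)`_n.
have [|c qE] := IH (q - a *: jacobiX 0 g n).
  apply/leq_sizeP => j nj; rewrite coefB coefZ.
  move: nj; rewrite leq_eqVlt => /predU1P[<-|nj].
    by rewrite divfK ?subrr // coef_jacobiX_lead.
  rewrite !nth_default ?mulr0 ?subrr //; first exact: leq_trans (size_jacobiX _ _ _) nj.
  exact: leq_trans qn nj.
exists (fun j => if j == n then a else c j).
rewrite big_ord_recr /= eqxx; apply/eqP; rewrite -subr_eq; apply/eqP.
by rewrite qE; apply: eq_bigr => j _; rewrite ltn_eqF.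
Qed.

End MomentFunctional.

(** * The reproducing kernel at 1 *)

Section Reproducing.
Context {R : realType}.
Variables (g C : R) (phi : {linear {poly R} -> R^o}).
Hypothesis g_gtN1 : -1 < g.
Hypothesis C_neq0 : C != 0.
Hypothesis phiE : jacobi_moment g C phi.

(** The functional for the weight raised by one power of X, with respect to which the polynomials of
    parameters (0, g + 1) are orthogonal. *)
Definition mulX_phi (p : {poly R}) : R^o := phi ('X * p).

Lemma mulX_phi_linear : linear mulX_phi.
Proof. by move=> c p q; rewrite /mulX_phi mulrDr -scalerAr linearP. Qed.

HB.instance Definition _ := GRing.isLinear.Build R {poly R} R^o _ mulX_phi mulX_phi_linear.

Lemma mulX_moment : jacobi_moment (g + 1) C mulX_phi.
Proof.
move=> v; rewrite /= /mulX_phi.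
have -> : 'X * ('X * v^`() + (g + 1 + 1) *: v) =
   'X * ('X * v)^`() + (g + 1) *: ('X * v).
  by rewrite derivM derivX -!mul_polyC !polyCD; ring.
by rewrite phiE hornerM hornerX mul1r.
Qed.

(** The product is X (J q)' + (g + 1) J q minus X J q'. The first part integrates to C q(1); the
    second to 0, because J is orthogonal to q', of degree below n, for the raised weight. *)
Lemma reproducing (n : nat) (q : {poly R}) : (size q <= n.+1)%N ->
  phi (euler_op (g + 1) (jacobiX 0 (g + 1) n) * q) = C * q.[1].
Proof.
move=> qn; set J := jacobiX 0 (g + 1) n.
have -> : euler_op (g + 1) J * q =
   ('X * (J * q)^`() + (g + 1) *: (J * q)) - 'X * (J * q^`()).
  by rewrite /euler_op derivM -!mul_polyC; ring.
rewrite linearB /= phiE hornerM jacobiX0_at1 mul1r.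
have g1 : -1 < g + 1 by have := g_gtN1; lra.
have sq : (size q^`() <= n)%N.
  have [->|q0] := eqVneq q 0; first by rewrite deriv0 size_poly0.
  by rewrite -ltnS; exact: (leq_trans (lt_size_deriv q0) qn).
have := jacobi_orth g1 mulX_moment sq; rewrite /= /mulX_phi -/J => ->.
by rewrite subr0.
Qed.

Lemma size_euler_op (b : R) (p : {poly R}) : (size (euler_op b p) <= size p)%N.
Proof.
apply/leq_sizeP => j pj; rewrite /euler_op coefD coefXderiv coefZ nth_default //.
by rewrite mul0rn mulr0 addr0.
Qed.

(** Testing an expansion with coefficients c_j against the j-th polynomial gives c_j phi (J_j^2) =
    C. As C is nonzero, this also shows that the norms do not vanish. *)
Lemma euler_op_expansion (n : nat) :
  (forall j, (j <= n)%N -> phi (jacobiX 0 g j * jacobiX 0 g j) != 0) /\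
  euler_op (g + 1) (jacobiX 0 (g + 1) n) =
  \sum_(j < n.+1) (C / phi (jacobiX 0 g j * jacobiX 0 g j)) *: jacobiX 0 g j.
Proof.
have [c cE] := jacobiX_span g_gtN1 (leq_trans (size_euler_op (g + 1) _) (size_jacobiX 0 (g + 1) n)).
have ch j : (j <= n)%N -> c j * phi (jacobiX 0 g j * jacobiX 0 g j) = C.
  move=> jn; have sj : (size (jacobiX 0 g j) <= n.+1)%N.
    by apply: leq_trans (size_jacobiX _ _ _) _; rewrite ltnS.
  have := reproducing sj; rewrite jacobiX0_at1 mulr1 cE mulr_suml linear_sum.
  have jn' : (j < n.+1)%N by rewrite ltnS.
  rewrite (bigD1 (Ordinal jn')) //= big1 ?addr0 => [|i ij].
    by rewrite -scalerAl linearZ.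
  rewrite -scalerAl linearZ /=.
  have {}ij : (i : nat) != j by move: ij; rewrite -val_eqE.
  have -> : phi (jacobiX 0 g i * jacobiX 0 g j) = 0; last by rewrite scaler0.
  move: ij; rewrite neq_ltn => /orP[ij|ji].
    rewrite mulrC; apply: (jacobi_orth g_gtN1 phiE).
    exact: leq_trans (size_jacobiX _ _ _) ij.
  apply: (jacobi_orth g_gtN1 phiE).
  exact: leq_trans (size_jacobiX _ _ _) ji.
have h0 j : (j <= n)%N -> phi (jacobiX 0 g j * jacobiX 0 g j) != 0.
  by move=> /ch; apply: contra_eq_neq => ->; rewrite mulr0 eq_sym.
split => //; rewrite cE; apply: eq_bigr => j _.
by rewrite -(ch j) ?leq_ord // mulfK // h0 // leq_ord.
Qed.

End Reproducing.

Definition jacobi_integrand (R : realType) (g : R) (p : {poly R}) (t : R) : R :=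
  p.[(1 + t) / 2] * (1 + t) `^ g.

(** Its values on monomials are the integrals of X^m (1 + t)^g over [-1, 1]; as a linear functional
    on polynomials it fits the algebraic lemmas on moments. *)
Definition jacobi_int (R : realType) (g : R) : {poly R} -> R^o :=
  linext (fun m => 2 `^ (g + 1) / (m%:R + g + 1) : R^o).

HB.instance Definition _ (R : realType) (g : R) := GRing.Linear.on (jacobi_int g).

(** * The weighted integral as a functional on polynomials *)

Section JacobiIntegral.
Context {R : realType}.
Variable g : R.
Hypothesis g_gtN1 : -1 < g.
Local Notation mu := (@lebesgue_measure R).
Implicit Types p q : {poly R}.

Lemma jacobi_integrandD p q t :
  jacobi_integrand g (p + q) t = jacobi_integrand g p t + jacobi_integrand g q t.
Proof. by rewrite /jacobi_integrand hornerD mulrDl. Qed.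

Lemma jacobi_integrandZ c p t : jacobi_integrand g (c *: p) t = c * jacobi_integrand g p t.
Proof. by rewrite /jacobi_integrand hornerZ mulrA. Qed.

Lemma jacobi_integrand_measurable p (D : set R) : measurable_fun D (jacobi_integrand g p).
Proof.
apply: (@measurable_funS _ _ _ _ setT) => //.
have ml : measurable_fun setT (fun x : R => 1 + x) by exact: measurable_funD.
apply: measurable_funM; last by apply: (measurableT_comp (@measurable_powR R g)).
apply: (@measurableT_comp _ _ _ _ _ _ (horner p)) => //.
  by apply: measurable_realfun.continuous_measurable_fun; exact: continuous_horner.
exact: measurable_funM.
Qed.

(** Presents X^m (1 + t)^g as the derivative of a constant times X^(m+g+1), so that the improper
    fundamental theorem evaluates the moments even when the weight is unbounded near -1. *)
Lemma kernel_prim'_monomial (m : nat) (t : R) : - 1 <= t ->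
  kernel_prim' (m%:R + g + 1) (2 `^ (g + 1) / (m%:R + g + 1))%:P t =
  jacobi_integrand g 'X^m t.
Proof.
move=> t1; have X0 : 0 <= (1 + t) / 2 by lra.
have m0 : 0 <= m%:R :> R by [].
have b0 : 0 < m%:R + g + 1 by have := g_gtN1; lra.
rewrite /kernel_prim' /jacobi_integrand /euler_op derivC mulr0 add0r hornerZ hornerC hornerXn.
rewrite addrK.
have tE : 1 + t = 2 * ((1 + t) / 2) by field.
set X := (1 + t) / 2 in X0 tE *; rewrite tE powRM //.
have -> : X `^ (m%:R + g) = X ^+ m * X `^ g.
  have [->|mn0] := eqVneq m 0%N; first by rewrite add0r expr0 mul1r.
  rewrite powRD ?powR_mulrn //.
  have m1 : 1 <= m%:R :> R by rewrite ler1n lt0n.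
  by rewrite gt_eqF //; have := g_gtN1; lra.
have -> : 2 `^ (g + 1) = 2 * 2 `^ g :> R.
  rewrite powRD; last by rewrite pnatr_eq0 implybT.
  by rewrite powRr1 // mulrC.
move: (_ ^+ m) (2 `^ g) (_ `^ g) b0 => u v w b0.
by field; rewrite gt_eqF.
Qed.

Lemma jacobi_integral_monomial (m : nat) :
  (\int[mu]_(t in `[(-1)%R, 1%R]) (jacobi_integrand g 'X^m t)%:E = (jacobi_int g 'X^m)%:E)%E.
Proof.
have m0 : 0 <= m%:R :> R by [].
have b0 : 0 < m%:R + g + 1 by have := g_gtN1; lra.
have lt11 : (-1 : R) < 1 by lra.
set c : R := 2 `^ (g + 1) / (m%:R + g + 1).
transitivity (\int[mu]_(t in `[(-1)%R, 1%R]) (kernel_prim' (m%:R + g + 1) c%:P t)%:E)%E.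
  apply: eq_integral => t; rewrite inE /= in_itv /= => /andP[t1 _].
  by rewrite kernel_prim'_monomial.
apply: (etrans (@ge0_improper_FTC R (-1) 1 (kernel_prim (m%:R + g + 1) c%:P)
  (kernel_prim' (m%:R + g + 1) c%:P) lt11 _ _ _ _)).
- exact: kernel_prim_within.
- by move=> t /andP[t1 _]; exact: is_derive_kernel_prim.
- by move=> t /andP[t1 _]; exact: is_derive_continuous (is_derive_kernel_prim' _ _ t1).
- move=> t /andP[t1 _]; rewrite kernel_prim'_monomial ?(ltW t1) //.
  by rewrite /jacobi_integrand hornerXn mulr_ge0 ?powR_ge0 // exprn_ge0 //; lra.
rewrite /kernel_prim subrr mul0r powR0 ?gt_eqF // mul0r subr0 hornerC /jacobi_int linext_Xn.
have -> : (1 + 1) / 2 = 1 :> R by field.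
by rewrite powR1 mul1r.
Qed.

Lemma jacobi_integral p :
  mu.-integrable `[-1, 1] (EFin \o jacobi_integrand g p) /\
  (\int[mu]_(t in `[(-1)%R, 1%R]) (jacobi_integrand g p t)%:E = (jacobi_int g p)%:E)%E.
Proof.
have mono m : mu.-integrable `[-1, 1] (EFin \o jacobi_integrand g 'X^m).
  apply/integrableP; split.
    by apply/measurable_EFinP; exact: jacobi_integrand_measurable.
  rewrite (_ : (\int[mu]_(x in _) _)%E = (jacobi_int g 'X^m)%:E) ?ltry //.
  rewrite -jacobi_integral_monomial; apply: eq_integral => t; rewrite inE /= in_itv /= => /andP[t1 _].
  rewrite ger0_norm // /jacobi_integrand hornerXn mulr_ge0 ?powR_ge0 // exprn_ge0 //; lra.
have term (c : R) m : mu.-integrable `[-1, 1] (EFin \o jacobi_integrand g (c *: 'X^m)) /\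
    (\int[mu]_(t in `[(-1)%R, 1%R]) (jacobi_integrand g (c *: 'X^m) t)%:E = (jacobi_int g (c *: 'X^m))%:E)%E.
  have E : (fun t => (jacobi_integrand g (c *: 'X^m) t)%:E) =
      (fun t => c%:E * (EFin \o jacobi_integrand g 'X^m) t)%E.
    by apply/funext => t; rewrite jacobi_integrandZ EFinM.
  split; first by rewrite [X in _.-integrable _ X]E; exact: integrableZl.
  by rewrite E integralZl //= jacobi_integral_monomial linearZ.
have sum0 : mu.-integrable `[-1, 1] (EFin \o jacobi_integrand g 0) /\
  (\int[mu]_(t in `[(-1)%R, 1%R]) (jacobi_integrand g 0 t)%:E = (jacobi_int g 0)%:E)%E.
  by have := term 0 0%N; rewrite scale0r.
rewrite -[p]coefK poly_def; elim/big_ind: _ => // [q r [q1 q2] [r1 r2]].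
have E : (fun t => (jacobi_integrand g (q + r) t)%:E) =
   ((EFin \o jacobi_integrand g q) \+ (EFin \o jacobi_integrand g r))%E.
  by apply/funext => t; rewrite jacobi_integrandD.
split; first by rewrite [X in _.-integrable _ X]E; exact: integrableD.
by rewrite E integralD_EFin //= q2 r2 linearD.
Qed.

Lemma jacobi_int_moment : jacobi_moment g (2 `^ (g + 1)) (jacobi_int g).
Proof.
pose f : {linear {poly R} -> R^o} := jacobi_int g.
move=> v; rewrite -/f -[v]coefK poly_def.
elim/big_ind: _ => [|p q hp hq|i _].
- by rewrite deriv0 mulr0 scaler0 addr0 linear0 horner0 mulr0.
- by rewrite derivD mulrDr scalerDr addrACA linearD /= hp hq hornerD mulrDr.
rewrite derivZ derivXn -scalerAr hornerZ hornerXn expr1n mulr1.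
have -> : 'X * ('X^(i.-1) *+ i) = i%:R *: 'X^i :> {poly R}.
  by case: (nat_of_ord i) => [|k] /=; rewrite ?mulr0n ?mulr0 ?scale0r // mulrnAr -exprS scaler_nat.
rewrite [(g + 1) *: _]scalerA mulrC -scalerA -scalerDr -scalerDl !linearZ /= /f /jacobi_int linext_Xn.
have i0 : 0 <= i%:R :> R by [].
have b0 : 0 < i%:R + g + 1 by have := g_gtN1; lra.
rewrite /GRing.scale /= addrA; move: (2 `^ _) (v`_i) => ? ?.
by field; rewrite gt_eqF.
Qed.

Lemma jacobi_int_ge0 p : (forall x, 0 <= x <= 1 -> 0 <= p.[x]) -> 0 <= (jacobi_int g p : R).
Proof.
move=> p0; rewrite -lee_fin -(jacobi_integral p).2; apply: integral_ge0 => t.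
rewrite /= in_itv /= => /andP[t0 t1]; rewrite lee_fin mulr_ge0 ?powR_ge0 // p0 //.
by apply/andP; split; lra.
Qed.

End JacobiIntegral.

(** * Approximation of |p| from above by polynomials *)

Section PolynomialAbs.
Context {R : realType}.
Implicit Types p q : {poly R}.

Lemma poly_bound01 p : exists2 M, 0 < M & forall x, 0 <= x <= 1 -> `|p.[x]| <= M.
Proof.
exists (1 + \sum_(i < size p) `|p`_i|); first by rewrite ltr_pwDl // sumr_ge0.
move=> x /andP[x0 x1]; rewrite horner_coef; apply: le_trans (ler_norm_sum _ _ _) _.
rewrite -[leLHS]add0r lerD //; apply: ler_sum => i _.
by rewrite normrM ler_piMr // ger0_norm ?exprn_ge0 // exprn_ile1.
Qed.

(** The error e = t - q becomes e (1 - (t + q) / 2) <= e (1 - e / 2), which preserves the rate 2 /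
    (k + 1). *)
Lemma abs_recursion_step (k t q : R) : 0 <= k -> 0 <= q <= t -> t <= 1 ->
  (t - q) * (k + 1) <= 2 ->
  0 <= q + (t ^+ 2 - q ^+ 2) / 2 <= t /\ (t - (q + (t ^+ 2 - q ^+ 2) / 2)) * (k + 1 + 1) <= 2.
Proof.
move=> k0 /andP[q0 qt] t1 h; split; first by apply/andP; split; nra.
have e1 : (t - q) * (1 - (t - q) * (k + 1) / 2) <= 1 - (t - q) * (k + 1) / 2 by nra.
have e2 : t - (q + (t ^+ 2 - q ^+ 2) / 2) <= (t - q) * (1 - (t - q) / 2) by nra.
have e3 : (t - (q + (t ^+ 2 - q ^+ 2) / 2)) * (k + 1 + 1) <=
   (t - q) * (1 - (t - q) / 2) * (k + 1 + 1) by rewrite ler_wpM2r //; lra.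
apply: le_trans e3 _; move: e1 h; move: (t - q) => e e1 h.
have := sqr_ge0 e; nra.
Qed.

(* The partial solutions of [q' = q + (p^2 - q^2)/2] increase to [|p|] wherever
   [|p| <= 1]. *)
Lemma poly_abs_approx p (e : R) : 0 < e -> exists h : {poly R}, forall x, 0 <= x <= 1 ->
  `|p.[x]| <= h.[x] <= `|p.[x]| + e.
Proof.
move=> e0; have [M M0 pM] := poly_bound01 p.
pose P := M^-1 *: p.
pose q k : {poly R} := iter k (fun q => q + 2^-1 *: (P ^+ 2 - q ^+ 2)) 0.
have qP k x : 0 <= x <= 1 -> 0 <= (q k).[x] <= `|P.[x]| /\ (`|P.[x]| - (q k).[x]) * (k%:R + 1) <= 2.
  move=> x01; have P1 : `|P.[x]| <= 1.
    by rewrite /P hornerZ normrM gtr0_norm ?invr_gt0 // mulrC ler_pdivrMr // mul1r pM.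
  elim: k => [|k [IH1 IH2]].
    by rewrite /q /= horner0 lexx normr_ge0 add0r mulr1 subr0; split => //; lra.
  have -> : (q k.+1).[x] = (q k).[x] + (`|P.[x]| ^+ 2 - (q k).[x] ^+ 2) / 2.
    rewrite /q iterS -/(q k) real_normK ?num_real //.
    move: (q k) => a; rewrite hornerD hornerZ hornerD hornerN !horner_exp.
    by move: (P.[x]) (a.[x]) => u v; field.
  by rewrite -[k.+1%:R]natr1; exact: abs_recursion_step.
pose N := Num.bound (2 * M / e).
exists (M *: q N + e%:P) => x x01; have [/andP[_ h1] h2] := qP N x x01.
rewrite hornerD hornerZ hornerC.
have pE : `|p.[x]| = M * `|P.[x]|.
  by rewrite /P hornerZ normrM (gtr0_norm (x := M^-1)) ?invr_gt0 // mulrA divff ?gt_eqF // mul1r.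
have N0 : 0 < N%:R + 1 :> R by rewrite ltr_wpDl.
have hN : 2 * M < e * (N%:R + 1).
  have := archi_boundP (divr_ge0 (mulr_ge0 (ler0n R 2) (ltW M0)) (ltW e0)).
  rewrite -/N ltr_pdivrMr // => h; apply: lt_trans h _.
  by rewrite mulrDr mulr1 [e * _]mulrC ltrDl.
rewrite pE; apply/andP; split; last by rewrite lerD2r ler_pM2l.
have h3 : (`|P.[x]| - (q N).[x]) * M * (N%:R + 1) <= e * (N%:R + 1).
  by rewrite mulrAC; apply: le_trans (ltW hN); rewrite ler_wpM2r // ltW.
rewrite ler_pM2r // in h3; move: h3; rewrite mulrBl ![_ * M]mulrC; lra.
Qed.

End PolynomialAbs.

(** * Integrals of translates, and a negative value of the Jacobi polynomial *)

Section Positivity.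
Context {R : realType}.
Variable g : R.
Hypothesis g_gtN1 : -1 < g.
Local Notation mu := (@lebesgue_measure R).
Implicit Types p q : {poly R}.

Let phiE := jacobi_int_moment g_gtN1.

Lemma jacobi_int_jacobi_op p : jacobi_int g (jacobi_op 0 g p) = 0.
Proof.
have op1 : jacobi_op 0 g (1 : {poly R}) = 0.
  by rewrite -(expr0 'X) jacobi_op_Xn !mul0r !scale0r subr0.
by have := jacobi_op_sym phiE p 1; rewrite op1 mulr0 mulr1 linear0.
Qed.

(** Images of the Jacobi operator integrate to 0, so integrating [transl_monoS_op] gives the
    translates of X^m the recurrence in m that the moments satisfy. *)
Lemma jacobi_int_transl Y p : jacobi_int g (transl g Y p) = jacobi_int g p.
Proof.
pose f : {linear {poly R} -> R^o} := jacobi_int g \o transl g Y.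
apply: (@linear_Xn_ext R _ f (jacobi_int g)) => i; rewrite /f /= {1}/transl linext_Xn.
elim: i => [|m IH]; first by rewrite transl_mono0 expr0.
have := jacobi_int_jacobi_op (transl_mono g Y m.+1).
rewrite transl_monoS_op linearB !linearZ /= IH.
move: (jacobi_int g (transl_mono g Y m.+1)) => z; rewrite /jacobi_int !linext_Xn.
rewrite /GRing.scale /= -[m.+1%:R]natr1.
have m0 : 0 <= m%:R :> R by [].
have g1 := g_gtN1.
move: (m%:R) (2 `^ _) m0 => u c u0 E.
have h1 : 0 < u + g + 1 by lra.
have h2 : 0 < u + 1 + g + 1 by lra.
have k1 : (u + 1) * (u + 1 + g + 1) != 0 by rewrite gt_eqF // mulr_gt0 //; lra.
apply: (mulfI k1); apply/esym; rewrite -[RHS]add0r -E.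
by field; rewrite !gt_eqF.
Qed.

(** J is orthogonal to 1 for the weight X^(g+1). If J were nonnegative with bound M, the weighted
    integral of J^2 would be at most M times that of J, hence 0, against the nonvanishing of the
    norm. *)
Lemma jacobi_negative_value (n : nat) :
  exists2 x, 0 < x < 1 & (jacobiX 0 (g + 1) n.+1).[x] < 0.
Proof.
have phi1E := mulX_moment phiE.
have g1 : -1 < g + 1 by have := g_gtN1; lra.
have C0 : 2 `^ (g + 1) != 0 :> R by rewrite gt_eqF // powR_gt0.
have J1 := jacobiX0_at1 (g + 1) n.+1.
have [h0 _] := euler_op_expansion g1 C0 phi1E n.+1.
have {h0} := h0 _ (leqnn _).
have := jacobi_orth g1 phi1E (n := n.+1) (q := 1); rewrite size_poly1 => /(_ isT).
rewrite mulr1 /= /mulX_phi.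
move: (jacobiX 0 (g + 1) n.+1) J1 => J J1 orth nz.
apply/not_exists2P => neg; move: nz; apply/negP; rewrite negbK.
have J0 x : 0 < x <= 1 -> 0 <= J.[x].
  move=> /andP[x0]; rewrite le_eqVlt => /predU1P[->|x1]; first by rewrite J1.
  by rewrite leNgt; apply/negP => Jx; case: (neg x) => //; rewrite x0 x1.
have [M M0 JM] := poly_bound01 J.
have a1 : 0 <= (jacobi_int g ('X * (J * J)) : R).
  apply: jacobi_int_ge0 => // x /andP[x0 _].
  by rewrite !hornerM hornerX mulr_ge0 // -expr2 sqr_ge0.
have a2 : 0 <= (jacobi_int g ('X * (J * (M%:P - J))) : R).
  apply: jacobi_int_ge0 => // x /andP[]; rewrite le_eqVlt => /predU1P[<- _|x0 x1].
    by rewrite hornerM hornerX mul0r.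
  rewrite !hornerM hornerX hornerD hornerN hornerC !mulr_ge0 ?(ltW x0) //.
    by rewrite J0 // x0.
  by rewrite subr_ge0 (le_trans (ler_norm _)) // JM // (ltW x0).
have E : 'X * (J * (M%:P - J)) = M *: ('X * J) - 'X * (J * J).
  by rewrite -mul_polyC; ring.
rewrite E linearB linearZ /= orth scaler0 in a2.
by rewrite eq_le a1 andbT -oppr_ge0; move: a2; rewrite add0r.
Qed.

End Positivity.

(** * The Lebesgue function and its maximum at x = 1 *)

Section LebesgueFunction.
Context {R : realType}.
Variable g : R.
Hypothesis g_gtN1 : -1 < g.
Local Notation mu := (@lebesgue_measure R).
Implicit Types p q : {poly R}.

Lemma jacobi_norm2E j :
  jacobi_norm2 0 g j = jacobi_int g (jacobiX 0 g j * jacobiX 0 g j).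
Proof.
rewrite /jacobi_norm2 /Rintegral.
have -> : (jacobi_int g (jacobiX 0 g j * jacobiX 0 g j) : R) =
  fine (jacobi_int g (jacobiX 0 g j * jacobiX 0 g j))%:E by [].
congr fine; rewrite -(jacobi_integral g_gtN1 _).2; apply: eq_integral => t _.
rewrite /= /jacobi_weight powRr0 mul1r jacobi_horner /jacobi_integrand hornerM.
by rewrite expr2.
Qed.

(** K_n(1, .) in the variable X; the factor 2^(g+1) is the constant in [jacobi_int_moment]. *)
Definition kernel_at1 (n : nat) : {poly R} :=
  (2 `^ (g + 1))^-1 *: euler_op (g + 1) (jacobiX 0 (g + 1) n).

Lemma jacobi_kernelE n x t :
  jacobi_kernel 0 g n x t = (transl g ((1 + x) / 2) (kernel_at1 n)).[(1 + t) / 2].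
Proof.
have C0 : 2 `^ (g + 1) != 0 :> R by rewrite gt_eqF // powR_gt0.
have [h0 E] := euler_op_expansion g_gtN1 C0 (jacobi_int_moment g_gtN1) n.
rewrite /kernel_at1 E scaler_sumr linear_sum horner_sum; apply: eq_bigr => j _.
rewrite scalerA linearZ /= transl_jacobi jacobi_norm2E !jacobi_horner scalerA.
have := h0 j; rewrite -ltnS ltn_ord => /(_ isT).
move: (jacobi_int g (jacobiX 0 g j * jacobiX 0 g j)) (jacobiX 0 g j) => N J N0; rewrite hornerZ.
by field; rewrite C0 N0.
Qed.

Lemma lebesgue_functionE n x : lebesgue_function 0 g n x =
  (\int[mu]_(t in `[(-1)%R, 1%R])
     `|jacobi_integrand g (transl g ((1 + x) / 2) (kernel_at1 n)) t|%:E)%E.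
Proof.
apply: eq_integral => t _; rewrite jacobi_kernelE /jacobi_weight powRr0 mul1r.
by rewrite /jacobi_integrand normrM [`|_ `^ _|]ger0_norm ?powR_ge0.
Qed.

(* A positive operator preserving the integral contracts the L^1 norm; the
   operator being defined on polynomials only, [|p|] is approximated from above. *)
Lemma transl_integral_abs_le (Y : R) p : - (1 / 2) <= g <= 0 -> 0 <= Y <= 1 ->
  (\int[mu]_(t in `[(-1)%R, 1%R]) `|jacobi_integrand g (transl g Y p) t|%:E <=
   \int[mu]_(t in `[(-1)%R, 1%R]) `|jacobi_integrand g p t|%:E)%E.
Proof.
move=> gle Y01; apply/lee_addgt0Pr => e e0.
have c0 : 0 < (jacobi_int g 1 : R).
  rewrite -(expr0 'X) /jacobi_int linext_Xn divr_gt0 ?powR_gt0 //.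
  by have := g_gtN1; rewrite add0r; lra.
have [h hp] := poly_abs_approx p (divr_gt0 e0 c0).
have X01 (t : R) : -1 <= t <= 1 -> 0 <= (1 + t) / 2 <= 1.
  by move=> /andP[? ?]; apply/andP; split; lra.
have mabs q (D : set R) : measurable_fun D (fun t => (`|jacobi_integrand g q t|)%:E).
  apply/measurable_EFinP; apply: measurableT_comp => //.
  exact: jacobi_integrand_measurable.
apply: (@le_trans _ _ (\int[mu]_(t in `[(-1)%R, 1%R]) (jacobi_integrand g (transl g Y h) t)%:E)%E).
  apply: ge0_le_integral => //.
  - exact: mabs.
  - by apply/measurable_EFinP; exact: jacobi_integrand_measurable.
  move=> t; rewrite /= in_itv /= => /X01 x01.
  rewrite lee_fin normrM [`|_ `^ _|]ger0_norm ?powR_ge0 // ler_wpM2r ?powR_ge0 //.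
  have hx x : 0 <= x <= 1 -> - h.[x] <= p.[x] <= h.[x].
    by move=> /hp /andP[h1 _]; rewrite -ler_norml.
  have a1 : 0 <= (transl g Y (h - p)).[(1 + t) / 2].
    by apply: transl_ge0 => // x /hx /andP[h1 h2]; rewrite hornerD hornerN; lra.
  have a2 : 0 <= (transl g Y (h + p)).[(1 + t) / 2].
    by apply: transl_ge0 => // x /hx /andP[h1 h2]; rewrite hornerD; lra.
  move: a1 a2; rewrite linearB linearD /= !hornerD hornerN => a1 a2.
  by rewrite ler_norml; apply/andP; split; lra.
rewrite (jacobi_integral g_gtN1 _).2 jacobi_int_transl // -(jacobi_integral g_gtN1 _).2.
have -> : e%:E = (\int[mu]_(t in `[(-1)%R, 1%R]) (jacobi_integrand g (e / jacobi_int g 1)%:P t)%:E)%E.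
  by rewrite (jacobi_integral g_gtN1 _).2 -[(_)%:P]mulr1 mul_polyC linearZ /= /GRing.scale /= divfK // gt_eqF.
have cint t : 0 <= jacobi_integrand g (e / jacobi_int g 1)%:P t.
  by rewrite /jacobi_integrand hornerC mulr_ge0 ?powR_ge0 // divr_ge0 // ltW.
rewrite -ge0_integralD //; last 3 first.
- exact: mabs.
- by move=> t _; rewrite lee_fin.
- by apply/measurable_EFinP; exact: jacobi_integrand_measurable.
apply: ge0_le_integral => //.
- move=> t; rewrite /= in_itv /= => /X01 /hp /andP[h1 _]; rewrite lee_fin mulr_ge0 ?powR_ge0 //.
  exact: le_trans h1.
- by apply/measurable_EFinP; exact: jacobi_integrand_measurable.
- apply: emeasurable_funD; first exact: mabs.
  by apply/measurable_EFinP; exact: jacobi_integrand_measurable.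
move=> t; rewrite /= in_itv /= => /X01 /hp /andP[_ h2].
rewrite -EFinD lee_fin /jacobi_integrand normrM [`|_ `^ _|]ger0_norm ?powR_ge0 // -mulrDl.
by rewrite ler_wpM2r ?powR_ge0 // hornerC.
Qed.

Lemma transl1 p : transl g 1 p = p.
Proof.
apply: (@linear_Xn_ext R _ (transl g 1) idfun) => i.
rewrite /= /transl linext_Xn /transl_mono big_ord_recl big1 => [|k _].
  rewrite /transl_coef bin0 pochhammer0 fact0 divr1 subn0 expr1n !expr0 !mulr1.
  by rewrite scale1r addr0.
by rewrite lift0 subrr expr0n /= !mulr0 scale0r.
Qed.

Lemma jacobi_integrand_kernel_at1 n t : -1 <= t ->
  jacobi_integrand g (kernel_at1 n) t = kernel_prim' (g + 1) (jacobiX 0 (g + 1) n) t.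
Proof.
move=> t1; rewrite /jacobi_integrand /kernel_at1 /kernel_prim' addrK hornerZ.
have X0 : 0 <= (1 + t) / 2 by lra.
have tE : 1 + t = 2 * ((1 + t) / 2) by field.
set X := (1 + t) / 2 in X0 tE *; rewrite tE powRM // powRD; last by rewrite pnatr_eq0 implybT.
rewrite powRr1 //; have : 2 `^ g != 0 :> R by rewrite gt_eqF // powR_gt0.
move: (2 `^ g) (_.[X]) (X `^ g) => u v w u0.
by field; rewrite u0.
Qed.

Lemma lebesgue_constantE n : - (1 / 2) <= g <= 0 ->
  lebesgue_constant 0 g n = (\int[mu]_(t in `[(-1)%R, 1%R])
    (`|kernel_prim' (g + 1) (jacobiX 0 (g + 1) n) t|)%:E)%E.
Proof.
move=> gle; transitivity (\int[mu]_(t in `[(-1)%R, 1%R]) (`|jacobi_integrand g (kernel_at1 n) t|)%:E)%E.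
  apply/eqP; rewrite eq_le; apply/andP; split.
    apply: ub_ereal_sup => _ [x + <-]; rewrite /= in_itv /= => /andP[x0 x1].
    by rewrite lebesgue_functionE transl_integral_abs_le //; apply/andP; split; lra.
  apply: ereal_sup_ubound; exists 1; first by rewrite /= in_itv /= lexx andbT; lra.
  rewrite lebesgue_functionE; have -> : (1 + 1) / 2 = 1 :> R by field.
  by rewrite transl1.
apply: eq_integral => t; rewrite inE /= in_itv /= => /andP[t1 _].
by rewrite jacobi_integrand_kernel_at1.
Qed.

End LebesgueFunction.

(** * The reflection exchanging the two parameters *)

Section Reflection.
Context {R : realType}.
Implicit Types a b : R.
Local Notation mu := (@lebesgue_measure R).

Lemma ge0_integral_reflect (f : R -> \bar R) :
  measurable_fun [set: R] f -> (forall t, (0 <= f t)%E) ->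
  (\int[mu]_(t in `[(-1)%R, 1%R]) f (- t)%R = \int[mu]_(t in `[(-1)%R, 1%R]) f t)%E.
Proof.
move=> mf f0; have E : (-%R : _ -> measurableTypeR R) @^-1` `[(-1)%R, 1%R]%classic = `[(-1)%R, 1%R]%classic.
  by rewrite opp_preimage_itvbndbnd opprK.
rewrite -[in LHS]E -ge0_integral_pushforward //=.
  by apply: eq_measure_integral => //= A mA _; exact: lebesgue_measureN.
exact: measurable_funS mf.
Qed.

Lemma measurable_jacobi_weight a b : measurable_fun setT (jacobi_weight a b).
Proof.
apply: measurable_funM.
  apply: (measurableT_comp (@measurable_powR R a)); exact: measurable_funB.
by apply: (measurableT_comp (@measurable_powR R b)); exact: measurable_funD.
Qed.

Lemma jacobi_weight_reflect a b t : jacobi_weight a b (- t) = jacobi_weight b a t.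
Proof. by rewrite /jacobi_weight opprK mulrC. Qed.

Lemma jacobi_weight_ge0 a b t : 0 <= jacobi_weight a b t.
Proof. by rewrite /jacobi_weight mulr_ge0 ?powR_ge0. Qed.

Lemma measurable_horner (p : {poly R}) : measurable_fun setT (horner p).
Proof. by apply: measurable_realfun.continuous_measurable_fun; exact: continuous_horner. Qed.

Lemma jacobi_reflect a b n : -1 < a -> -1 < b -> exists2 c : R, c != 0 &
  forall t, (jacobi a b n).[- t] = c * (jacobi b a n).[t].
Proof.
move=> a1 b1; have [c c0 cE] := jacobiX_reflect n a1 b1.
exists c => // t; rewrite !jacobi_horner.
have -> : (1 + - t) / 2 = (1 - 'X).[(1 + t) / 2].
  by rewrite hornerD hornerN hornerX hornerC; field.
by rewrite -horner_comp cE hornerZ.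
Qed.

Lemma jacobi_norm2_reflect a b n (c : R) : c != 0 ->
  (forall t, (jacobi a b n).[- t] = c * (jacobi b a n).[t]) ->
  jacobi_norm2 a b n = c ^+ 2 * jacobi_norm2 b a n.
Proof.
move=> c0 cE; rewrite /jacobi_norm2 /Rintegral.
pose w p a b t := (p.[t] ^+ 2 * jacobi_weight a b t)%:E.
have wm p a' b' (D : set R) : measurable_fun D (w p a' b').
  apply: (@measurable_funS _ _ _ _ setT) => //.
  apply/measurable_EFinP; apply: measurable_funM; last exact: measurable_jacobi_weight.
  by apply: measurable_funX; exact: measurable_horner.
have w0 p a' b' t : (0 <= w p a' b' t)%E.
  by rewrite lee_fin mulr_ge0 ?sqr_ge0 ?jacobi_weight_ge0.
have E t : w (jacobi a b n) a b (- t) = ((c ^+ 2)%:E * w (jacobi b a n) b a t)%E.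
  rewrite /w cE jacobi_weight_reflect -EFinM; congr (_%:E).
  by move: (_.[t]) (jacobi_weight _ _ _) => u v; ring.
have I : (\int[mu]_(t in `[(-1)%R, 1%R]) w (jacobi a b n) a b t =
    (c ^+ 2)%:E * \int[mu]_(t in `[(-1)%R, 1%R]) w (jacobi b a n) b a t)%E.
  rewrite -(ge0_integral_reflect (wm (jacobi a b n) a b setT) (w0 _ _ _)).
  rewrite -ge0_integralZl //; last 2 first.
  - exact: wm.
  - by rewrite lee_fin sqr_ge0.
  by apply: eq_integral => t _; exact: E.
transitivity (fine ((c ^+ 2)%:E * \int[mu]_(t in `[(-1)%R, 1%R]) w (jacobi b a n) b a t)%E).
  by rewrite -I.
have c2 : (0 < (c ^+ 2)%:E)%E by rewrite lte_fin exprn_even_gt0.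
(* A positive factor keeps an infinite integral infinite, and there [fine] gives 0 on both sides. *)
rewrite /w; case: (\int[mu]_(t in _) _)%E => [r| |] //=.
- by rewrite gt0_muley // mulr0.
- by rewrite gt0_muleNy // mulr0.
Qed.

Lemma jacobi_kernel_reflect a b n x t : -1 < a -> -1 < b ->
  jacobi_kernel a b n (- x) (- t) = jacobi_kernel b a n x t.
Proof.
move=> a1 b1; apply: eq_bigr => j _.
have [c c0 cE] := jacobi_reflect j a1 b1.
rewrite !cE (jacobi_norm2_reflect c0 cE) mulrACA -expr2 -mulf_div divff ?expf_neq0 //.
by rewrite mul1r.
Qed.

Lemma lebesgue_function_reflect a b n x : -1 < a -> -1 < b ->
  lebesgue_function a b n (- x) = lebesgue_function b a n x.
Proof.
move=> a1 b1; rewrite /lebesgue_function -ge0_integral_reflect.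
- apply: eq_integral => t _.
  by rewrite jacobi_kernel_reflect // jacobi_weight_reflect.
- apply/measurable_EFinP; apply: measurable_funM; last exact: measurable_jacobi_weight.
  apply: measurableT_comp => //; apply: measurable_sum => j.
  by apply: measurable_funM => //; apply: measurable_funM => //; exact: measurable_horner.
- by move=> t; rewrite lee_fin mulr_ge0 ?jacobi_weight_ge0.
Qed.

Lemma lebesgue_constant_reflect a b n : -1 < a -> -1 < b ->
  lebesgue_constant a b n = lebesgue_constant b a n.
Proof.
move=> a1 b1; congr ereal_sup.
have x01 (x : R) : `[-1, 1]%classic x -> `[-1, 1]%classic (- x).
  by rewrite /= !in_itv /= => /andP[? ?]; apply/andP; split; lra.
apply/seteqP; split => _ [x /x01 x1 <-]; exists (- x) => //.
- exact: lebesgue_function_reflect.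
- exact: lebesgue_function_reflect.
Qed.

End Reflection.

Lemma lebesgue_constant_lt (R : realType) (g : R) (n : nat) : - (1 / 3) <= g <= 0 ->
  (lebesgue_constant 0 g n < lebesgue_constant 0 g n.+1)%E.
Proof.
move=> /andP[g0 g1]; have gN1 : -1 < g by lra.
have gh : - (1 / 2) <= g <= 0 by apply/andP; split; lra.
rewrite !lebesgue_constantE //.
(* With b = g + 1 this is (k + 1)(k + b), written as the eigenvalue plus b, the form in which
   [jacobi_op_euler] delivers it. *)
pose m k : R := k%:R * (k%:R + 0 + (g + 1) + 1) + (g + 1).
have ode k x : (1 - x) * (euler_op (g + 1) (jacobiX 0 (g + 1) k))^`().[x] =
    (euler_op (g + 1) (jacobiX 0 (g + 1) k)).[x] - m k * (jacobiX 0 (g + 1) k).[x].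
  by apply: jacobi_op_euler; exact: jacobiX_ode.
have [x x01 Jx] := jacobi_negative_value gN1 n.
have n0 : 0 <= n%:R :> R by [].
apply: (variation_lt (mu1 := m n) (mu2 := m n.+1) _ _ _ _ _ (ode n) (ode n.+1) x01 Jx).
- by apply/andP; split; lra.
- by rewrite /m; nra.
- by rewrite /m -[n.+1%:R]natr1; nra.
- exact: jacobiX0_at1.
- exact: jacobiX0_at1.
Qed.

Theorem theorem5p4 (R : realType) :
  (forall beta : R, - (1 / 3) <= beta <= 0 ->
     forall n : nat,
       (lebesgue_constant 0%R beta n < lebesgue_constant 0%R beta n.+1)%E) /\
  (forall gamma : R, - (1 / 3) <= gamma <= 0 ->
     forall n : nat,
       (lebesgue_constant gamma 0%R n < lebesgue_constant gamma 0%R n.+1)%E).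
Proof.
split=> g hg n; first exact: lebesgue_constant_lt.
have g1 : -1 < g by move: hg => /andP[? _]; lra.
have z1 : -1 < 0 :> R by rewrite ltrN10.
by rewrite !(lebesgue_constant_reflect _ g1 z1); exact: lebesgue_constant_lt.
Qed.
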